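(* Let $n\in\mathbb N$. There is a smooth bounded function $m$ on $\mathbb R^{2n}$ belonging to the space $L^4(\mathbb R^{2n})$ which has bounded partial derivatives of all orders and for which the associated bilinear multiplier operator $T_m$ is unbounded from $L^2(\mathbb R^n)\times L^2(\mathbb R^n)$ to $L^1(\mathbb R^n)$.
   Context: The Fourier transform on $\mathbb R^n$ is $\widehat f(\xi)=\int_{\mathbb R^n} f(x)e^{-2\pi i x\cdot\xi}\,dx$. For a bounded function $m$ on $\mathbb R^{2n}=\mathbb R^n\times\mathbb R^n$, the bilinear multiplier operator $T_m$ is defined for Schwartz functions $f,g$ on $\mathbb R^n$ by $$T_m(f,g)(x)=\int_{\mathbb R^n}\int_{\mathbb R^n}m(\xi,\eta)\widehat f(\xi)\widehat g(\eta)e^{2\pi i x\cdot(\xi+\eta)}\,d\xi\,d\eta,\quad x\in\mathbb R^n.$$ $T_m$ is unbounded from $L^2(\mathbb R^n)\times L^2(\mathbb R^n)$ to $L^1(\mathbb R^n)$ if there is no finite constant $C$ with $\|T_m(f,g)\|_{L^1}\le C\|f\|_{L^2}\|g\|_{L^2}$ for all Schwartz functions $f,g$ on $\mathbb R^n$. *)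

(* Defs.v *)
From HB Require Import structures.
From mathcomp Require Import all_boot all_order all_algebra.
From mathcomp Require Import all_classical all_reals all_analysis.
From mathcomp Require Export complex.

Set Implicit Arguments.
Unset Strict Implicit.
Unset Printing Implicit Defensive.
Import Order.TTheory GRing.Theory Num.Theory.
Import numFieldNormedType.Exports.

Local Open Scope classical_set_scope.
Local Open Scope ring_scope.

Definition rV_display : measure_display.
Proof. exact: default_measure_display. Qed.

(* The sigma-algebra on R^n generated by the n coordinate functions (as the
   library does for n.-tuple); it is the Borel sigma-algebra of 'rV[R]_n. *)
Section measurable_rV.
Context {R : realType} (n : nat).

Let coord : 'I_n -> 'rV[R]_n -> measurableTypeR R := fun i v => v ord0 i.

Let rV_set0 : g_sigma_preimage coord set0.
Proof. exact: sigma_algebra0. Qed.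

Let rV_setC A : g_sigma_preimage coord A -> g_sigma_preimage coord (~` A).
Proof. exact: sigma_algebraC. Qed.

Let rV_bigcup (F : (set 'rV[R]_n)^nat) :
  (forall i, g_sigma_preimage coord (F i)) ->
  g_sigma_preimage coord (\bigcup_i (F i)).
Proof. exact: sigma_algebra_bigcup. Qed.

HB.instance Definition _ := @isMeasurable.Build rV_display
  'rV[R]_n (g_sigma_preimage coord) rV_set0 rV_setC rV_bigcup.

End measurable_rV.

Lemma measurable_coord (R : realType) n (i : 'I_n) :
  measurable_fun [set: 'rV[R]_n] (fun v => v ord0 i : measurableTypeR R).
Proof.
move=> _ Y mY; apply: sub_sigma_algebra => /=.
by rewrite -bigcup_seq/=; exists i; [rewrite /= mem_index_enum|exists Y].
Qed.

Lemma measurable_fun_rV d (T : measurableType d) (R : realType) n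
    (f : T -> 'rV[R]_n) :
  (forall i, measurable_fun [set: T] (fun t => f t ord0 i : measurableTypeR R)) ->
  measurable_fun [set: T] f.
Proof.
move=> mf _ A mA; rewrite setTI.
suff : <<s \big[setU/set0]_(i < n) preimage_set_system setT
    (fun v : 'rV[R]_n => v ord0 i : measurableTypeR R) measurable >> `<=`
    [set B | measurable (f @^-1` B)] by apply.
apply: smallest_sub.
  split=> /=; first by rewrite preimage_set0.
  - by move=> B mB; rewrite setTD preimage_setC; exact: measurableC.
  - by move=> F mF; rewrite preimage_bigcup; exact: bigcup_measurable.
rewrite -bigcup_seq => B [i _] [C mC <-] /=.
by rewrite setTI -[X in measurable X]setTI; exact: mf.
Qed.

Definition rV_cons (R : realType) n (p : measurableTypeR R * 'rV[R]_n) :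
  'rV[R]_n.+1 := row_mx (\row_(_ < 1) p.1) p.2 : 'rV[R]_(1 + n).

Lemma rV_cons0 (R : realType) n p : @rV_cons R n p ord0 ord0 = p.1.
Proof.
have -> : ord0 = lshift n (ord0 : 'I_1) :> 'I_(1 + n) by exact: ord_inj.
by apply: etrans (row_mxEl _ _ _ _) _; rewrite mxE.
Qed.

Lemma rV_consS (R : realType) n p j :
  @rV_cons R n p ord0 (lift ord0 j) = p.2 ord0 j.
Proof.
have -> : lift ord0 j = rshift 1 j :> 'I_(1 + n) by exact: ord_inj.
exact: row_mxEr.
Qed.

Lemma measurable_rV_cons (R : realType) n : measurable_fun setT (@rV_cons R n).
Proof.
apply: measurable_fun_rV => i; case: (unliftP ord0 i) => [j|] ->.
  under eq_fun do rewrite rV_consS.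
  exact: (measurableT_comp (measurable_coord j) measurable_snd).
by under eq_fun do rewrite rV_cons0; exact: measurable_fst.
Qed.

Definition rV_uncons (R : realType) n (v : 'rV[R]_n.+1) :
  measurableTypeR R * 'rV[R]_n := (v ord0 ord0, \row_j v ord0 (lift ord0 j)).

Lemma measurable_rV_uncons (R : realType) n :
  measurable_fun setT (@rV_uncons R n).
Proof.
apply/measurable_fun_pairP; split; first exact: measurable_coord.
apply: measurable_fun_rV => j.
rewrite (_ : (fun _ => _) = (fun v : 'rV[R]_n.+1 => v ord0 (lift ord0 j))).
  exact: measurable_coord.
by apply/funext => v; rewrite mxE.
Qed.

Lemma rV_consK (R : realType) n : cancel (@rV_cons R n) (@rV_uncons R n).
Proof.
move=> [x v]; rewrite /rV_uncons rV_cons0; congr pair.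
by apply/rowP => j; rewrite mxE rV_consS.
Qed.

(* The product of the Lebesgue measure on R with a measure mu on R^n, carried
   from R x R^n to R^(1 + n). Sigma-finiteness is proved by hand: the library's
   instance for general product measures is not found by inference. *)
Section lebesgue_rV_step.
Context {R : realType} (n : nat).
Variable mu : {sigma_finite_measure set 'rV[R]_n -> \bar R}.

Definition lebesgue_rV_step : set 'rV[R]_n.+1 -> \bar R :=
  pushforward (@lebesgue_measure R \x mu)%E (@rV_cons R n).

Let measurable_preimage_cons A :
  measurable A -> measurable (@rV_cons R n @^-1` A).
Proof. by rewrite -[X in _ -> measurable X]setTI; exact: measurable_rV_cons. Qed.

Let lebesgue_rV_step0 : lebesgue_rV_step set0 = 0%E.
Proof. by rewrite /lebesgue_rV_step /pushforward preimage_set0 measure0. Qed.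

Let lebesgue_rV_step_ge0 A : (0 <= lebesgue_rV_step A)%E.
Proof. by rewrite /lebesgue_rV_step /pushforward; exact: measure_ge0. Qed.

Let lebesgue_rV_step_sigma_additive : semi_sigma_additive lebesgue_rV_step.
Proof.
move=> F mF tF mUF; rewrite /lebesgue_rV_step /pushforward preimage_bigcup.
apply: measure_semi_sigma_additive.
- by move=> k; exact: measurable_preimage_cons.
- apply/trivIsetP => i j _ _ ij; rewrite -preimage_setI.
  by move/trivIsetP : tF => /(_ _ _ _ _ ij) ->//; rewrite preimage_set0.
- by rewrite -preimage_bigcup; exact: measurable_preimage_cons.
Qed.

HB.instance Definition _ := isMeasure.Build _ _ _ lebesgue_rV_step
  lebesgue_rV_step0 lebesgue_rV_step_ge0 lebesgue_rV_step_sigma_additive.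

Let lebesgue_rV_step_sigma_finite : sigma_finite setT lebesgue_rV_step.
Proof.
have /sigma_finiteP[F [TF ndF Foo]] := sigma_finiteT (@lebesgue_measure R).
have /sigma_finiteP[G [TG ndG Goo]] := sigma_finiteT mu.
exists (fun k => @rV_uncons R n @^-1` (F k `*` G k)) => [|k].
  rewrite -preimage_bigcup (_ : \bigcup_k _ = setT) ?preimage_setT//.
  apply/seteqP; split => // -[x v] _.
  have [i _ Fix] : (\bigcup_k F k) x by rewrite -TF.
  have [j _ Gjv] : (\bigcup_k G k) v by rewrite -TG.
  exists (maxn i j) => //; split => /=.
  - by move: x Fix; exact/subsetPset/ndF/leq_maxl.
  - by move: v Gjv; exact/subsetPset/ndG/leq_maxr.
have [mF Fk] := Foo k; have [mG Gk] := Goo k; split.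
  by rewrite -[X in measurable X]setTI; apply: measurable_rV_uncons => //;
    exact: measurableX.
rewrite /lebesgue_rV_step /pushforward -comp_preimage.
rewrite (_ : _ \o _ = id) ?preimage_id; last first.
  by apply/funext => p /=; rewrite rV_consK.
by rewrite product_measure1E// lte_mul_pinfty// ge0_fin_numE.
Qed.

HB.instance Definition _ := Measure_isSigmaFinite.Build _ _ _
  lebesgue_rV_step lebesgue_rV_step_sigma_finite.

End lebesgue_rV_step.

Fixpoint lebesgue_rV (R : realType) (n : nat) :
    {sigma_finite_measure set 'rV[R]_n -> \bar R} :=
  match n with
  | 0 => @dirac _ 'rV[R]_0 0 R
  | n'.+1 => lebesgue_rV_step (lebesgue_rV R n')
  end.

Lemma lebesgue_rV_box (R : realType) n (A : 'I_n -> set (measurableTypeR R)) :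
  (forall i, measurable (A i)) ->
  lebesgue_rV R n [set v | forall i, A i (v ord0 i)] =
  (\prod_(i < n) lebesgue_measure (A i))%E.
Proof.
elim: n A => [|n IHn] A mA.
  by rewrite big_ord0 /= diracE mem_set// => -[].
pose B : set 'rV[R]_n := [set v | forall i, A (lift ord0 i) (v ord0 i)].
have mB : measurable B.
  rewrite (_ : B =
      \bigcap_(i in [set: 'I_n]) [set v | A (lift ord0 i) (v ord0 i)]).
    apply: fin_bigcap_measurable; first exact: finite_finset.
    by move=> i _; rewrite -[X in measurable X]setTI; exact: measurable_coord.
  by apply/seteqP; split => [v Av i _|v Av i]; exact: Av.
rewrite big_ord_recl -IHn// -product_measure1E//.
rewrite [LHS]/= /lebesgue_rV_step /pushforward.
congr product_measure1; apply/seteqP; split => p /=.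
  move=> Ap; split; first by have := Ap ord0; rewrite rV_cons0.
  by move=> i; have := Ap (lift ord0 i); rewrite rV_consS.
move=> [A0 AS] i; case: (unliftP ord0 i) => [j|] ->.
  by rewrite rV_consS; exact: AS.
by rewrite rV_cons0.
Qed.

Local Notation normc := ComplexField.Normc.normc.

Section complex_valued.
Context {R : realType}.

Definition cpartial n (i : 'I_n) (f : 'rV[R]_n -> R[i]) : 'rV[R]_n -> R[i] :=
  fun x => ('D_(delta_mx ord0 i) (fun y => complex.Re (f y)) x +i*
            'D_(delta_mx ord0 i) (fun y => complex.Im (f y)) x)%C.

(* The iterated partial derivative along the coordinates listed in s; for
   s = [::] this is f itself. *)
Definition cpartials n (s : seq 'I_n) (f : 'rV[R]_n -> R[i]) :
  'rV[R]_n -> R[i] := foldr (@cpartial n) f s.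

Definition csmooth n (f : 'rV[R]_n -> R[i]) : Prop := forall s : seq 'I_n,
  [/\ continuous (fun x => complex.Re (cpartials s f x)),
      continuous (fun x => complex.Im (cpartials s f x)) &
      forall x (i : 'I_n),
        derivable (fun y => complex.Re (cpartials s f y)) x (delta_mx ord0 i) /\
        derivable (fun y => complex.Im (cpartials s f y)) x (delta_mx ord0 i)].

Definition cbounded T (f : T -> R[i]) : Prop :=
  exists M : R, forall x, normc (f x) <= M.

Definition schwartz n (f : 'rV[R]_n -> R[i]) : Prop :=
  csmooth f /\ forall (a : 'I_n -> nat) (s : seq 'I_n),
    cbounded (fun x : 'rV[R]_n =>
      (\prod_(i < n) x ord0 i ^+ a i)%:C * cpartials s f x)%C.

Definition cintegral d (T : measurableType d)
    (mu : {measure set T -> \bar R}) (f : T -> R[i]) : R[i] :=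
  (\int[mu]_x complex.Re (f x) +i* \int[mu]_x complex.Im (f x))%C.

Definition cLnorm d (T : measurableType d)
    (mu : {measure set T -> \bar R}) (p : R) (f : T -> R[i]) : \bar R :=
  Lnorm mu p%:E (fun x => (normc (f x))%:E).

Definition in_cLp d (T : measurableType d)
    (mu : {measure set T -> \bar R}) (p : R) (f : T -> R[i]) : Prop :=
  [/\ measurable_fun setT (fun x => complex.Re (f x)),
      measurable_fun setT (fun x => complex.Im (f x)) &
      (cLnorm mu p f < +oo)%E].

Definition cis (t : R) : R[i] := (cos t +i* sin t)%C.

Definition dotrV n (x y : 'rV[R]_n) : R := \sum_(i < n) x ord0 i * y ord0 i.

Definition fourier n (f : 'rV[R]_n -> R[i]) (xi : 'rV[R]_n) : R[i] :=
  cintegral (lebesgue_rV R n) (fun x => f x * cis (- (2 * pi * dotrV x xi))).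

(* A point (xi, eta) of R^n x R^n = R^(2n) is the row vector row_mx xi eta. *)
Definition bilinear_multiplier n (m : 'rV[R]_(n + n) -> R[i])
    (f g : 'rV[R]_n -> R[i]) (x : 'rV[R]_n) : R[i] :=
  cintegral (lebesgue_rV R n) (fun eta =>
    cintegral (lebesgue_rV R n) (fun xi =>
      m (row_mx xi eta) * fourier f xi * fourier g eta *
      cis (2 * pi * dotrV x (xi + eta)))).

Definition bounded_L2xL2_L1 n
    (T : ('rV[R]_n -> R[i]) -> ('rV[R]_n -> R[i]) -> 'rV[R]_n -> R[i]) : Prop :=
  exists C : R, forall f g : 'rV[R]_n -> R[i], schwartz f -> schwartz g ->
    (cLnorm (lebesgue_rV R n) 1 (T f g) <=
     C%:E * cLnorm (lebesgue_rV R n) 2 f * cLnorm (lebesgue_rV R n) 2 g)%E.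

End complex_valued.

(* Main.v *)
(* The multiplier is a sum of chirped Gaussians,

     m = sum_i m_i,
     m_i(xi, eta) = delta_i prod_(a < n) exp (i pi tau_i (xi_a + eta_a)^2)
                                         exp (- pi (xi_a^2 + eta_a^2) / R_i^2),

   where tau_i = lambda_i / R_i, lambda_i = 16^i, delta_i = 2^-(i+1) R_i^(-n/2) and
   R_i grows doubly exponentially. Each m_i has L^4 norm at most 2^-(i+1), and
   k derivatives of m_i cost lambda_i^k, which is negligible against delta_i.
   On Gaussians f = g whose Fourier transform has width R_j, the operator T_(m_j)
   multiplies f g by a Gaussian cutoff in frequency and applies the Schroedinger
   flow: a bump of width 1 / R_j is spread over the width lambda_j with constant
   L^2 norm, so that its L^1 norm is multiplied by (lambda_j R_j)^(n/2), and
   |T_(m_j)(f, g)|_1 / (|f|_2 |g|_2) is of order 2^-j lambda_j^(n/2), which is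
   unbounded. All integrals are explicit because everything is a tensor product of
   complex Gaussians in dimension one. The blocks with i <> j are harmless: on the
   box of side lambda_j / 2 that carries T_(m_j)(f, g) they are estimated
   pointwise, by the integral of |m_i| if i < j and by delta_i if i > j. *)

Require Import Defs.
From mathcomp Require Import all_boot all_order all_algebra.
From mathcomp Require Import all_classical all_reals all_analysis.
From mathcomp Require Import complex measurable_realfun.
From mathcomp Require Import zify ring lra.

Set Implicit Arguments.
Unset Strict Implicit.
Unset Printing Implicit Defensive.
Import Order.TTheory GRing.Theory Num.Theory.
Import numFieldNormedType.Exports.

Local Open Scope classical_set_scope.
Local Open Scope ring_scope.
Local Open Scope complex_scope.

Local Notation normc := ComplexField.Normc.normc.
Local Notation Re := complex.Re.
Local Notation Im := complex.Im.

(** * The complex exponential and derivatives of complex-valued functions *)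

(** The exponent 4 is critical here. A Gaussian of width R_i on R^(2n) has L^4 norm of order
    R_i^(n/2), which fixes the power of R_i in delta_i; the chirp gains exactly the factor R_i^(n/2)
    on the output, so R_i cancels from the ratio and only 2^-i lambda_i^(n/2) survives. Thus R_i may
    grow as fast as the smoothness and the separation of the blocks demand, and lambda_i = 16^i
    beats 2^-i already for n = 1. The gradient of the phase is tau_i times a linear function, hence
    of order lambda_i where xi and eta have size R_i; this is why tau_i carries the factor 1 / R_i
    and why a derivative costs one factor lambda_i. No contour is shifted in the complex Gaussian
    integrals. Each parameter is moved along a real line, and an ordinary differential equation
    coming from integration by parts is solved. In the bilinear computation the value without linear
    term enters only through its squared modulus, so no branch of a square root has to be chosen. *)

Section complex_basics.
Context {R : realType}.
Implicit Types z w : R[i].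

Lemma cReD z w : Re (z + w) = Re z + Re w. Proof. by case: z; case: w. Qed.
Lemma cImD z w : Im (z + w) = Im z + Im w. Proof. by case: z; case: w. Qed.
Lemma cReN z : Re (- z) = - Re z. Proof. by case: z. Qed.
Lemma cImN z : Im (- z) = - Im z. Proof. by case: z. Qed.
Lemma cReB z w : Re (z - w) = Re z - Re w. Proof. by rewrite cReD cReN. Qed.
Lemma cImB z w : Im (z - w) = Im z - Im w. Proof. by rewrite cImD cImN. Qed.
Lemma cReM z w : Re (z * w) = Re z * Re w - Im z * Im w.
Proof. by case: z; case: w. Qed.
Lemma cImM z w : Im (z * w) = Re z * Im w + Im z * Re w.
Proof. by case: z => a b; case: w. Qed.

Definition ReImE := (cReD, cImD, cReN, cImN, cReM, cImM).

Lemma complex_ext z w : Re z = Re w -> Im z = Im w -> z = w.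
Proof. by case: z => a b; case: w => c d /= -> ->. Qed.

Lemma normc_sqrtE z : normc z = Num.sqrt (Re z ^+ 2 + Im z ^+ 2).
Proof. by case: z. Qed.

Lemma normc_ge0 z : 0 <= normc z.
Proof. by rewrite normc_sqrtE sqrtr_ge0. Qed.

Lemma normc_sqr z : normc z ^+ 2 = Re z ^+ 2 + Im z ^+ 2.
Proof. by rewrite normc_sqrtE sqr_sqrtr// addr_ge0 ?sqr_ge0. Qed.

Lemma Re_le_normc z : `|Re z| <= normc z.
Proof. by rewrite normc_sqrtE -sqrtr_sqr ler_wsqrtr// lerDl sqr_ge0. Qed.

Lemma Im_le_normc z : `|Im z| <= normc z.
Proof. by rewrite normc_sqrtE -sqrtr_sqr ler_wsqrtr// lerDr sqr_ge0. Qed.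

Lemma normc_le_ReIm z : normc z <= `|Re z| + `|Im z|.
Proof.
rewrite -(@ler_pXn2r _ 2)// ?nnegrE ?normc_ge0 ?addr_ge0//.
rewrite normc_sqr -(real_normK (num_real (Re z))).
rewrite -[X in _ + X <= _](real_normK (num_real (Im z))).
have := normr_ge0 (Re z); have := normr_ge0 (Im z); nra.
Qed.

Lemma normc_real (x : R) : normc x%:C = `|x|.
Proof. by rewrite normc_sqrtE /= expr0n addr0 sqrtr_sqr. Qed.

Lemma normc_nat k : normc (k%:R : R[i]) = k%:R.
Proof. by rewrite -[k%:R](rmorph_nat (real_complex R)) normc_real normr_nat. Qed.

Lemma normcM z w : normc (z * w) = normc z * normc w.
Proof. exact: ComplexField.Normc.normcM. Qed.

Lemma normcD z w : normc (z + w) <= normc z + normc w.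
Proof. exact: le_normcD. Qed.

Lemma normc_prod (I : Type) (s : seq I) (F : I -> R[i]) :
  normc (\prod_(i <- s) F i) = \prod_(i <- s) normc (F i).
Proof.
apply: (big_morph _ normcM); exact: ComplexField.Normc.normc1.
Qed.

Lemma normcX z k : normc (z ^+ k) = normc z ^+ k.
Proof.
elim: k => [|k IH]; first by rewrite !expr0 ComplexField.Normc.normc1.
by rewrite !exprS normcM IH.
Qed.

Definition cexp z : R[i] := (expR (Re z))%:C * cis (Im z).

Lemma Re_cexp z : Re (cexp z) = expR (Re z) * cos (Im z).
Proof. by rewrite cReM /= mul0r subr0. Qed.

Lemma Im_cexp z : Im (cexp z) = expR (Re z) * sin (Im z).
Proof. by rewrite cImM /= mul0r addr0. Qed.

Lemma cexpD z w : cexp (z + w) = cexp z * cexp w.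
Proof.
apply: complex_ext; rewrite !(ReImE, Re_cexp, Im_cexp) expRD.
  by rewrite cosD; ring.
by rewrite sinD; ring.
Qed.

Lemma cexp0 : cexp 0 = 1.
Proof. by apply: complex_ext; rewrite ?Re_cexp ?Im_cexp /= expR0 ?cos0 ?sin0 mul1r. Qed.

Lemma cexpN z : cexp (- z) * cexp z = 1.
Proof. by rewrite -cexpD addNr cexp0. Qed.

Lemma cexp_sum (I : Type) (s : seq I) (F : I -> R[i]) :
  cexp (\sum_(i <- s) F i) = \prod_(i <- s) cexp (F i).
Proof. by apply: (big_morph _ cexpD); exact: cexp0. Qed.

Lemma normc_cexp z : normc (cexp z) = expR (Re z).
Proof.
rewrite normcM normc_real ger0_norm ?expR_ge0// normc_sqrtE /= cos2Dsin2 sqrtr1.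
by rewrite mulr1.
Qed.

Lemma cexp_real (x : R) : cexp x%:C = (expR x)%:C.
Proof.
by apply: complex_ext; rewrite ?Re_cexp ?Im_cexp /= ?cos0 ?sin0 ?mulr1 ?mulr0.
Qed.

Lemma cis_cexp (t : R) : cis t = cexp (0 +i* t).
Proof. by apply: complex_ext; rewrite ?Re_cexp ?Im_cexp /= expR0 mul1r. Qed.

End complex_basics.

Section complex_derivative.
Context {R : realType}.
Implicit Types (f g : R -> R[i]) (t : R) (d e : R[i]).

(** Functions of one real variable with complex values are differentiated componentwise, so that the
    real theory applies. Complex parameters are always varied along real lines, which makes this
    notion sufficient for the differential equations below. *)
Definition cderiv f t d :=
  is_derive t 1 (fun s => Re (f s)) (Re d) /\
  is_derive t 1 (fun s => Im (f s)) (Im d).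

Lemma cderiv_eq f t d e : cderiv f t d -> d = e -> cderiv f t e.
Proof. by move=> + <-. Qed.

Lemma cderiv_cst c t : cderiv (cst c) t 0.
Proof. by split; exact: is_derive_cst. Qed.

Lemma cderiv_real (f : R -> R) t (d : R) :
  is_derive t 1 f d -> cderiv (fun s => (f s)%:C) t d%:C.
Proof. by move=> fd; split => //=; exact: is_derive_cst. Qed.

Lemma cderiv_id t : cderiv (fun s => s%:C) t 1.
Proof. by apply: (cderiv_real (is_derive_id _ _)). Qed.

Lemma cderivD f g t d e :
  cderiv f t d -> cderiv g t e -> cderiv (fun s => f s + g s) t (d + e).
Proof.
move=> [f1 f2] [g1 g2]; split.
  rewrite cReD (_ : (fun _ => _) = (fun s => Re (f s)) + (fun s => Re (g s))).
    exact: is_deriveD.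
  by apply/funext => s; rewrite fctE cReD.
rewrite cImD (_ : (fun _ => _) = (fun s => Im (f s)) + (fun s => Im (g s))).
  exact: is_deriveD.
by apply/funext => s; rewrite fctE cImD.
Qed.

Lemma is_deriveM_eq (f g : R -> R) t (d e c : R) :
  is_derive t 1 f d -> is_derive t 1 g e -> d * g t + f t * e = c ->
  is_derive t 1 (fun s => f s * g s) c.
Proof.
move=> fd ge <-.
have -> : d * g t + f t * e = f t *: e + g t *: d.
  by rewrite /GRing.scale /=; ring.
exact: is_deriveM.
Qed.

Lemma cderivM f g t d e :
  cderiv f t d -> cderiv g t e ->
  cderiv (fun s => f s * g s) t (d * g t + f t * e).
Proof.
move=> [f1 f2] [g1 g2]; split.
  under eq_fun do rewrite cReM.
  apply: (is_derive_eq (@is_deriveB _ _ _ (fun s => Re (f s) * Re (g s))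
    (fun s => Im (f s) * Im (g s)) _ _ _ _
    (is_deriveM_eq f1 g1 erefl) (is_deriveM_eq f2 g2 erefl))).
  by rewrite !ReImE; ring.
under eq_fun do rewrite cImM.
apply: (is_derive_eq (@is_deriveD _ _ _ (fun s => Re (f s) * Im (g s))
  (fun s => Im (f s) * Re (g s)) _ _ _ _
  (is_deriveM_eq f1 g2 erefl) (is_deriveM_eq f2 g1 erefl))).
by rewrite !ReImE; ring.
Qed.

Lemma cderiv_cexp f t d :
  cderiv f t d -> cderiv (fun s => cexp (f s)) t (d * cexp (f t)).
Proof.
move=> [f1 f2].
have e1 : is_derive t 1 (fun s => expR (Re (f s))) (expR (Re (f t)) * Re d).
  exact: (is_derive1_comp (is_derive_expR _) f1).
split.
  under eq_fun do rewrite Re_cexp.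
  rewrite cReM Re_cexp Im_cexp.
  apply: (is_deriveM_eq e1 (is_derive1_comp (is_derive_cos _) f2)) => /=.
  by ring.
under eq_fun do rewrite Im_cexp.
rewrite cImM Re_cexp Im_cexp.
apply: (is_deriveM_eq e1 (is_derive1_comp (is_derive_sin _) f2)) => /=.
by ring.
Qed.

Lemma cderiv_affine (p q : R[i]) t : cderiv (fun s => p + s%:C * q) t q.
Proof.
apply: cderiv_eq (cderivD (cderiv_cst p t)
  (cderivM (cderiv_id t) (cderiv_cst q t))) _.
by rewrite /= mulr0 addr0 mul1r add0r.
Qed.

Lemma cderiv_quadratic (p q : R[i]) t :
  cderiv (fun s => p * s%:C ^+ 2 + q * s%:C) t (2 * p * t%:C + q).
Proof.
have h : cderiv (fun s => p * (s%:C * s%:C) + q * s%:C) t (2 * p * t%:C + q).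
  apply: cderiv_eq (cderivD (cderivM (cderiv_cst p t)
    (cderivM (cderiv_id t) (cderiv_id t)))
    (cderivM (cderiv_cst q t) (cderiv_id t))) _.
  by rewrite /=; ring.
exact: h.
Qed.

Lemma cderiv_continuous f (d : R -> R[i]) :
  (forall t, cderiv f t (d t)) ->
  continuous (fun s => Re (f s)) /\ continuous (fun s => Im (f s)).
Proof.
move=> fd; split => t; apply: differentiable_continuous;
  by apply/derivable1_diffP; apply: ex_derive; case: (fd t).
Qed.

Lemma cderiv0_cst f s t : (forall r, cderiv f r 0) -> f s = f t.
Proof.
move=> f0; apply: complex_ext.
  by apply: (@is_derive_0_is_cst _ (fun r => Re (f r))) => r; case: (f0 r).
by apply: (@is_derive_0_is_cst _ (fun r => Im (f r))) => r; case: (f0 r).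
Qed.

End complex_derivative.

(** * Gaussian integrals with complex parameters *)

Section gauss_real.
Context {R : realType}.
Local Notation mu := (@lebesgue_measure R).

(** The decay [c * x ^+ 2] is split: one quarter absorbs the polynomial by [1 + y <= expR y],
    another absorbs the linear term by completing the square, and half remains. The bound depends on
    the linear term only through [M], which makes it a domination uniform in a bounded parameter. *)
Lemma gauss_exponent (M c x : R) : 0 < c ->
  (1 + x ^+ 2) * expR (- c * x ^+ 2 + M * `|x|) <=
  (1 + 4 / c) * expR (M ^+ 2 / c) * expR (- (c / 2) * x ^+ 2).
Proof.
move=> c0; rewrite -mulrA -expRD.
have h1 : 1 + x ^+ 2 <= (1 + 4 / c) * expR (c / 4 * x ^+ 2).
  apply: (@le_trans _ _ ((1 + 4 / c) * (1 + c / 4 * x ^+ 2))).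
    have -> : (1 + 4 / c) * (1 + c / 4 * x ^+ 2) =
        1 + x ^+ 2 + 4 / c + c / 4 * x ^+ 2 by field; rewrite gt_eqF.
    have k1 : 0 <= 4 / c by rewrite divr_ge0// ltW.
    have k2 : 0 <= c / 4 * x ^+ 2 by rewrite mulr_ge0 ?sqr_ge0// divr_ge0// ltW.
    by rewrite -addrA lerDl addr_ge0.
  rewrite ler_wpM2l// ?addr_ge0// ?divr_ge0 ?(ltW c0)//.
  exact: expR_ge1Dx.
have h2 : M * `|x| <= M ^+ 2 / c + c / 4 * x ^+ 2.
  rewrite -subr_ge0 -[X in _ * X ^+ 2]/x -(real_normK (num_real x)).
  have -> : M ^+ 2 / c + c / 4 * `|x| ^+ 2 - M * `|x| =
      (M - c / 2 * `|x|) ^+ 2 / c by field; rewrite gt_eqF.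
  by rewrite divr_ge0 ?sqr_ge0 ?ltW.
apply: (@le_trans _ _ ((1 + 4 / c) * expR (c / 4 * x ^+ 2) *
    expR (- c * x ^+ 2 + M * `|x|))).
  by rewrite ler_wpM2r ?expR_ge0.
rewrite -mulrA -expRD ler_wpM2l ?addr_ge0// ?divr_ge0 ?(ltW c0)//.
by rewrite ler_expR; nra.
Qed.

Lemma continuous_gauss (c : R) : continuous (fun x : R => expR (- c * x ^+ 2)).
Proof.
move=> x; apply: (@continuous_comp _ _ _ (fun x : R => - c * x ^+ 2) expR);
  last exact: continuous_expR.
by apply: cvgMr; exact: exprn_continuous.
Qed.

Lemma gauss_scaling (c : R) : 0 < c ->
  (\int[mu]_x (gauss_fun x)%:E =
   \int[mu]_x (expR (- c * x ^+ 2) * Num.sqrt c)%:E)%E.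
Proof.
move=> c0; have s0 : 0 < Num.sqrt c by rewrite sqrtr_gt0.
have dF (x : R) : is_derive x 1 (fun x : R => Num.sqrt c * x) (Num.sqrt c).
  apply: (is_derive_eq (is_deriveZ _ _)).
  by rewrite /GRing.scale /= mulr1.
have F' : (fun x : R => Num.sqrt c * x)^`()%classic = cst (Num.sqrt c).
  by apply/funext => x; rewrite derive1E; apply: derive_val.
rewrite (@increasing_ge0_integration_by_substitutionT _
  (fun x => Num.sqrt c * x)) ?F'.
- apply: eq_integral => x _; rewrite fctE /= /gauss_fun; rewrite exprMn sqr_sqrtr ?ltW//.
  by rewrite mulNr.
- by move=> x y xy; rewrite ltr_pM2l.
- by move=> x; exact: cvg_cst.
- by apply/cvg_ex; exists (Num.sqrt c); exact: cvg_cst.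
- by apply/cvg_ex; exists (Num.sqrt c); exact: cvg_cst.
- by move=> x; exact: ex_derive.
- exact: gt0_cvgMrNy.
- exact: gt0_cvgMry.
- exact: continuous_gauss_fun.
- exact: gauss_fun_ge0.
Qed.

Lemma integral_gauss (c : R) : 0 < c ->
  (\int[mu]_x (expR (- c * x ^+ 2))%:E = (Num.sqrt (pi / c))%:E)%E.
Proof.
move=> c0; have s0 : 0 < Num.sqrt c by rewrite sqrtr_gt0.
have := gauss_scaling c0; rewrite integralT_gauss.
under eq_integral do rewrite EFinM muleC.
rewrite ge0_integralZl//; last first.
  by apply/measurable_EFinP; apply: continuous_measurable_fun;
    exact: continuous_gauss.
move=> e; rewrite sqrtrM ?pi_ge0// sqrtrV ?ltW// EFinM e muleC muleA.
by rewrite -EFinM mulVf ?gt_eqF// mul1e.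
Qed.

Lemma Rintegral_gauss (c : R) : 0 < c ->
  \int[mu]_x expR (- c * x ^+ 2) = Num.sqrt (pi / c).
Proof. by move=> c0; rewrite /Rintegral integral_gauss. Qed.

Lemma integrable_gauss (c : R) : 0 < c ->
  mu.-integrable setT (EFin \o (fun x => expR (- c * x ^+ 2))).
Proof.
move=> c0; apply/integrableP; split.
  by apply/measurable_EFinP; apply: continuous_measurable_fun;
    exact: continuous_gauss.
under eq_integral do rewrite /= ger0_norm ?expR_ge0//.
by rewrite integral_gauss// ltry.
Qed.

Lemma gauss_dominated_integrable (f : R -> R) (C c : R) : 0 < c ->
  continuous f -> (forall x, `|f x| <= C * expR (- c * x ^+ 2)) ->
  mu.-integrable setT (EFin \o f).
Proof.
move=> c0 cf fC.
apply: (@le_integrable _ _ _ mu setT _ (EFin \o f)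
  (fun x => (C * expR (- c * x ^+ 2))%:E)) => //.
- by apply/measurable_EFinP; exact: continuous_measurable_fun.
- by move=> x _ /=; rewrite lee_fin (le_trans (fC x)) ?ler_norm.
- under eq_fun do rewrite EFinM.
  by apply: integrableZl => //; exact: integrable_gauss.
Qed.

Lemma cvg_gauss_seq (c : R) : 0 < c ->
  expR (- c * (n%:R) ^+ 2) @[n --> \oo] --> (0 : R).
Proof.
move=> c0.
have h := cvg_comp _ _ (@cvgr_idn R) (gt0_cvgMry c0 (@cvgr_expr2 R)).
under eq_fun do rewrite mulNr.
exact: (cvg_comp _ _ (h _) (@cvgr_expR R)).
Qed.

(** On growing symmetric intervals the fundamental theorem gives boundary values of [F], which the
    Gaussian bound sends to 0; dominated convergence passes to the whole line. *)
Lemma integral_derivative0 (F f : R -> R) (C c : R) : 0 < c ->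
  (forall x : R, is_derive x 1 F (f x)) -> continuous f ->
  (forall x, `|F x| <= C * expR (- c * x ^+ 2)) ->
  (forall x, `|f x| <= C * expR (- c * x ^+ 2)) ->
  \int[mu]_x f x = 0.
Proof.
move=> c0 Ff cf FC fC.
have intf := gauss_dominated_integrable c0 cf fC.
(* With [n.+1] in place of [n] the interval is nondegenerate from the start, as the fundamental
   theorem requires. *)
pose D (n : nat) : set R := `[- n.+1%:R, n.+1%:R]%classic.
have mf : measurable_fun [set: R] (EFin \o f).
  by apply/measurable_EFinP; exact: continuous_measurable_fun.
have cF x : {for x, continuous F}.
  by apply: differentiable_continuous; apply/derivable1_diffP;
    apply: ex_derive; exact: Ff.
have [] := @dominated_convergence _ _ _ mu setT measurableT
  (fun n => (EFin \o f) \_ (D n)) (EFin \o f)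
  (fun x => (C * expR (- c * x ^+ 2))%:E).
- move=> n; apply/(measurable_restrictT _ _).1; first exact: measurable_itv.
  by apply: (measurable_funS measurableT) mf.
- by [].
- apply: aeW => x _; apply: cvg_near_cst; near=> n.
  rewrite /patch mem_set// /D/= in_itv/= -ler_norml.
  near: n; exists (Num.trunc `|x|) => // n /= xn.
  by rewrite ltW// (lt_le_trans (truncnS_gt _))// ler_nat.
- under eq_fun do rewrite EFinM.
  by apply: integrableZl => //; exact: integrable_gauss.
- apply: aeW => x n _; rewrite /patch; case: ifPn => _ /=.
    by rewrite lee_fin.
  by rewrite /point/= normr0 lee_fin (le_trans _ (fC x)).
move=> _ _; under eq_fun do rewrite -integral_mkcond.
have FTC n : (\int[mu]_(x in D n) (f x)%:E = (F n.+1%:R - F (- n.+1%:R))%:E)%E.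
  apply: continuous_FTC2.
  - by rewrite (@lt_trans _ _ 0)// ?oppr_lt0 ltr0n.
  - exact: continuous_subspaceT.
  - split; first by move=> x _; apply: ex_derive; exact: Ff.
      exact: (cvg_at_right_filter (cF _)).
    exact: (cvg_at_left_filter (cF _)).
  - by move=> x _; rewrite derive1E; apply: derive_val; exact: Ff.
under eq_fun do rewrite FTC.
have h0 : (fun n : nat => F n.+1%:R - F (- n.+1%:R)) n @[n --> \oo] --> 0.
  apply: norm_cvg0.
  apply: (@squeeze_cvgr _ _ _ _ (cst 0)
    (fun n => 2 * C * expR (- c * (n.+1%:R) ^+ 2))).
  - apply: nearW => n /=; rewrite normr_ge0/= (le_trans (ler_normB _ _))//.
    rewrite -mulrA mulr2n mulrDl mul1r lerD//.
    by rewrite (le_trans (FC _))// sqrrN.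
  - exact: cvg_cst.
  - rewrite -(mulr0 (2 * C)); apply: cvgMr.
    have := cvg_gauss_seq c0.
    by rewrite -(cvg_shiftS (fun n : nat => expR (- c * n%:R ^+ 2))).
move=> h1; rewrite /Rintegral.
have := cvg_unique _ h1 (cvg_EFin _ h0).
by move=> -> //; apply: nearW.
Unshelve. all: end_near. Qed.

End gauss_real.

Section complex_integral.
Context d (T : measurableType d) (R : realType) (mu : {measure set T -> \bar R}).
Implicit Types f g : T -> R[i].

Definition cintegrable f :=
  mu.-integrable setT (EFin \o (fun x => Re (f x))) /\
  mu.-integrable setT (EFin \o (fun x => Im (f x))).

Lemma eq_cintegral f g : f =1 g -> cintegral mu f = cintegral mu g.
Proof. by move=> /funext ->. Qed.

Lemma integrable_EFinD (f g : T -> R) :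
  mu.-integrable setT (EFin \o f) -> mu.-integrable setT (EFin \o g) ->
  mu.-integrable setT (EFin \o (fun x => f x + g x)).
Proof.
move=> fi gi; rewrite (_ : _ \o _ = (EFin \o f) \+ (EFin \o g))%E //.
exact: integrableD.
Qed.

Lemma integrable_EFinZ (c : R) (f : T -> R) :
  mu.-integrable setT (EFin \o f) ->
  mu.-integrable setT (EFin \o (fun x => c * f x)).
Proof.
move=> fi; rewrite (_ : _ \o _ = (fun x => c%:E * (EFin \o f) x)%E) //.
exact: integrableZl.
Qed.

Lemma cintegrableZ c f : cintegrable f -> cintegrable (fun x => c * f x).
Proof.
move=> [f1 f2]; split.
  under eq_fun do rewrite cReM -mulNr.
  by apply: integrable_EFinD; exact: integrable_EFinZ.
under eq_fun do rewrite cImM.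
by apply: integrable_EFinD; exact: integrable_EFinZ.
Qed.

Lemma cintegrableD f g :
  cintegrable f -> cintegrable g -> cintegrable (fun x => f x + g x).
Proof.
move=> [f1 f2] [g1 g2]; split.
  by under eq_fun do rewrite cReD; exact: integrable_EFinD.
by under eq_fun do rewrite cImD; exact: integrable_EFinD.
Qed.

Lemma cintegralD f g : cintegrable f -> cintegrable g ->
  cintegral mu (fun x => f x + g x) = cintegral mu f + cintegral mu g.
Proof.
move=> [f1 f2] [g1 g2]; apply: complex_ext; rewrite /= ?cReD ?cImD /=.
  by under eq_Rintegral do rewrite cReD; rewrite RintegralD.
by under eq_Rintegral do rewrite cImD; rewrite RintegralD.
Qed.

Lemma cintegralZ c f : cintegrable f ->
  cintegral mu (fun x => c * f x) = c * cintegral mu f.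
Proof.
move=> [f1 f2]; apply: complex_ext; rewrite /= ?cReM ?cImM /=.
  under eq_Rintegral do rewrite cReM -mulNr.
  rewrite RintegralD//; [|exact: integrable_EFinZ..].
  by rewrite !RintegralZl// mulNr.
under eq_Rintegral do rewrite cImM.
rewrite RintegralD//; [|exact: integrable_EFinZ..].
by rewrite !RintegralZl.
Qed.

End complex_integral.

(** * Complex Gaussians: differentiation in a parameter and moment identities *)

Section gauss_complex.
Context {R : realType}.
Local Notation mu := (@lebesgue_measure R).
Implicit Types (p q : R[i]) (P Q : R -> R[i]).

Definition cderivable (f : R -> R[i]) := forall s, exists d, cderiv f s d.

Lemma cderivable_continuous f : cderivable f ->
  continuous (fun s => Re (f s)) /\ continuous (fun s => Im (f s)).
Proof. by move=> /choice[d]; exact: cderiv_continuous. Qed.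

Lemma cderivable_quadratic p q :
  cderivable (fun s => p * s%:C ^+ 2 + q * s%:C).
Proof. by move=> s; exists (2 * p * s%:C + q); exact: cderiv_quadratic. Qed.

Lemma cderivable_cexp P : cderivable P -> cderivable (fun s => cexp (P s)).
Proof. by move=> dP s; have [d Pd] := dP s; eexists; exact: cderiv_cexp Pd. Qed.

Lemma cderivableM P Q : cderivable P -> cderivable Q ->
  cderivable (fun s => P s * Q s).
Proof.
move=> dP dQ s; have [d Pd] := dP s; have [e Qe] := dQ s.
by eexists; exact: cderivM Pd Qe.
Qed.

Lemma cderivableD P Q : cderivable P -> cderivable Q ->
  cderivable (fun s => P s + Q s).
Proof.
move=> dP dQ s; have [d Pd] := dP s; have [e Qe] := dQ s.
by eexists; exact: cderivD Pd Qe.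
Qed.

Lemma cderivable_cst p : cderivable (fun=> p).
Proof. by move=> s; exists 0; exact: cderiv_cst. Qed.

Lemma cgauss_dominated_integrable (f : R -> R[i]) (C c : R) : 0 < c ->
  cderivable f -> (forall s, normc (f s) <= C * expR (- c * s ^+ 2)) ->
  cintegrable mu f.
Proof.
move=> c0 /cderivable_continuous[cf1 cf2] fC.
split.
  apply: (gauss_dominated_integrable c0 cf1) => s.
  exact: le_trans (Re_le_normc _) (fC s).
apply: (gauss_dominated_integrable c0 cf2) => s.
exact: le_trans (Im_le_normc _) (fC s).
Qed.

Lemma cintegral_derivative0 (F f : R -> R[i]) (C c : R) : 0 < c ->
  (forall s, cderiv F s (f s)) -> cderivable f ->
  (forall s, normc (F s) <= C * expR (- c * s ^+ 2)) ->
  (forall s, normc (f s) <= C * expR (- c * s ^+ 2)) ->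
  cintegral mu f = 0.
Proof.
move=> c0 Ff /cderivable_continuous[cf1 cf2] FC fC.
apply: complex_ext => /=.
  apply: (@integral_derivative0 _ (fun s => Re (F s)) _ C c) => // s.
  - by case: (Ff s).
  - exact: le_trans (Re_le_normc _) (FC s).
  - exact: le_trans (Re_le_normc _) (fC s).
apply: (@integral_derivative0 _ (fun s => Im (F s)) _ C c) => // s.
- by case: (Ff s).
- exact: le_trans (Im_le_normc _) (FC s).
- exact: le_trans (Im_le_normc _) (fC s).
Qed.

(** The factor [1 + normc (Q s)] lets a single Gaussian majorant dominate both the integrand and its
    [t]-derivative, and a window of radius 1 around [a] is enough because differentiation is
    local. *)
Lemma cderiv_under_integral P Q (a C c : R) : 0 < c ->
  cderivable P -> cderivable Q ->
  (forall t s, a - 1 < t < a + 1 ->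
    (1 + normc (Q s)) * normc (cexp (P s + t%:C * Q s)) <=
    C * expR (- c * s ^+ 2)) ->
  cderiv (fun t => cintegral mu (fun s => cexp (P s + t%:C * Q s))) a
    (cintegral mu (fun s => Q s * cexp (P s + a%:C * Q s))).
Proof.
move=> c0 dP dQ dom.
(* Read off from the domination at [t = a], [s = 0], where the Gaussian equals 1. *)
have C0 : 0 <= C.
  have := dom a 0; rewrite ltrBlDr ltrDl ltr01 expr0n mulr0 expR0 mulr1.
  move=> /(_ isT) /(le_trans _); apply.
  by rewrite mulr_ge0 ?addr_ge0 ?normc_ge0.
have dE t : cderivable (fun s => cexp (P s + t%:C * Q s)).
  apply: cderivable_cexp; apply: cderivableD => //; apply: cderivableM => //.
  exact: cderivable_cst.
have Iaa : (`]a - 1, a + 1[%classic : set R) a.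
  by rewrite /= in_itv/= ltrBlDr ltrDl ltr01.
have intE t : (`]a - 1, a + 1[%classic : set R) t ->
    cintegrable mu (fun s => cexp (P s + t%:C * Q s)).
  rewrite /= in_itv/= => ta; apply: (cgauss_dominated_integrable c0 (dE t)) => s.
  apply: le_trans (dom t s ta).
  by rewrite ler_peMl ?normc_ge0// lerDl normc_ge0.
have dt t s : cderiv (fun r => cexp (P s + r%:C * Q s)) t
    (Q s * cexp (P s + t%:C * Q s)).
  by apply: cderiv_cexp; exact: cderiv_affine.
have domG t s : (`]a - 1, a + 1[%classic : set R) t ->
    normc (Q s * cexp (P s + t%:C * Q s)) <= C * expR (- c * s ^+ 2).
  rewrite /= in_itv/= => ta; apply: le_trans (dom t s ta).
  by rewrite normcM ler_wpM2r ?normc_ge0// lerDr.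
have intG : mu.-integrable setT (EFin \o (fun s => C * expR (- c * s ^+ 2))).
  by apply: integrable_EFinZ; exact: integrable_gauss.
have G0 s : 0 <= C * expR (- c * s ^+ 2) by rewrite mulr_ge0 ?expR_ge0.
split.
  pose f t s := Re (cexp (P s + t%:C * Q s)).
  have f' t s : partial1of2 f t s = Re (Q s * cexp (P s + t%:C * Q s)).
    by rewrite partial1of2E; apply: derive_val; case: (dt t s).
  have hi t : (`]a - 1, a + 1[%classic : set R) t ->
      mu.-integrable setT (EFin \o f t) by move=> /intE[].
  have hd t s : (`]a - 1, a + 1[%classic : set R) t -> [set: R] s ->
      derivable (f ^~ s) t 1 by move=> _ _; apply: ex_derive; case: (dt t s).
  have hb t s : (`]a - 1, a + 1[%classic : set R) t -> [set: R] s ->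
      `|partial1of2 f t s| <= C * expR (- c * s ^+ 2).
    by move=> ta _; rewrite f' (le_trans (Re_le_normc _))// domG.
  apply: DeriveDef.
    exact: (derivable_under_integral measurableT Iaa hi hd G0 intG hb).
  have := differentiation_under_integral measurableT Iaa hi hd G0 intG hb.
  by rewrite derive1E => -> /=; apply: eq_Rintegral => s _; rewrite f'.
pose f t s := Im (cexp (P s + t%:C * Q s)).
have f' t s : partial1of2 f t s = Im (Q s * cexp (P s + t%:C * Q s)).
  by rewrite partial1of2E; apply: derive_val; case: (dt t s).
have hi t : (`]a - 1, a + 1[%classic : set R) t ->
    mu.-integrable setT (EFin \o f t) by move=> /intE[].
have hd t s : (`]a - 1, a + 1[%classic : set R) t -> [set: R] s ->
    derivable (f ^~ s) t 1 by move=> _ _; apply: ex_derive; case: (dt t s).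
have hb t s : (`]a - 1, a + 1[%classic : set R) t -> [set: R] s ->
    `|partial1of2 f t s| <= C * expR (- c * s ^+ 2).
  by move=> ta _; rewrite f' (le_trans (Im_le_normc _))// domG.
apply: DeriveDef.
  exact: (derivable_under_integral measurableT Iaa hi hd G0 intG hb).
have := differentiation_under_integral measurableT Iaa hi hd G0 intG hb.
by rewrite derive1E => -> /=; apply: eq_Rintegral => s _; rewrite f'.
Qed.

Definition cgauss p q : R[i] :=
  cintegral mu (fun s => cexp (p * s%:C ^+ 2 + q * s%:C)).

Lemma Re_quadratic p q (s : R) :
  Re (p * s%:C ^+ 2 + q * s%:C) = Re p * s ^+ 2 + Re q * s.
Proof. by rewrite expr2 !ReImE /=; ring. Qed.

Lemma quadratic_cexp_bound p q (c M s : R) : Re p = - c -> 0 < c ->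
  `|Re q| <= M ->
  (1 + s ^+ 2) * normc (cexp (p * s%:C ^+ 2 + q * s%:C)) <=
  (1 + 4 / c) * expR (M ^+ 2 / c) * expR (- (c / 2) * s ^+ 2).
Proof.
move=> pc c0 qM; apply: le_trans (gauss_exponent M s c0).
rewrite normc_cexp Re_quadratic pc ler_wpM2l ?addr_ge0 ?sqr_ge0//.
rewrite ler_expR lerD2l (le_trans (ler_norm _))// normrM.
by rewrite ler_wpM2r.
Qed.

Lemma ge0_normc_le (z w : R[i]) (C : R) (s : R) :
  normc z <= C * (1 + s ^+ 2) -> normc (z * w) <= C * ((1 + s ^+ 2) * normc w).
Proof. by move=> zC; rewrite normcM mulrA ler_wpM2r ?normc_ge0. Qed.

Lemma abs_le_quad (s : R) : `|s| <= 1 + s ^+ 2.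
Proof.
have := sqr_ge0 (`|s| - 1 / 2); rewrite -(real_normK (num_real s)); nra.
Qed.

(* [0 = int F'] for [F = E] and [F = sE], with [E = exp (p s^2 + q s)]. *)
Lemma cgauss_moments p q : Re p < 0 ->
  let E := fun s : R => cexp (p * s%:C ^+ 2 + q * s%:C) in
  let M1 := cintegral mu (fun s => s%:C * E s) in
  let M2 := cintegral mu (fun s => s%:C ^+ 2 * E s) in
  2 * p * M1 + q * cgauss p q = 0 /\ cgauss p q + 2 * p * M2 + q * M1 = 0.
Proof.
move=> p0 E M1 M2; set c := - Re p.
have c0 : 0 < c by rewrite oppr_gt0.
have c20 : 0 < c / 2 by rewrite divr_gt0.
set C := (1 + 4 / c) * expR (`|Re q| ^+ 2 / c).
have EC s : (1 + s ^+ 2) * normc (E s) <= C * expR (- (c / 2) * s ^+ 2).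
  by apply: quadratic_cexp_bound; rewrite ?opprK.
have ge1 (s : R) : 1 <= 1 + s ^+ 2 by rewrite lerDl sqr_ge0.
have fC (f : R -> R[i]) K : 0 <= K ->
    (forall s, normc (f s) <= K * (1 + s ^+ 2)) ->
    forall s, normc (f s * E s) <= K * C * expR (- (c / 2) * s ^+ 2).
  move=> K0 fK s; rewrite -mulrA (le_trans (ge0_normc_le _ (fK s)))//.
  by rewrite ler_wpM2l.
have dE s : cderiv E s ((2 * p * s%:C + q) * E s).
  by apply: cderiv_cexp; exact: cderiv_quadratic.
have dE' : cderivable E by move=> s; eexists; exact: dE.
have did : cderivable (fun s : R => s%:C).
  by move=> s; eexists; exact: cderiv_id.
have b1 (s : R) : normc (1 : R[i]) <= 1 * (1 + s ^+ 2).
  by rewrite ComplexField.Normc.normc1 mul1r.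
have bs (s : R) : normc s%:C <= 1 * (1 + s ^+ 2).
  by rewrite normc_real mul1r abs_le_quad.
have bss (s : R) : normc (s%:C ^+ 2) <= 1 * (1 + s ^+ 2).
  by rewrite normcX normc_real real_normK ?num_real// mul1r lerDr.
have iE : cintegrable mu E.
  apply: (cgauss_dominated_integrable (C := C) c20 dE') => s.
  by have := fC (fun=> 1) 1 ler01 b1 s; rewrite !mul1r.
have isE : cintegrable mu (fun s => s%:C * E s).
  apply: (cgauss_dominated_integrable c20); first exact: cderivableM.
  exact: (fC (fun s => s%:C) 1 ler01 bs).
have dss : cderivable (fun s : R => s%:C ^+ 2).
  by rewrite (_ : (fun _ => _) = (fun s : R => s%:C * s%:C))//; exact: cderivableM.
have issE : cintegrable mu (fun s => s%:C ^+ 2 * E s).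
  apply: (cgauss_dominated_integrable c20); first exact: cderivableM.
  exact: (fC (fun s => s%:C ^+ 2) 1 ler01 bss).
have np := normc_ge0 p; have nq := normc_ge0 q.
split.
  have dq : cderivable (fun s : R => 2 * p * s%:C + q).
    apply: cderivableD; last exact: cderivable_cst.
    by apply: cderivableM => //; exact: cderivable_cst.
  (* One constant for two bounds: the summand 1 serves [E] itself, the others the polynomial factor
     of its derivative. *)
  set K := 1 + 2 * normc p + normc q.
  have K0 : 0 <= K by rewrite /K; lra.
  have K1 : 1 <= K by rewrite /K; lra.
  have C0 : 0 <= C by rewrite mulr_ge0 ?expR_ge0// addr_ge0// divr_ge0// ltW.
  have h : cintegral mu (fun s => (2 * p * s%:C + q) * E s) = 0.
    apply: (@cintegral_derivative0 E _ (K * C) (c / 2)) => //.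
    - exact: cderivableM.
    - move=> s; have := fC (fun=> 1) K K0 _ s; rewrite mul1r; apply => r.
      by rewrite ComplexField.Normc.normc1 -[leLHS]mulr1 ler_pM.
    - apply: fC => // s; rewrite (le_trans (normcD _ _))// !normcM.
      rewrite normc_nat normc_real.
      apply: (@le_trans _ _ (2 * normc p * (1 + s ^+ 2) + normc q * (1 + s ^+ 2))).
        by rewrite lerD// ?ler_wpM2l ?abs_le_quad ?mulr_ge0// ler_peMr.
      by rewrite -mulrDl ler_wpM2r// ?addr_ge0 ?sqr_ge0// /K; lra.
  rewrite -h /M1 /cgauss -!cintegralZ//.
  rewrite -cintegralD; [|exact: cintegrableZ..].
  by apply: eq_cintegral => s; rewrite /E; ring.
have dq : cderivable (fun s : R => 1 + s%:C * (2 * p * s%:C + q)).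
  apply: cderivableD; first exact: cderivable_cst.
  apply: cderivableM => //.
  apply: cderivableD; last exact: cderivable_cst.
  by apply: cderivableM => //; exact: cderivable_cst.
set K := 1 + 2 * normc p + normc q.
have K0 : 0 <= K by rewrite /K; lra.
have K1 : 1 <= K by rewrite /K; lra.
have h : cintegral mu (fun s => (1 + s%:C * (2 * p * s%:C + q)) * E s) = 0.
  apply: (@cintegral_derivative0 (fun s => s%:C * E s) _ (K * C) (c / 2)) => //.
  - move=> s; apply: cderiv_eq (cderivM (cderiv_id s) (dE s)) _.
    by ring.
  - exact: cderivableM.
  - apply: (fC (fun s => s%:C)) => // s; rewrite (le_trans (bs s))//.
    by rewrite ler_wpM2r// addr_ge0 ?sqr_ge0.
  - apply: fC => // s.
    rewrite (_ : 1 + _ = 1 + (2 * (p * s%:C ^+ 2) + s%:C * q)); last by ring.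
    apply: (@le_trans _ _ (1 + (2 * (normc p * normc (s%:C ^+ 2)) +
        normc s%:C * normc q))).
      rewrite (le_trans (normcD _ _))// ComplexField.Normc.normc1 lerD2l.
      by rewrite (le_trans (normcD _ _))// !normcM normc_nat.
    have h1 : 0 <= normc p * (1 + s ^+ 2 - normc (s%:C ^+ 2)).
      by rewrite mulr_ge0// subr_ge0 -[leRHS]mul1r.
    have h2 : 0 <= normc q * (1 + s ^+ 2 - normc s%:C).
      by rewrite mulr_ge0// subr_ge0 -[leRHS]mul1r.
    have h3 := sqr_ge0 s.
    rewrite -subr_ge0 /K (_ : _ - _ = s ^+ 2 +
      2 * (normc p * (1 + s ^+ 2 - normc (s%:C ^+ 2))) +
      normc q * (1 + s ^+ 2 - normc s%:C)); last by ring.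
    by rewrite !addr_ge0// mulr_ge0.
rewrite -h /M1 /M2 /cgauss -!cintegralZ//.
rewrite -cintegralD//; last exact: cintegrableZ.
rewrite -cintegralD; [|by apply: cintegrableD => //; exact: cintegrableZ|
  exact: cintegrableZ].
by apply: eq_cintegral => s; rewrite /E; ring.
Qed.

End gauss_complex.

(** * Complex Gaussians: evaluation by differential equations *)

Section gauss_complex_value.
Context {R : realType}.
Local Notation mu := (@lebesgue_measure R).
Implicit Types (p q : R[i]).

Lemma cgauss_mul_integrable p q (f : R -> R[i]) (K : R) : Re p < 0 -> 0 <= K ->
  cderivable f -> (forall s, normc (f s) <= K * (1 + s ^+ 2)) ->
  cintegrable mu (fun s : R => f s * cexp (p * s%:C ^+ 2 + q * s%:C)).
Proof.
move=> p0 K0 df fK; set c := - Re p.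
have c0 : 0 < c by rewrite oppr_gt0.
apply: (@cgauss_dominated_integrable _ _
  (K * ((1 + 4 / c) * expR (`|Re q| ^+ 2 / c))) (c / 2)); first by rewrite divr_gt0.
  apply: cderivableM => //; apply: cderivable_cexp; exact: cderivable_quadratic.
move=> s; rewrite -mulrA (le_trans (ge0_normc_le _ (fK s)))// ler_wpM2l//.
by apply: quadratic_cexp_bound; rewrite ?opprK.
Qed.

Lemma cgauss_integrable p q : Re p < 0 ->
  cintegrable mu (fun s : R => cexp (p * s%:C ^+ 2 + q * s%:C)).
Proof.
move=> p0; rewrite (_ : (fun _ => _) =
  (fun s : R => 1 * cexp (p * s%:C ^+ 2 + q * s%:C))); last first.
  by apply/funext => s; rewrite mul1r.
apply: (@cgauss_mul_integrable _ _ (fun=> 1) 1) => //.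
  exact: cderivable_cst.
by move=> s; rewrite ComplexField.Normc.normc1 mul1r lerDl sqr_ge0.
Qed.

Lemma Re_neq0 p : Re p < 0 -> p != 0.
Proof. by apply: contraTneq => ->; rewrite ltxx. Qed.

Lemma cderivable_ofreal : cderivable (fun s : R => s%:C).
Proof. by move=> s; exists 1; exact: cderiv_id. Qed.

Lemma cderivable_sqr_ofreal : cderivable (fun s : R => s%:C ^+ 2).
Proof.
rewrite (_ : (fun _ => _) = (fun s : R => s%:C * s%:C))//.
by apply: cderivableM; exact: cderivable_ofreal.
Qed.

(* [G(t) = cgauss p (t q)] solves [G' = - t q^2 / (2 p) G] by the first moment
   identity. *)
Lemma cgauss_linear p q : Re p < 0 ->
  cgauss p q = cgauss p 0 * cexp (- (q ^+ 2 / (4 * p))).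
Proof.
move=> p0; have pn0 := Re_neq0 p0.
set c := - Re p; have c0 : 0 < c by rewrite oppr_gt0.
pose P (s : R) := p * s%:C ^+ 2; pose Q (s : R) := q * s%:C.
have dP : cderivable P.
  by apply: cderivableM; [exact: cderivable_cst|exact: cderivable_sqr_ofreal].
have dQ : cderivable Q.
  by apply: cderivableM; [exact: cderivable_cst|exact: cderivable_ofreal].
have GE t : cgauss p (t%:C * q) =
    cintegral mu (fun s => cexp (P s + t%:C * Q s)).
  by apply: eq_cintegral => s; rewrite /P /Q mulrA.
have dG a : cderiv (fun t => cgauss p (t%:C * q)) a
    (- (a%:C * q ^+ 2 / (2 * p)) * cgauss p (a%:C * q)).
  under eq_fun do rewrite GE.
  pose M := (`|a| + 1) * `|Re q|.
  pose K := 1 + normc q.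
  apply: cderiv_eq (@cderiv_under_integral _ P Q a
    (K * ((1 + 4 / c) * expR (M ^+ 2 / c))) (c / 2) _ dP dQ _) _.
  - by rewrite divr_gt0.
  - move=> t s /andP[at1 ta1]; rewrite /Q mulrA.
    apply: (@le_trans _ _ (K * ((1 + s ^+ 2) *
        normc (cexp (P s + t%:C * q * s%:C))))).
      rewrite [leRHS]mulrA ler_wpM2r ?normc_ge0// /K mulrDl mul1r normcM normc_real.
      by rewrite lerD ?lerDl ?sqr_ge0// ler_wpM2l ?normc_ge0// abs_le_quad.
    rewrite -[leRHS]mulrA ler_wpM2l ?addr_ge0 ?normc_ge0//.
    apply: quadratic_cexp_bound; rewrite ?opprK//.
    rewrite cReM /= mul0r subr0 normrM ler_wpM2r//.
    have := ler_norm a; have := ler_norm (- a); rewrite normrN => ? ?.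
    by rewrite ler_norml; apply/andP; split; lra.
  - have -> : cintegral mu (fun s => Q s * cexp (P s + a%:C * Q s)) =
        q * cintegral mu (fun s : R => s%:C *
          cexp (p * s%:C ^+ 2 + a%:C * q * s%:C)).
      rewrite -cintegralZ; last first.
        apply: (@cgauss_mul_integrable _ _ (fun s => s%:C) 1) => //.
          exact: cderivable_ofreal.
        by move=> s; rewrite normc_real mul1r abs_le_quad.
      by apply: eq_cintegral => s; rewrite /P /Q !mulrA.
    have [+ _] := cgauss_moments (a%:C * q) p0.
    rewrite addrC => /addr0_eq h.
    rewrite (_ : _ * cintegral _ _ = q / (2 * p) * (2 * p * cintegral mu (fun s : R => s%:C *
          cexp (p * s%:C ^+ 2 + a%:C * q * s%:C)))); last first.
      by field.
    by rewrite -h; field.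
(* [G] times the integrating factor of its equation; [H] is constant, and the claim compares its
   values at 1 and at 0. *)
pose H t := cgauss p (t%:C * q) * cexp (q ^+ 2 / (4 * p) * t%:C ^+ 2 + 0 * t%:C).
have dH a : cderiv H a 0.
  apply: cderiv_eq (cderivM (dG a)
    (cderiv_cexp (cderiv_quadratic (q ^+ 2 / (4 * p)) 0 a))) _.
  by field.
have := cderiv0_cst 1 0 dH.
rewrite /H !mul0r !addr0 expr1n mulr1 mul1r expr0n mulr0 cexp0 mulr1 => <-.
by rewrite -mulrA (mulrC (cexp _)) cexpN mulr1.
Qed.

Lemma cgauss_real (b : R) : 0 < b -> cgauss (- b%:C) 0 = (Num.sqrt (pi / b))%:C.
Proof.
move=> b0; transitivity
    (cintegral mu (fun s : R => (expR (- b * s ^+ 2))%:C)).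
  apply: eq_cintegral => s; rewrite -cexp_real; congr cexp.
  by rewrite mul0r addr0 rmorphM rmorphN rmorphXn.
apply: complex_ext; rewrite /= ?Rintegral_gauss//.
by rewrite /Rintegral integral0.
Qed.

(* Along a vertical line [p(t) = - b + t r], with [r] imaginary, the second moment
   identity gives [G' = - r / (2 p) G] for [G = cgauss p 0], so [G^2 p] is
   constant. *)
Lemma sqr_cgauss p : Re p < 0 -> cgauss p 0 ^+ 2 * p = - pi%:C.
Proof.
move=> p0; set b := - Re p; have b0 : 0 < b by rewrite oppr_gt0.
(* The line leads from the real point [- b], where the integral is known, at [t = 0] to [p] at
   [t = 1]. Its real part stays [- b], so the domination does not depend on [t]. *)
pose r := 0 +i* Im p; pose pt (t : R) : R[i] := - b%:C + t%:C * r.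
have Ept t : Re (pt t) = - b by rewrite !ReImE /=; ring.
have pt0 t : Re (pt t) < 0 by rewrite Ept oppr_lt0.
have ptn0 t := Re_neq0 (pt0 t).
pose P (s : R) := - b%:C * s%:C ^+ 2; pose Q (s : R) := r * s%:C ^+ 2.
have dP : cderivable P.
  by apply: cderivableM; [exact: cderivable_cst|exact: cderivable_sqr_ofreal].
have dQ : cderivable Q.
  by apply: cderivableM; [exact: cderivable_cst|exact: cderivable_sqr_ofreal].
have PQE t (s : R) : P s + t%:C * Q s = pt t * s%:C ^+ 2 + 0 * s%:C.
  by rewrite /P /Q /pt; ring.
have dG a : cderiv (fun t => cgauss (pt t) 0) a
    (- (r / (2 * pt a)) * cgauss (pt a) 0).
  rewrite (_ : (fun _ => _) = (fun t =>
    cintegral mu (fun s => cexp (P s + t%:C * Q s)))); last first.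
    by apply/funext => t; apply: eq_cintegral => s; rewrite PQE.
  pose K := 1 + normc r.
  apply: cderiv_eq (@cderiv_under_integral _ P Q a
    (K * ((1 + 4 / b) * expR (0 ^+ 2 / b))) (b / 2) _ dP dQ _) _.
  - by rewrite divr_gt0.
  - move=> t s _; rewrite PQE.
    apply: (@le_trans _ _ (K * ((1 + s ^+ 2) *
        normc (cexp (pt t * s%:C ^+ 2 + 0 * s%:C))))).
      rewrite [leRHS]mulrA ler_wpM2r ?normc_ge0// /K mulrDl mul1r normcM normcX.
      rewrite normc_real real_normK ?num_real//.
      by rewrite lerD ?lerDl ?sqr_ge0// ler_wpM2l ?normc_ge0// lerDr.
    rewrite -[leRHS]mulrA ler_wpM2l ?addr_ge0 ?normc_ge0//.
    by apply: quadratic_cexp_bound => //; rewrite normr0.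
  - have -> : cintegral mu (fun s => Q s * cexp (P s + a%:C * Q s)) =
        r * cintegral mu (fun s : R => s%:C ^+ 2 *
          cexp (pt a * s%:C ^+ 2 + 0 * s%:C)).
      rewrite -cintegralZ; last first.
        apply: (@cgauss_mul_integrable _ _ (fun s => s%:C ^+ 2) 1) => //.
          exact: cderivable_sqr_ofreal.
        move=> s; rewrite normcX normc_real real_normK ?num_real//.
        by rewrite mul1r lerDr.
      by apply: eq_cintegral => s; rewrite PQE /Q !mulrA.
    have [_ +] := cgauss_moments 0 (pt0 a).
    rewrite mul0r addr0 => /addr0_eq h.
    rewrite (_ : _ * cintegral _ _ = r / (2 * pt a) * (2 * pt a *
        cintegral mu (fun s : R => s%:C ^+ 2 *
          cexp (pt a * s%:C ^+ 2 + 0 * s%:C)))); last by field.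
    by rewrite -h; field.
pose H t := cgauss (pt t) 0 * cgauss (pt t) 0 * pt t.
have dH a : cderiv H a 0.
  apply: cderiv_eq (cderivM (cderivM (dG a) (dG a))
    (cderiv_affine (- b%:C) r a)) _.
  by rewrite -/(pt a); field.
have := cderiv0_cst 1 0 dH.
have -> : H 1 = cgauss p 0 ^+ 2 * p.
  rewrite /H (_ : pt 1 = p) ?expr2//.
  by apply: complex_ext; rewrite !ReImE /= /b; ring.
move=> ->; rewrite /H (_ : pt 0 = - b%:C); last first.
  by apply: complex_ext; rewrite !ReImE /=; ring.
rewrite cgauss_real// -expr2 -rmorphXn /= sqr_sqrtr ?divr_ge0 ?pi_ge0 ?ltW//.
by rewrite mulrN -rmorphM/= divfK ?gt_eqF.
Qed.

(** Taking moduli removes the sign ambiguity left by the identity for the square, and the modulus is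
    all that the lower bound uses. *)
Lemma normc_cgauss p : Re p < 0 -> normc (cgauss p 0) ^+ 2 * normc p = pi.
Proof.
move=> /sqr_cgauss /(congr1 (@ComplexField.Normc.normc R)).
by rewrite normcM normcX -rmorphN normc_real normrN ger0_norm ?pi_ge0.
Qed.

End gauss_complex_value.

(* The exponent [p xi^2 + 2 i P (x + t eta) xi + p eta^2 + 2 i P x eta] is integrated
   first in [xi], then in [eta]; in the application [P = pi], [u = a - i t] and
   [p = - P u]. *)
Section complete_square.
Variables (F : fieldType) (P I a t x u : F).
Hypotheses (P0 : P != 0) (u0 : u != 0) (a0 : a != 0) (two0 : 2 != 0 :> F).
Hypothesis I2 : I ^+ 2 = -1.
Let p := - (P * u).
Let p0 : - (P * u) != 0. Proof. by rewrite oppr_eq0 mulf_neq0. Qed.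
Let p2 := p + P ^+ 2 * t ^+ 2 / p.
Let q2 := 2 * P * x * (I + P * t / p).

Lemma complete_square_inner (e : F) :
  p * e ^+ 2 + I * (2 * P * x) * e + - ((I * (2 * P * (x + t * e))) ^+ 2 / (4 * p)) =
  P ^+ 2 * x ^+ 2 / p + (p2 * e ^+ 2 + q2 * e).
Proof.
have four0 : (4 : F) != 0 by rewrite (_ : 4 = 2 * 2) ?mulf_neq0//; ring.
by rewrite exprMn I2 /p2 /q2 /p; field; rewrite p0 four0.
Qed.

Let v := 2 * u - a.
Hypotheses (v0 : v != 0) (uE : u ^+ 2 + t ^+ 2 = a * v).
Hypothesis IuE : I * u = I * a + t.

(** For [u = a - i t] one has u^2 + t^2 = (u + i t)(u - i t) with u + i t = a and u - i t = 2 u - a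
    = v; this is the hypothesis [uE]. The outer coefficient therefore factors, and its product with
    [p] is P^2 a v. *)
Lemma complete_square_coeff : p2 = - (P * a * v / u).
Proof.
have -> : P * a * v = P * (u ^+ 2 + t ^+ 2) by rewrite uE mulrA.
by rewrite /p2 /p; field; rewrite ?p0 ?P0 u0.
Qed.

Lemma complete_square_outer :
  P ^+ 2 * x ^+ 2 / p - q2 ^+ 2 / (4 * p2) = - (2 * P * x ^+ 2 / v).
Proof.
have four0 : (4 : F) != 0 by rewrite (_ : 4 = 2 * 2) ?mulf_neq0//; ring.
have q2E : q2 = I * (2 * P * x * a / u).
  rewrite /q2 /p.
  have -> : I * (2 * P * x * a / u) = 2 * P * x * (I * u - t) / u.
    by rewrite IuE; field; rewrite u0.
  by field; rewrite ?p0 ?P0 u0.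
rewrite q2E exprMn I2 complete_square_coeff /p /v.
by field; rewrite -/v v0 u0 four0 p0 oppr_eq0 !mulf_neq0.
Qed.

End complete_square.

(** * One coordinate of the bilinear operator *)

Section bilinear_1d.
Context {R : realType}.
Local Notation mu := (@lebesgue_measure R).
Implicit Types (a t x r : R).

Lemma ReV_lt0 (z : R[i]) : Re z < 0 -> Re z^-1 < 0.
Proof.
case: z => u v /= u0; rewrite pmulr_llt0// invr_gt0.
by rewrite ltr_wpDr ?sqr_ge0// exprn_even_gt0//= lt_eqF.
Qed.

Lemma i_sqr : ('i : R[i]) ^+ 2 = -1. Proof. exact: sqr_i. Qed.

Lemma fourier_gauss_1d (r xi : R) : 0 < r ->
  cintegral mu (fun y : R =>
    (expR (- (pi * r ^+ 2 * y ^+ 2)))%:C * cis (- (2 * pi * (y * xi)))) =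
  (r^-1 * expR (- (pi * xi ^+ 2 / r ^+ 2)))%:C.
Proof.
move=> r0; have b0 : 0 < pi * r ^+ 2 by rewrite mulr_gt0 ?pi_gt0// exprn_gt0.
transitivity (cgauss (- (pi * r ^+ 2)%:C) (- (2 * pi * xi)%:C * 'i)).
  apply: eq_cintegral => y; rewrite -cexp_real cis_cexp -cexpD; congr cexp.
  by apply: complex_ext; rewrite expr2 !ReImE /=; ring.
have sq : Num.sqrt (pi / (pi * r ^+ 2)) = r^-1.
  rewrite invfM mulrA mulfV ?gt_eqF ?pi_gt0// mul1r -exprVn sqrtr_sqr.
  by rewrite gtr0_norm ?invr_gt0.
rewrite cgauss_linear ?oppr_lt0// cgauss_real// sq [RHS]rmorphM /=.
congr (_ * _).
rewrite -cexp_real; congr cexp.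
have h1 : r%:C != 0 by rewrite fmorph_eq0 gt_eqF.
have h2 : (pi : R)%:C != 0 by rewrite fmorph_eq0 gt_eqF ?pi_gt0.
move: (pi : R) h2 => P h2.
rewrite exprMn i_sqr !(rmorphN, rmorphM, rmorphXn, fmorphV, rmorph_nat) /=.
by field; rewrite h1 h2.
Qed.

Lemma fourier_gauss_1d_integrable (r xi : R) : 0 < r ->
  cintegrable mu (fun y : R =>
    (expR (- (pi * r ^+ 2 * y ^+ 2)))%:C * cis (- (2 * pi * (y * xi)))).
Proof.
move=> r0; have b0 : 0 < pi * r ^+ 2 by rewrite mulr_gt0 ?pi_gt0// exprn_gt0.
rewrite (_ : (fun _ => _) = (fun y : R =>
  cexp (- (pi * r ^+ 2)%:C * y%:C ^+ 2 + - (2 * pi * xi)%:C * 'i * y%:C))).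
  by apply: cgauss_integrable; rewrite oppr_lt0.
apply/funext => y; rewrite -cexp_real cis_cexp -cexpD; congr cexp.
by apply: complex_ext; rewrite expr2 !ReImE /=; ring.
Qed.

(** The exponent of one coordinate of the integrand: [a] collects the Gaussian decay of the
    multiplier and of the two Fourier transforms, [t] is the chirp rate, and [x] enters through
    Fourier inversion. *)
Definition phase a t x (xi eta : R) : R[i] :=
  - (pi * a * (xi ^+ 2 + eta ^+ 2)) +i*
  (pi * t * (xi + eta) ^+ 2 + 2 * pi * x * (xi + eta)).

Lemma phase_quadratic a t x (xi eta : R) : phase a t x xi eta =
  ((- (pi * a) +i* (pi * t)) * xi%:C ^+ 2 +
   (0 +i* (2 * pi * (x + t * eta))) * xi%:C) +
  ((- (pi * a) +i* (pi * t)) * eta%:C ^+ 2 + (0 +i* (2 * pi * x)) * eta%:C).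
Proof. by apply: complex_ext; rewrite !expr2 !ReImE /=; ring. Qed.

Lemma phase_inner_integrable a t x eta : 0 < a ->
  cintegrable mu (fun xi : R => cexp (phase a t x xi eta)).
Proof.
move=> a0; under eq_fun do rewrite phase_quadratic cexpD mulrC.
apply: cintegrableZ; apply: cgauss_integrable.
by rewrite /= oppr_lt0 mulr_gt0 ?pi_gt0.
Qed.

(** The existential packages what the n-dimensional computation needs: the inner integral is a
    constant times a Gaussian in [eta], and the iterated integral has an explicit squared modulus.
    The latter comes from |G(p)|^2 |G(p2)|^2 = pi^2 / (|p| |p2|) with p p2 = pi^2 a v and v = a - 2
    i t, and from twice the real part of - 2 pi x^2 / v. *)
Lemma phase_inner a t x : 0 < a -> exists K p2 q2 : R[i],
  [/\ Re p2 < 0,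
      forall eta : R, cintegral mu (fun xi : R => cexp (phase a t x xi eta)) =
        K * cexp (p2 * eta%:C ^+ 2 + q2 * eta%:C) &
      normc (K * cgauss p2 q2) ^+ 2 =
        expR (- (4 * pi * x ^+ 2 * a / (a ^+ 2 + 4 * t ^+ 2))) /
        (a * normc (a +i* (- (2 * t))))].
Proof.
move=> a0; set p : R[i] := - (pi * a) +i* (pi * t).
have p0 : Re p < 0 by rewrite /= oppr_lt0 mulr_gt0 ?pi_gt0.
have pn0 := Re_neq0 p0.
pose u : R[i] := a +i* (- t); pose v : R[i] := a +i* (- (2 * t)).
have u0 : u != 0 by rewrite eq_complex /= gt_eqF.
have v0 : v != 0 by rewrite eq_complex /= gt_eqF.
have I2 := i_sqr.
have two0 : (2 : R[i]) != 0 by rewrite pnatr_eq0.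
have a0' : a%:C != 0 by rewrite fmorph_eq0 gt_eqF.
have pi0' : (pi : R)%:C != 0 by rewrite fmorph_eq0 gt_eqF ?pi_gt0.
have pu : p = - (pi%:C * u).
  by apply: complex_ext; rewrite !ReImE /=; ring.
have PX y : (pi ^+ 2 * y ^+ 2)%:C = pi%:C ^+ 2 * y%:C ^+ 2 :> R[i].
  by rewrite rmorphM !rmorphXn.
have P2X : (2 * pi * x)%:C = 2 * pi%:C * x%:C :> R[i].
  by rewrite !rmorphM rmorph_nat.
have Pt : (pi * t)%:C = pi%:C * t%:C :> R[i] by rewrite rmorphM.
pose p2 := p + (pi ^+ 2 * t ^+ 2)%:C / p.
pose q2 := (2 * pi * x)%:C * ('i + (pi * t)%:C / p).
exists (cgauss p 0 * cexp ((pi ^+ 2 * x ^+ 2)%:C / p)), p2, q2.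
(* Inversion preserves the left half-plane, so the correction term cannot raise [Re p2]. *)
have p20 : Re p2 < 0.
  rewrite cReD ltr_wnDr// cReM mul0r subr0.
  by apply: mulr_ge0_le0; [rewrite mulr_ge0 ?sqr_ge0|exact/ltW/ReV_lt0].
split=> //.
  move=> eta; under eq_cintegral do rewrite phase_quadratic cexpD mulrC.
  rewrite cintegralZ; last exact: cgauss_integrable.
  rewrite -/(cgauss _ _) cgauss_linear// -/p.
  rewrite [LHS]mulrC -[LHS]mulrA -[RHS]mulrA -!cexpD; congr (_ * cexp _).
  have e : (0 +i* (2 * pi * (x + t * eta)) : R[i]) =
      'i * (2 * pi%:C * (x%:C + t%:C * eta%:C)).
    by apply: complex_ext; rewrite !ReImE /=; ring.
  have e' : (0 +i* (2 * pi * x) : R[i]) = 'i * (2 * pi%:C * x%:C).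
    by apply: complex_ext; rewrite !ReImE /=; ring.
  rewrite e e' /p2 /q2 pu !PX P2X Pt.
  by rewrite [LHS]addrC; apply: complete_square_inner.
have e1 : u ^+ 2 + t%:C ^+ 2 = a%:C * (2 * u - a%:C).
  by apply: complex_ext; rewrite !expr2 !ReImE /=; ring.
have e2 : 'i * u = 'i * a%:C + t%:C.
  by apply: complex_ext; rewrite !ReImE /=; ring.
have e3 : v = 2 * u - a%:C.
  by apply: complex_ext; rewrite !ReImE /=; ring.
have v0' : 2 * u - a%:C != 0 by rewrite -e3.
have p2E : p2 = - (pi%:C * a%:C * v / u).
  rewrite /p2 pu e3 PX.
  exact: (complete_square_coeff pi0' u0 e1).
rewrite (cgauss_linear q2 p20).
have -> : cgauss p 0 * cexp ((pi ^+ 2 * x ^+ 2)%:C / p) *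
    (cgauss p2 0 * cexp (- (q2 ^+ 2 / (4 * p2)))) =
    cgauss p 0 * cgauss p2 0 * cexp (- (2 * pi%:C * x%:C ^+ 2 / v)).
  rewrite mulrACA -cexpD; congr (_ * cexp _).
  rewrite /p2 /q2 pu e3 !PX P2X Pt.
  exact: (complete_square_outer _ pi0' u0 a0' two0 I2 v0' e1 e2).
rewrite (normcM _ (cexp _)) (normcM (cgauss p 0)) normc_cexp !exprMn.
have hh : (normc (cgauss p 0) ^+ 2 * normc p) *
    (normc (cgauss p2 0) ^+ 2 * normc p2) = pi ^+ 2.
  by rewrite !normc_cgauss// expr2.
have pp2 : normc p * normc p2 = pi ^+ 2 * (a * normc v).
  rewrite -normcM (_ : p * p2 = pi%:C ^+ 2 * a%:C * v).
    by rewrite (normcM _ v) (normcM _ a%:C) normcX !normc_real !gtr0_norm ?pi_gt0// mulrA.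
  by rewrite p2E pu; field.
have nv : 0 < a * normc v.
  rewrite mulr_gt0// lt_neqAle normc_ge0 eq_sym andbT.
  by apply: contra v0 => /eqP /ComplexField.Normc.eq0_normc ->.
have pi20 : (pi : R) ^+ 2 != 0 by rewrite expf_neq0 ?gt_eqF ?pi_gt0.
have -> : normc (cgauss p 0) ^+ 2 * normc (cgauss p2 0) ^+ 2 = (a * normc v)^-1.
  apply: (mulIf (lt0r_neq0 nv)); rewrite mulVf ?lt0r_neq0//.
  by apply: (mulIf pi20); rewrite -mulrA [X in _ * X]mulrC -pp2 mulrACA hh mul1r.
rewrite mulrC; congr (_ / _).
rewrite -expRM_natl; congr expR.
have -> : Re (- (2 * pi%:C * x%:C ^+ 2 / v)) =
    - (2 * pi * x ^+ 2 * (a / (a ^+ 2 + (2 * t) ^+ 2))).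
  rewrite (_ : 2 * _ * _ = (2 * pi * x ^+ 2)%:C); last first.
    by rewrite !(rmorphM, rmorphXn, rmorph_nat).
  by rewrite !ReImE /= mul0r subr0 sqrrN.
rewrite (_ : a ^+ 2 + 4 * t ^+ 2 = a ^+ 2 + (2 * t) ^+ 2); last by ring.
by rewrite !mulrA -mulr_natl; ring.
Qed.

End bilinear_1d.

(** * Integrals of tensor products *)

Section tensor2.
Context d1 d2 (T1 : measurableType d1) (T2 : measurableType d2) (R : realType).
Variable m1 : {sigma_finite_measure set T1 -> \bar R}.
Variable m2 : {sigma_finite_measure set T2 -> \bar R}.

Lemma integrable_measurable d (T : measurableType d)
    (mu : {measure set T -> \bar R}) (f : T -> R) :
  mu.-integrable setT (EFin \o f) -> measurable_fun setT f.
Proof. by move=> /measurable_int /measurable_EFinP. Qed.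

Lemma tensor2_measurable (f : T1 -> R) (g : T2 -> R) :
  measurable_fun setT f -> measurable_fun setT g ->
  measurable_fun setT (fun z : T1 * T2 => f z.1 * g z.2).
Proof.
by move=> mf mg; apply: measurable_funM; exact: measurableT_comp.
Qed.

Lemma tensor2_integrable (f : T1 -> R) (g : T2 -> R) :
  m1.-integrable setT (EFin \o f) -> m2.-integrable setT (EFin \o g) ->
  (m1 \x m2)%E.-integrable setT (EFin \o (fun z => f z.1 * g z.2)).
Proof.
move=> fi gi; have mf := integrable_measurable fi.
have mg := integrable_measurable gi.
apply/integrable12ltyP; first by apply/measurable_EFinP; exact: tensor2_measurable.
have [_ foo] := integrableP _ _ _ fi; have [_ goo] := integrableP _ _ _ gi.
under eq_integral => x _.
  under eq_integral => y _ do rewrite /= normrM EFinM.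
  rewrite ge0_integralZl//; last by apply/measurable_EFinP; exact: measurableT_comp.
  over.
rewrite ge0_integralZr//.
- by rewrite lte_mul_pinfty// ?integral_ge0// ge0_fin_numE// integral_ge0.
- by apply/measurable_EFinP; exact: measurableT_comp.
- exact: integral_ge0.
Qed.

Lemma tensor2_Rintegral (f : T1 -> R) (g : T2 -> R) :
  m1.-integrable setT (EFin \o f) -> m2.-integrable setT (EFin \o g) ->
  \int[(m1 \x m2)%E]_z (f z.1 * g z.2) = \int[m1]_x f x * \int[m2]_y g y.
Proof.
move=> fi gi; have fg := tensor2_integrable fi gi.
rewrite {1}/Rintegral -(integral12_prod_meas1 fg) /fubini_F /=.
have fin d (T : measurableType d) (mu : {measure set T -> \bar R}) (h : T -> R) :
    mu.-integrable setT (EFin \o h) -> (\int[mu]_x (h x)%:E = (\int[mu]_x h x)%:E)%E.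
  by move=> hi; rewrite /Rintegral fineK//; exact: integrable_fin_num.
under eq_integral => x _.
  under eq_integral => y _ do rewrite EFinM.
  rewrite integralZl// fin// -EFinM mulrC; over.
rewrite fin; last exact: integrable_EFinZ.
by rewrite /= RintegralZl// mulrC.
Qed.

Lemma tensor2_cintegral (f : T1 -> R[i]) (g : T2 -> R[i]) :
  cintegrable m1 f -> cintegrable m2 g ->
  cintegrable (m1 \x m2)%E (fun z => f z.1 * g z.2) /\
  cintegral (m1 \x m2)%E (fun z => f z.1 * g z.2) =
  cintegral m1 f * cintegral m2 g.
Proof.
move=> [f1 f2] [g1 g2].
have i11 := tensor2_integrable f1 g1; have i22 := tensor2_integrable f2 g2.
have i12 := tensor2_integrable f1 g2; have i21 := tensor2_integrable f2 g1.
have i22' := integrable_EFinZ (-1) i22.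
have ReE : (fun z => Re (f z.1 * g z.2)) =
    (fun z => Re (f z.1) * Re (g z.2) + -1 * (Im (f z.1) * Im (g z.2))).
  by apply/funext => z; rewrite cReM mulN1r.
have ImE : (fun z => Im (f z.1 * g z.2)) =
    (fun z => Re (f z.1) * Im (g z.2) + Im (f z.1) * Re (g z.2)).
  by apply/funext => z; rewrite cImM.
split; first by split; rewrite ?ReE ?ImE; exact: integrable_EFinD.
apply: complex_ext; rewrite !ReImE /= -!tensor2_Rintegral//.
  by rewrite ReE RintegralD// RintegralZl// mulN1r.
by rewrite ImE RintegralD.
Qed.

End tensor2.

Section tensor_rV.
Context {R : realType}.
Local Notation mu1 := (@lebesgue_measure R).
Local Notation mu n := (lebesgue_rV R n).

Lemma measurable_preimageT d d' (T : measurableType d) (U : measurableType d')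
  (f : T -> U) A : measurable_fun setT f -> measurable A -> measurable (f @^-1` A).
Proof. by move=> mf mA; rewrite -[X in measurable X]setTI; exact: mf. Qed.

(** [lebesgue_rV R n.+1] is a pushforward under [rV_cons] by construction, so this is the change of
    variables formula that lowers the dimension by one. *)
Lemma Rintegral_rV_step n (f : 'rV[R]_n.+1 -> R) : measurable_fun setT f ->
  (mu1 \x mu n)%E.-integrable setT (EFin \o (fun p => f (rV_cons p))) ->
  (mu n.+1).-integrable setT (EFin \o f) /\
  \int[mu n.+1]_v f v = \int[(mu1 \x mu n)%E]_p f (rV_cons p).
Proof.
move=> mf fi; have mE : measurable_fun setT (EFin \o f) by apply/measurable_EFinP.
have mc := @measurable_rV_cons R n.
split.
  by apply: (@integrable_pushforward _ _ _ _ _ (@rV_cons R n)) => //.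
rewrite /Rintegral; congr fine.
exact: (@integral_pushforward _ _ _ _ _ (@rV_cons R n) mc _ setT).
Qed.

(** Induction on the dimension, splitting off one coordinate at a time by the two-factor product
    formula. *)
Lemma tensor_rV n (h : 'I_n -> R -> R[i]) :
  (forall i, cintegrable mu1 (h i)) ->
  cintegrable (mu n) (fun v => \prod_(i < n) h i (v ord0 i)) /\
  cintegral (mu n) (fun v => \prod_(i < n) h i (v ord0 i)) =
  \prod_(i < n) cintegral mu1 (h i).
Proof.
elim: n h => [|n IH] h hi.
  have -> : (fun v : 'rV[R]_0 => \prod_(i < 0) h i (v ord0 i)) = (fun=> 1).
    by apply/funext => v; rewrite big_ord0.
  split.
    split; exact: finite_measure_integrable_cst.
  have d1 : mu 0 setT = 1%E by rewrite /= diracE mem_set.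
  rewrite big_ord0; apply: complex_ext; rewrite /= /Rintegral integral_cst//.
    by rewrite [X in (_ * X)%E]d1 mule1.
  by rewrite mul0e.
have [ti tE] := IH (fun i => h (lift ord0 i)) (fun i => hi _).
have [i2 E2] := tensor2_cintegral (hi ord0) ti.
pose F (v : 'rV[R]_n.+1) := \prod_(i < n.+1) h i (v ord0 i).
pose G (p : R * 'rV[R]_n) :=
  h ord0 p.1 * \prod_(i < n) h (lift ord0 i) (p.2 ord0 i).
have FE p : F (rV_cons p) = G p.
  rewrite /F big_ord_recl rV_cons0; congr (_ * _).
  by apply: eq_bigr => i _; rewrite rV_consS.
(* Integrals are transported by [rV_cons], but measurability on row vectors is obtained through its
   inverse [rV_uncons]. *)
have FE' : F = G \o @rV_uncons R n.
  apply/funext => v; rewrite /F big_ord_recl /=; congr (_ * _).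
  by apply: eq_bigr => i _; rewrite mxE.
have [i2R i2I] := i2.
have mR : measurable_fun setT (fun v => Re (F v)).
  rewrite FE'; apply: (@measurableT_comp _ _ _ _ _ _ (fun p => Re (G p))).
    exact: integrable_measurable i2R.
  exact: measurable_rV_uncons.
have mI : measurable_fun setT (fun v => Im (F v)).
  rewrite FE'; apply: (@measurableT_comp _ _ _ _ _ _ (fun p => Im (G p))).
    exact: integrable_measurable i2I.
  exact: measurable_rV_uncons.
have FG : (fun p => F (rV_cons p)) = G by apply/funext.
have [FRi FRE] : (mu n.+1).-integrable setT (EFin \o (fun v => Re (F v))) /\
    \int[mu n.+1]_v Re (F v) = \int[(mu1 \x mu n)%E]_p Re (G p).
  have [] := Rintegral_rV_step mR; first by under eq_fun do rewrite FE.
  by move=> ? ->; split=> //; apply: eq_Rintegral => p _; rewrite FE.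
have [FIi FIE] : (mu n.+1).-integrable setT (EFin \o (fun v => Im (F v))) /\
    \int[mu n.+1]_v Im (F v) = \int[(mu1 \x mu n)%E]_p Im (G p).
  have [] := Rintegral_rV_step mI; first by under eq_fun do rewrite FE.
  by move=> ? ->; split=> //; apply: eq_Rintegral => p _; rewrite FE.
split; first by split.
by rewrite big_ord_recl -tE -E2; apply: complex_ext.
Qed.

End tensor_rV.

(** * Smooth sums of modulated Gaussians *)

Section real_series.
Context {R : realType}.
Implicit Types (u b : R^nat).

Definition sumR u : R := limn (series u).

Lemma summable_dominated u b : (forall i, `|u i| <= b i) ->
  cvgn (series b) -> cvgn (series u).
Proof.
move=> ub cb; apply: normed_cvg.
apply: (@series_le_cvg _ (fun i => `|u i|) b) => // i.
exact: le_trans (ub i).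
Qed.

Lemma norm_sumR u b : (forall i, `|u i| <= b i) ->
  cvgn (series b) -> `|sumR u| <= sumR b.
Proof.
move=> ub cb; have cu : cvgn (series (fun i => `|u i|)).
  apply: (@series_le_cvg _ (fun i => `|u i|) b) => // i.
  exact: le_trans (ub i).
rewrite (le_trans (lim_series_norm cu))//.
exact: lim_series_le.
Qed.

Lemma sumRD u b : cvgn (series u) -> cvgn (series b) ->
  sumR (fun i => u i + b i) = sumR u + sumR b.
Proof. by move=> cu cb; rewrite /sumR -lim_seriesD. Qed.

Lemma seriesMl (c : R) u :
  series (fun i => c * u i) = (fun n => c * series u n).
Proof. by apply/funext => n; rewrite /series /= mulr_sumr. Qed.

Lemma summableZ (c : R) u : cvgn (series u) ->
  cvgn (series (fun i => c * u i)).
Proof. by move=> cu; rewrite seriesMl; apply/cvg_ex; exists (c * limn (series u)); exact: cvgMr. Qed.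

Lemma sumRZ (c : R) u : cvgn (series u) ->
  sumR (fun i => c * u i) = c * sumR u.
Proof.
move=> cu; rewrite /sumR seriesMl.
by apply: (@cvg_lim _ (@Rhausdorff R)); exact: cvgMr.
Qed.

Lemma sumR_ge0 u : (forall i, 0 <= u i) -> cvgn (series u) -> 0 <= sumR u.
Proof.
move=> u0 cu; apply: limr_ge => //; apply: nearW => n.
by rewrite /series /= sumr_ge0.
Qed.

Lemma sumR_D1 u j : cvgn (series u) ->
  sumR u = u j + sumR (fun i => if i == j then 0 else u i).
Proof.
move=> cu; set v := fun i => if i == j then u j else 0.
have vE n : series v (n + j.+1)%N = u j.
  rewrite /series /= (bigD1_seq j) ?iota_uniq ?mem_index_iota ?ltn_addl//=.
  by rewrite /v eqxx big1 ?addr0// => i /negbTE ->.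
have cv : series v n @[n --> \oo] --> u j.
  by rewrite -(cvg_shiftn j.+1); under eq_fun do rewrite vE; exact: cvg_cst.
have cw : cvgn (series (fun i => if i == j then 0 else u i)).
  rewrite (_ : (fun i => _) = u - v); last first.
    apply/funext => i; rewrite /v !fctE; case: eqP => [->|_].
      by rewrite subrr.
    by rewrite subr0.
  by apply: is_cvg_seriesB => //; apply/cvg_ex; exists (u j).
rewrite -[u j](cvg_lim (@Rhausdorff R) cv) -/(sumR v) -sumRD//; last first.
  by apply/cvg_ex; exists (u j).
congr sumR; apply/funext => i; rewrite /v; case: eqP => [->|_].
  by rewrite addr0.
by rewrite add0r.
Qed.

End real_series.

Section derivative_along_line.
Context {R : realType}.

(** Both difference quotients are the same function of the increment. Directional derivatives thus
    reduce to one real variable, where the mean value theorem is available. *)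
Lemma is_derive_line (V : normedModType R) (f : V -> R) (x v : V) (t d : R) :
  is_derive t (1 : R) (fun s : R => f (x + s *: v)) d <->
  is_derive (x + t *: v) v f d.
Proof.
have e : (fun h : R => h^-1 *: (((fun s : R => f (x + s *: v)) \o shift t)
    (h *: (1 : R)) - f (x + t *: v))) =
    (fun h : R => h^-1 *: ((f \o shift (x + t *: v)) (h *: v) - f (x + t *: v))).
  apply/funext => h /=; congr (_ *: (f _ - _)).
  by rewrite scaler1 scalerDl addrCA.
split=> -[dv ev].
  apply: DeriveDef; first by rewrite /derivable -e.
  by rewrite -ev /derive e.
apply: DeriveDef; first by rewrite /derivable e.
by rewrite -ev /derive -e.
Qed.

Lemma mvt0 (g g' : R -> R) (h : R) : (forall t : R, is_derive t (1 : R) g (g' t)) ->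
  exists2 c, `|c| <= `|h| & g h - g 0 = g' c * h.
Proof.
move=> gg'; have cg (A : set R) : {within A, continuous g}.
  apply: continuous_subspaceT => t; apply: differentiable_continuous.
  by apply/derivable1_diffP; apply: ex_derive; exact: gg'.
have [h0|h0] := leP 0 h.
  have [c] := MVT_segment h0 (fun t _ => gg' t) (cg _).
  rewrite in_itv/= subr0 => /andP[c0 ch] ->; exists c => //.
  by rewrite !ger0_norm.
have [c] := MVT_segment (ltW h0) (fun t _ => gg' t) (cg _).
rewrite in_itv/= sub0r => /andP[hc c0] e; exists c.
  by rewrite !ler0_norm ?(ltW h0)// lerN2.
by rewrite -opprB e mulrN opprK.
Qed.

(** The mean value theorem is applied to [g] and then to [g']. The constant [B] in place of [B / 2]
    is good enough, since only the order in [h] matters. *)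
Lemma taylor2_bound (g g' g'' : R -> R) (B h : R) :
  (forall t : R, is_derive t (1 : R) g (g' t)) ->
  (forall t : R, is_derive t (1 : R) g' (g'' t)) ->
  (forall t, `|g'' t| <= B) ->
  `|g h - g 0 - h * g' 0| <= B * h ^+ 2.
Proof.
move=> d1 d2 gB; have [c ch ->] := mvt0 h d1.
rewrite [h * _]mulrC -mulrBl; have [c' _ ->] := mvt0 c d2.
rewrite !normrM -(real_normK (num_real h)) expr2 mulrA ler_wpM2r//.
by rewrite ler_pM.
Qed.

End derivative_along_line.

Lemma continuous_sumR (R : realType) (T : topologicalType) (I : Type) (s : seq I)
    (f : I -> T -> R) (x : T) :
  (forall i, {for x, continuous (f i)}) ->
  {for x, continuous (fun y => \sum_(i <- s) f i y)}.
Proof.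
move=> fc; elim: s => [|i s IH].
  have -> : (fun y => \sum_(i <- [::]) f i y) = cst 0.
    by apply/funext => y; rewrite big_nil.
  exact: cst_continuous.
have -> : (fun y => \sum_(j <- i :: s) f j y) =
    f i + (fun y => \sum_(j <- s) f j y).
  by apply/funext => y; rewrite big_cons.
exact: (continuousD (fc i) IH).
Qed.

Section gaussian_class.
Context {R : realType} (N : nat).
Variables (rho lam delta : nat -> R) (theta : nat -> 'rV[R]_N -> R).
Hypothesis lam1 : forall i, 1 <= lam i.
Hypothesis delta0 : forall i, 0 <= delta i.
Hypothesis delta_summable : forall k, cvgn (series (fun i => delta i * lam i ^+ k)).

Definition growth (a : nat -> R) := exists C k, forall i, `|a i| <= C * lam i ^+ k.

Hypothesis growth_rho : growth rho.

(* The factors that multiply the [i]-th Gaussian [exp (- pi |rho_i x|^2)] when it is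
   modulated by the phase [theta_i] and differentiated repeatedly; every
   derivative costs at most a power of [lam_i], uniformly in [i]. *)
Inductive pclass : (nat -> 'rV[R]_N -> R) -> Prop :=
| pclass_cst a : growth a -> pclass (fun i _ => a i)
| pclass_coord k : pclass (fun i x => rho i * x ord0 k)
| pclass_cos : pclass (fun i x => cos (theta i x))
| pclass_sin : pclass (fun i x => sin (theta i x))
| pclass_add F G : pclass F -> pclass G -> pclass (fun i x => F i x + G i x)
| pclass_mul F G : pclass F -> pclass G -> pclass (fun i x => F i x * G i x).

Local Notation dir k := (delta_mx ord0 k : 'rV[R]_N).

Definition pderiv (F F' : nat -> 'rV[R]_N -> R) k :=
  forall i x, is_derive x (dir k) (F i) (F' i x).

(** Only the gradient of the phase is required to lie in the class, because differentiating [cos]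
    and [sin] of the phase reproduces the phase inside them and its gradient outside. *)
Hypothesis theta_deriv : forall k, exists2 D, pclass D & pderiv theta D k.

Lemma growth_cst c : growth (fun=> c).
Proof. by exists `|c|, 0 => i; rewrite expr0 mulr1. Qed.

Lemma growth_scale c a : growth a -> growth (fun i => c * a i).
Proof.
move=> [C [k aC]]; exists (`|c| * C), k => i.
by rewrite normrM -mulrA ler_wpM2l.
Qed.

Lemma is_derive_coord (x : 'rV[R]_N) k l :
  is_derive x (dir k) (fun y : 'rV[R]_N => y ord0 l) (k == l)%:R.
Proof.
rewrite -[x]addr0 -(scale0r (dir k)); apply/is_derive_line.
have -> : (fun s : R => (x + s *: dir k) ord0 l) =
    cst (x ord0 l) + (fun s : R => s * (k == l)%:R).
  by apply/funext => s; rewrite fctE !mxE eqxx /= eq_sym.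
rewrite -[X in is_derive _ _ _ X]add0r; apply: is_deriveD.
have h : is_derive (0 : R) 1 ((k == l)%:R *: (@id R)) ((k == l)%:R *: (1 : R)).
  exact: is_deriveZ.
rewrite [X in is_derive _ _ _ X](_ : _ = (k == l)%:R *: (1 : R)).
  by rewrite (_ : (fun s => _) = (k == l)%:R *: (@id R))//; apply/funext => s;
    rewrite fctE /GRing.scale /= mulrC.
by rewrite /GRing.scale /= mulr1.
Qed.

Lemma is_deriveM_rV (f g : 'rV[R]_N -> R) x v (d e : R) :
  is_derive x v f d -> is_derive x v g e ->
  is_derive x v (fun y => f y * g y) (d * g x + f x * e).
Proof.
move=> fd ge; apply: (is_derive_eq (is_deriveM fd ge)).
by rewrite /GRing.scale /=; ring.
Qed.

Lemma is_derive_comp_rV (phi : R -> R) (f : 'rV[R]_N -> R) x v (d e : R) :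
  is_derive x v f d -> is_derive (f x) 1 phi e ->
  is_derive x v (fun y => phi (f y)) (e * d).
Proof.
move=> fd pe; rewrite -[x]addr0 -(scale0r v); apply/is_derive_line.
apply: (@is_derive1_comp _ phi (fun s : R => f (x + s *: v))).
  by rewrite scale0r addr0.
by apply/is_derive_line; rewrite scale0r addr0.
Qed.

Lemma pclass_deriv F k : pclass F -> exists2 F', pclass F' & pderiv F F' k.
Proof.
elim=> {F} [a ga|l|||F G FF [F' FF' dF] GG [G' GG' dG]|
  F G FF [F' FF' dF] GG [G' GG' dG]].
- exists (fun i x => 0); first exact: (pclass_cst (growth_cst 0)).
  by move=> i x; exact: is_derive_cst.
- exists (fun i x => rho i * (k == l)%:R).
    apply: pclass_cst; have [C [m rC]] := growth_scale (k == l)%:R growth_rho.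
    by exists C, m => i; rewrite mulrC.
  move=> i x; exact: (is_deriveZ _ (is_derive_coord x k l)).
- have [D DD dD] := theta_deriv k.
  exists (fun i x => -1 * sin (theta i x) * D i x).
    apply: pclass_mul => //; apply: pclass_mul; last exact: pclass_sin.
    exact: (pclass_cst (growth_cst (-1))).
  move=> i x; rewrite mulN1r.
  exact: (is_derive_comp_rV (dD i x) (is_derive_cos _)).
- have [D DD dD] := theta_deriv k.
  exists (fun i x => cos (theta i x) * D i x).
    by apply: pclass_mul => //; exact: pclass_cos.
  by move=> i x; exact: (is_derive_comp_rV (dD i x) (is_derive_sin _)).
- exists (fun i x => F' i x + G' i x); first exact: pclass_add.
  by move=> i x; exact: (is_deriveD (dF i x) (dG i x)).
- exists (fun i x => F' i x * G i x + F i x * G' i x).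
    by apply: pclass_add; exact: pclass_mul.
  by move=> i x; exact: is_deriveM_rV.
Qed.

Definition sqnorm i (x : 'rV[R]_N) : R := \sum_(l < N) (rho i * x ord0 l) ^+ 2.

Lemma sqnorm_ge0 i x : 0 <= sqnorm i x.
Proof. by rewrite sumr_ge0// => l _; rewrite sqr_ge0. Qed.

Lemma pclass_bound F : pclass F -> exists C k m, 0 <= C /\
  forall i x, `|F i x| <= C * lam i ^+ k * (1 + sqnorm i x) ^+ m.
Proof.
have s1 i x : 1 <= 1 + sqnorm i x by rewrite lerDl sqnorm_ge0.
elim=> {F} [a [C [k aC]]|l|||F G _ [C [k [m [C0 FC]]]] _ [C' [k' [m' [C0' GC]]]]|
  F G _ [C [k [m [C0 FC]]]] _ [C' [k' [m' [C0' GC]]]]].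
- exists C, k, 0%N; split.
    have := aC 0%N => /(le_trans (normr_ge0 _)); rewrite pmulr_lge0//.
    by rewrite exprn_gt0// (lt_le_trans ltr01).
  by move=> i x; rewrite expr0 mulr1.
- exists 1, 0%N, 1%N; split=> // i x; rewrite expr0 !mul1r expr1.
  apply: (le_trans (abs_le_quad _)); rewrite lerD2l /sqnorm (bigD1 l)//=.
  by rewrite lerDl sumr_ge0// => j _; rewrite sqr_ge0.
- exists 1, 0%N, 0%N; split=> // i x; rewrite !expr0 !mulr1.
  by rewrite ler_norml cos_geN1 cos_le1.
- exists 1, 0%N, 0%N; split=> // i x; rewrite !expr0 !mulr1.
  by rewrite ler_norml sin_geN1 sin_le1.
- exists (C + C'), (k + k')%N, (m + m')%N; split; first exact: addr_ge0.
  move=> i x; rewrite (le_trans (ler_normD _ _))// 2!mulrDl lerD//.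
    apply: (le_trans (FC i x)); rewrite -!mulrA ler_wpM2l// !exprD.
    rewrite ler_pM ?exprn_ge0 ?(le_trans ler01)// ler_peMr ?exprn_ge0 ?exprn_ege1//;
      by rewrite (le_trans ler01).
  apply: (le_trans (GC i x)); rewrite -!mulrA ler_wpM2l// !exprD.
  rewrite ler_pM ?exprn_ge0 ?(le_trans ler01)// ler_peMl ?exprn_ge0 ?exprn_ege1//;
    by rewrite (le_trans ler01).
- exists (C * C'), (k + k')%N, (m + m')%N; split; first exact: mulr_ge0.
  move=> i x; rewrite normrM !exprD.
  rewrite (_ : _ * _ * _ = (C * lam i ^+ k * (1 + sqnorm i x) ^+ m) *
    (C' * lam i ^+ k' * (1 + sqnorm i x) ^+ m')); last by ring.
  by rewrite ler_pM.
Qed.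

Definition gfactor i x := expR (- (pi * sqnorm i x)).

Lemma gfactor_deriv i x k : is_derive x (dir k) (gfactor i)
  (- (2 * pi * rho i) * (rho i * x ord0 k) * gfactor i x).
Proof.
pose s (y : 'rV[R]_N) := - (pi * sqnorm i y).
have ds : is_derive x (dir k) s (- (2 * pi * rho i) * (rho i * x ord0 k)).
  have d l : is_derive x (dir k) (fun y : 'rV[R]_N => (rho i * y ord0 l) ^+ 2)
      (2 * rho i * (k == l)%:R * (rho i * x ord0 l)).
    have h : is_derive x (dir k) (fun y : 'rV[R]_N => rho i * y ord0 l)
      (rho i * (k == l)%:R) by exact: (is_deriveZ _ (is_derive_coord x k l)).
    by apply: (is_derive_eq (is_deriveM_rV h h)); ring.
  have h : is_derive x (dir k) (\sum_(l < N) (fun y : 'rV[R]_N => (rho i * y ord0 l) ^+ 2))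
      (\sum_(l < N) (2 * rho i * (k == l)%:R * (rho i * x ord0 l))).
    exact: is_derive_sum.
  have -> : s = - pi *: (\sum_(l < N) (fun y : 'rV[R]_N => (rho i * y ord0 l) ^+ 2)).
    by apply/funext => y; rewrite /s /sqnorm fctE fct_sumE /GRing.scale /= mulNr.
  apply: (is_derive_eq (is_deriveZ _ h)).
  rewrite (bigD1 k)//= eqxx big1 => [|l lk]; last first.
    by rewrite eq_sym (negbTE lk) mulr0 mul0r.
  by rewrite /GRing.scale /=; ring.
by rewrite mulrC; exact: (is_derive_comp_rV ds (is_derive_expR _)).
Qed.

(** The scale [rho i] enters only through S = [sqnorm i x], so the bound is uniform in [i]. Raising
    (1 + S) / (m + 1) <= exp ((1 + S) / (m + 1)) to the power m gives (1 + S)^m <= (m + 1)^m exp (1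
    + S), and exp (S - pi S) <= 1; [m.+1] keeps the division meaningful at m = 0. *)
Lemma gfactor_bound m : exists2 C, 0 <= C &
  forall i x, (1 + sqnorm i x) ^+ m * gfactor i x <= C.
Proof.
exists (m.+1%:R ^+ m * expR 1); first by rewrite mulr_ge0 ?expR_ge0// exprn_ge0.
move=> i x; set S := sqnorm i x; have S0 : 0 <= S by exact: sqnorm_ge0.
have m0 : 0 < m.+1%:R :> R by rewrite ltr0n.
have h : (1 + S) ^+ m <= m.+1%:R ^+ m * expR (1 + S).
  rewrite -[1 + S in leLHS](mulfVK (lt0r_neq0 m0)) mulrC exprMn.
  rewrite ler_wpM2l ?exprn_ge0 ?(ltW m0)//.
  apply: (@le_trans _ _ (expR ((1 + S) / m.+1%:R) ^+ m)).
    apply: lerXn2r; rewrite ?nnegrE ?expR_ge0 ?divr_ge0 ?addr_ge0 ?(ltW m0)//.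
    by rewrite (le_trans _ (expR_ge1Dx _))// lerDr.
  rewrite -expRM_natl ler_expR mulrA ler_pdivrMr// mulrC ler_wpM2l ?addr_ge0//.
  by rewrite ler_nat.
apply: (@le_trans _ _ (m.+1%:R ^+ m * expR (1 + S) * gfactor i x)).
  by rewrite ler_wpM2r// expR_ge0.
rewrite -mulrA -expRD ler_wpM2l ?exprn_ge0// ler_expR.
rewrite -/S -addrA gerDl subr_le0 ler_peMl//.
by rewrite (le_trans _ (pi_ge2 R))// ler1n.
Qed.

Definition gclass (F : nat -> 'rV[R]_N -> R) :=
  exists2 P, pclass P & F = (fun i x => P i x * gfactor i x).

Lemma gclass_deriv F k : gclass F -> exists2 F', gclass F' & pderiv F F' k.
Proof.
move=> [P PP ->]; have [P' PP' dP] := pclass_deriv k PP.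
exists (fun i x => (P' i x + P i x * (- (2 * pi) * rho i * (rho i * x ord0 k))) *
    gfactor i x).
  exists (fun i x => P' i x + P i x * (- (2 * pi) * rho i * (rho i * x ord0 k))) => //.
  apply: pclass_add => //; apply: pclass_mul => //; apply: pclass_mul.
    exact: (pclass_cst (growth_scale _ growth_rho)).
  exact: pclass_coord.
move=> i x; apply: (is_derive_eq (is_deriveM_rV (dP i x) (gfactor_deriv i x k))).
by rewrite /=; ring.
Qed.

Lemma gclass_bound F : gclass F -> exists C k, 0 <= C /\
  forall i x, `|F i x| <= C * lam i ^+ k.
Proof.
move=> [P /pclass_bound[C [k [m [C0 PC]]]] ->].
have [C' C0' gC] := gfactor_bound m.
exists (C * C'), k; split; first exact: mulr_ge0.
move=> i x; rewrite normrM [X in _ * X]ger0_norm ?expR_ge0//.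
apply: (le_trans (ler_wpM2r (expR_ge0 _) (PC i x))).
rewrite -[leLHS]mulrA [leRHS]mulrAC ler_wpM2l//; first by rewrite mulr_ge0// exprn_ge0// (le_trans ler01).
Qed.

Lemma series_tail (u b : R^nat) n : (forall i, `|u i| <= b i) ->
  cvgn (series b) -> `|sumR u - series u n| <= sumR b - series b n.
Proof.
move=> ub cb; have cu := summable_dominated ub cb.
have cn (w : R^nat) : cvgn (series w) ->
    (fun k => series w k - series w n) k @[k --> \oo] --> sumR w - series w n.
  by move=> cw; apply: cvgB => //; exact: cvg_cst.
rewrite -(cvg_lim (@Rhausdorff R) (cvg_norm (cn _ cu))).
rewrite -(cvg_lim (@Rhausdorff R) (cn _ cb)).
apply: ler_lim.
- by apply/cvg_ex; eexists; exact: (cvg_norm (cn _ cu)).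
- by apply/cvg_ex; eexists; exact: (cn _ cb).
near=> k; rewrite !sub_series_geq; [|by near: k; exact: nbhs_infty_ge..].
by rewrite (le_trans (ler_norm_sum _ _ _))// ler_sum.
Unshelve. all: end_near. Qed.

Definition gsum (F : nat -> 'rV[R]_N -> R) (x : 'rV[R]_N) :=
  sumR (fun i => delta i * F i x).

Lemma growth_summable (C : R) k : cvgn (series (fun i => delta i * (C * lam i ^+ k))).
Proof. by under eq_fun do rewrite mulrCA; exact: summableZ. Qed.

Lemma gsum_summable F x : gclass F -> cvgn (series (fun i => delta i * F i x)).
Proof.
move=> /gclass_bound[C [k [C0 FC]]].
apply: (summable_dominated _ (@growth_summable C k)) => i.
by rewrite normrM ger0_norm// ler_wpM2l.
Qed.

Lemma gsum_bounded F : gclass F -> exists M, forall x, `|gsum F x| <= M.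
Proof.
move=> /gclass_bound[C [k [C0 FC]]].
exists (sumR (fun i => delta i * (C * lam i ^+ k))) => x.
apply: (norm_sumR _ (@growth_summable C k)) => i.
by rewrite normrM ger0_norm// ler_wpM2l.
Qed.

(* Since the class is closed under derivatives, the second derivatives are also
   summably bounded, and the second-order Taylor estimate of each term adds up. *)
Lemma gsum_deriv F F' k x : gclass F -> gclass F' -> pderiv F F' k ->
  is_derive x (dir k) (gsum F) (gsum F' x).
Proof.
move=> FF FF' dF; have [F'' FF'' dF'] := gclass_deriv k FF'.
have [C [m [C0 FC]]] := gclass_bound FF''.
set B := sumR (fun i => delta i * (C * lam i ^+ m)).
have B0 : 0 <= B.
  apply: sumR_ge0 => [i|]; last exact: growth_summable.
  by rewrite !mulr_ge0// exprn_ge0// (le_trans ler01).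
set v := dir k.
have key h : `|gsum F (x + h *: v) - gsum F x - h * gsum F' x| <= B * h ^+ 2.
  have -> : gsum F (x + h *: v) - gsum F x - h * gsum F' x =
      sumR (fun i => delta i * (F i (x + h *: v) - F i x - h * F' i x)).
    have fE : (fun i => delta i * (F i (x + h *: v) - F i x - h * F' i x)) =
        (fun i => (delta i * F i (x + h *: v) + -1 * (delta i * F i x)) +
          - h * (delta i * F' i x)) by apply/funext => i; ring.
    have c1 := @gsum_summable F (x + h *: v) FF; have c2 := @gsum_summable F x FF.
    have c3 := @gsum_summable F' x FF'.
    have c4 := @summableZ _ (-1) _ c2.
    rewrite fE sumRD; [|exact: (is_cvg_seriesD c1 c4)|exact: summableZ].
    by rewrite sumRD// !sumRZ// /gsum; ring.
  have BE : B * h ^+ 2 = sumR (fun i => h ^+ 2 * (delta i * (C * lam i ^+ m))).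
    by rewrite sumRZ 1?mulrC//; exact: growth_summable.
  rewrite BE; apply: norm_sumR => [i|]; last exact/summableZ/growth_summable.
  rewrite normrM ger0_norm// [leRHS]mulrCA ler_wpM2l// [leRHS]mulrC.
  have := @taylor2_bound _ (fun t : R => F i (x + t *: v))
    (fun t : R => F' i (x + t *: v)) (fun t : R => F'' i (x + t *: v))
    (C * lam i ^+ m) h.
  rewrite scale0r addr0; apply.
  - by move=> t; apply/is_derive_line; exact: dF.
  - by move=> t; apply/is_derive_line; exact: dF'.
  - by move=> t; exact: FC.
have lim0 : (fun h : R => h^-1 *: ((gsum F \o shift x) (h *: v) - gsum F x))
    h @[h --> 0^'] --> gsum F' x.
  apply/cvgrPdist_le => e e0; near=> h.
  have h0 : h != 0 by near: h; exact: nbhs_dnbhs_neq.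
  have he : `|h| <= e / (B + 1).
    near: h; apply: dnbhs0_le; rewrite divr_gt0//.
    by rewrite (le_lt_trans B0)// ltrDl.
  rewrite /= [_ + x]addrC.
  have -> : gsum F' x - h^-1 *: (gsum F (x + h *: v) - gsum F x) =
      - (h^-1 * (gsum F (x + h *: v) - gsum F x - h * gsum F' x)).
    by rewrite /GRing.scale /=; field.
  rewrite normrN normrM normfV ler_pdivrMl ?normr_gt0//.
  apply: (le_trans (key h)); rewrite -(real_normK (num_real h)) expr2 mulrA.
  rewrite [leRHS]mulrC ler_wpM2r//.
  rewrite (le_trans (ler_wpM2l B0 he))// mulrA ler_pdivrMr ?(le_lt_trans B0 _) ?ltrDl//.
  by rewrite mulrDr mulr1 mulrC lerDl ltW.
apply: DeriveDef.
  by apply/cvg_ex; exists (gsum F' x).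
exact: (cvg_lim (@Rhausdorff R)).
Unshelve. all: end_near. Qed.

Hypothesis theta_cont : forall i, continuous (theta i).

Lemma pclass_continuous F i : pclass F -> continuous (F i).
Proof.
elim=> {F} [a _|l|||F G _ FC _ GC|F G _ FC _ GC] x.
- exact: cst_continuous.
- apply: (@continuousM _ _ (cst (rho i)) (fun y : 'rV[R]_N => y ord0 l)).
    exact: cst_continuous.
  exact: coord_continuous.
- by apply: continuous_comp; [exact: theta_cont|exact: continuous_cos].
- by apply: continuous_comp; [exact: theta_cont|exact: continuous_sin].
- by apply: (@continuousD _ _ _ (F i) (G i)); [exact: FC|exact: GC].
- by apply: (@continuousM _ _ (F i) (G i)); [exact: FC|exact: GC].
Qed.

Lemma gfactor_continuous i : continuous (gfactor i).
Proof.
move=> x; apply: continuous_comp; last exact: continuous_expR.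
have cq : {for x, continuous (sqnorm i)}.
  apply: continuous_sumR => l.
  have cl : {for x, continuous (fun y : 'rV[R]_N => rho i * y ord0 l)}.
    exact: (@pclass_continuous _ i (pclass_coord l) x).
  exact: (continuousM cl cl).
apply: (@continuousN _ _ _ (fun y => pi * sqnorm i y)).
by apply: (@continuousM _ _ (cst pi) (sqnorm i)); [exact: cst_continuous|].
Qed.

Lemma gclass_continuous F i : gclass F -> continuous (F i).
Proof.
move=> [P PP ->] x; apply: (@continuousM _ _ (P i) (gfactor i)).
  exact: pclass_continuous.
exact: gfactor_continuous.
Qed.

(** Weierstrass: the tails of the series are bounded by those of a numerical series, uniformly in
    the point, so a partial sum and a three-epsilon argument suffice. *)
Lemma gsum_continuous F : gclass F -> continuous (gsum F).
Proof.
move=> FF x; have [C [k [C0 FC]]] := gclass_bound FF.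
have cb := @growth_summable C k.
have tail n y : `|gsum F y - series (fun i => delta i * F i y) n| <=
    sumR (fun i => delta i * (C * lam i ^+ k)) -
    series (fun i => delta i * (C * lam i ^+ k)) n.
  apply: series_tail => // i.
  by rewrite normrM ger0_norm// ler_wpM2l.
apply/(@cvgrPdist_le _ _ _ _ (nbhs_filter x)) => e e0.
have e3 : 0 < e / 3 by rewrite divr_gt0.
have [n nP] : exists n, sumR (fun i => delta i * (C * lam i ^+ k)) -
    series (fun i => delta i * (C * lam i ^+ k)) n <= e / 3.
  have /cvgrPdist_le/(_ _ e3)[n _ nP] := cb.
  by exists n; apply: le_trans (ler_norm _) (nP n _) => /=.
have cS : continuous (fun y => series (fun i => delta i * F i y) n).
  move=> y; apply: continuous_sumR => i.
  apply: (@continuousM _ _ (cst (delta i)) (F i)); first exact: cst_continuous.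
  exact: gclass_continuous.
have hn : \forall y \near x, `|series (fun i => delta i * F i x) n -
    series (fun i => delta i * F i y) n| <= e / 3.
  exact: ((@cvgrPdist_le _ _ _ _ (nbhs_filter x) _ _).1 (cS x) _ e3).
apply: (@filterS _ _ (nbhs_filter x) _ _ _ hn) => y xy.
have h1 := le_trans (tail n x) nP; have h2 := le_trans (tail n y) nP.
set a := series _ n in h1 xy; set b := series _ n in h2 xy.
rewrite (_ : _ - _ = (gsum F x - a) + (a - b) - (gsum F y - b)); last by ring.
rewrite (le_trans (ler_normB _ _))// (le_trans (lerD (ler_normD _ _) h2))//.
rewrite (le_trans (lerD (lerD h1 xy) (lexx _)))//; lra.
Qed.

Hypothesis theta_meas : forall i, measurable_fun setT (theta i).

(** The measurable structure on row vectors is the one generated by the coordinates, so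
    measurability follows the induction on the class instead of being deduced from continuity. *)
Lemma pclass_measurable F i : pclass F -> measurable_fun setT (F i).
Proof.
elim=> {F} [a _|l|||F G _ FC _ GC|F G _ FC _ GC].
- exact: measurable_cst.
- by apply: measurable_funM; [exact: measurable_cst|exact: measurable_coord].
- apply: (@measurableT_comp _ _ _ _ _ _ (@cos R)) => //.
  by apply: continuous_measurable_fun; exact: continuous_cos.
- apply: (@measurableT_comp _ _ _ _ _ _ (@sin R)) => //.
  by apply: continuous_measurable_fun; exact: continuous_sin.
- exact: measurable_funD.
- exact: measurable_funM.
Qed.

Lemma gfactor_measurable i : measurable_fun setT (gfactor i).
Proof.
apply: (@measurableT_comp _ _ _ _ _ _ (@expR R)) => //.
apply: (@measurableT_comp _ _ _ _ _ _ (@GRing.opp R)) => //.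
apply: measurable_funM; first exact: measurable_cst.
apply: measurable_sum => l; apply: measurable_funX.
by apply: measurable_funM; [exact: measurable_cst|exact: measurable_coord].
Qed.

Lemma gclass_measurable F i : gclass F -> measurable_fun setT (F i).
Proof.
move=> [P PP ->]; apply: measurable_funM; first exact: pclass_measurable.
exact: gfactor_measurable.
Qed.

Lemma gsum_measurable F : gclass F -> measurable_fun setT (gsum F).
Proof.
move=> FF; apply: (@measurable_fun_cvg _ _ _ _
  (fun n x => series (fun i => delta i * F i x) n)) => [n|x _].
  rewrite /series /=; apply: measurable_sum => i.
  by apply: measurable_funM => //; exact: gclass_measurable.
exact: gsum_summable.
Qed.

Definition rpartials (s : seq 'I_N) (f : 'rV[R]_N -> R) : 'rV[R]_N -> R :=
  foldr (fun k g x => 'D_(dir k) g x) f s.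

Lemma cpartialsE (s : seq 'I_N) (f g : 'rV[R]_N -> R) :
  cpartials s (fun x => f x +i* g x) =
  (fun x => rpartials s f x +i* rpartials s g x).
Proof. by elim: s => //= k s ->. Qed.

Lemma gsum_rpartials F s : gclass F ->
  exists2 G, gclass G & rpartials s (gsum F) = gsum G.
Proof.
move=> FF; elim: s => [|k s [G GG /= ->]]; first by exists F.
have [G' GG' dG] := gclass_deriv k GG; exists G' => //.
by apply/funext => x; apply: derive_val; exact: gsum_deriv.
Qed.

Lemma gsum_csmooth F G : gclass F -> gclass G ->
  csmooth (fun x => gsum F x +i* gsum G x).
Proof.
move=> FF GG s; rewrite cpartialsE.
have [F' FF' ->] := gsum_rpartials s FF; have [G' GG' ->] := gsum_rpartials s GG.
split=> [||x k]; [exact: gsum_continuous|exact: gsum_continuous|].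
have [F'' FF'' dF] := gclass_deriv k FF'.
have [G'' GG'' dG] := gclass_deriv k GG'.
have h1 := @gsum_deriv _ _ _ x FF' FF'' dF.
have h2 := @gsum_deriv _ _ _ x GG' GG'' dG.
by split; [exact: (@ex_derive _ _ _ _ _ _ _ h1)|exact: (@ex_derive _ _ _ _ _ _ _ h2)].
Qed.

Lemma gsum_cbounded F G s : gclass F -> gclass G ->
  cbounded (cpartials s (fun x => gsum F x +i* gsum G x)).
Proof.
move=> FF GG; rewrite cpartialsE.
have [F' FF' ->] := gsum_rpartials s FF; have [G' GG' ->] := gsum_rpartials s GG.
have [A FA] := gsum_bounded FF'; have [B GB] := gsum_bounded GG'.
exists (A + B) => x; apply: (le_trans (normc_le_ReIm _)).
exact: lerD (FA x) (GB x).
Qed.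

Lemma gclass_mul P F : pclass P -> gclass F ->
  gclass (fun i x => P i x * F i x).
Proof.
move=> PP [Q QQ ->]; exists (fun i x => P i x * Q i x); first exact: pclass_mul.
by apply/funext => i; apply/funext => x; rewrite mulrA.
Qed.

Lemma pclass_prod n (P : 'I_n -> nat -> 'rV[R]_N -> R) (a : 'I_n -> nat) :
  (forall j, pclass (P j)) -> pclass (fun i x => \prod_(j < n) P j i x ^+ a j).
Proof.
move=> PP.
have PX j k : pclass (fun i x => P j i x ^+ k).
  elim: k => [|k IH].
    rewrite (_ : (fun _ _ => _) = (fun _ _ => 1)).
      exact: (pclass_cst (growth_cst 1)).
    by apply/funext => i; apply/funext => x; rewrite expr0.
  rewrite (_ : (fun _ _ => _) = (fun i x => P j i x * P j i x ^+ k)).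
    exact: pclass_mul.
  by apply/funext => i; apply/funext => x; rewrite exprS.
elim: (index_enum _) => [|j s IH].
  rewrite (_ : (fun _ _ => _) = (fun _ _ => 1)).
    exact: (pclass_cst (growth_cst 1)).
  by apply/funext => i; apply/funext => x; rewrite big_nil.
rewrite (_ : (fun _ _ => _) = (fun i x => P j i x ^+ a j *
    \prod_(j <- s) P j i x ^+ a j)).
  exact: pclass_mul.
by apply/funext => i; apply/funext => x; rewrite big_cons.
Qed.

End gaussian_class.

(** * Gaussians are Schwartz functions *)

Section gaussian_schwartz.
Context {R : realType} (n : nat).
Variable r : R.
Hypothesis r0 : 0 < r.
Local Notation rho := (fun _ : nat => r).
Local Notation one := (fun _ : nat => 1 : R).
Local Notation delta := (fun i : nat => (i == 0%N)%:R : R).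
Local Notation theta := (fun (_ : nat) (_ : 'rV[R]_n) => 0 : R).

Definition gaussian (x : 'rV[R]_n) : R :=
  \prod_(l < n) expR (- (pi * r ^+ 2 * x ord0 l ^+ 2)).

Lemma gaussianE x : gaussian x = gfactor rho 0 x.
Proof.
rewrite /gfactor /sqnorm mulr_sumr -sumrN expR_sum.
by apply: eq_bigr => l _; rewrite exprMn -[in LHS]mulrA.
Qed.

Let delta_sum (u : nat -> R) : sumR (fun i => delta i * u i) = u 0%N.
Proof.
apply: (@cvg_lim _ (@Rhausdorff R)); rewrite -(cvg_shiftn 1%N).
rewrite (_ : (fun _ => _) = cst (u 0%N)); first exact: cvg_cst.
apply/funext => k; rewrite /series /= addn1 big_nat_recl//= ?eqxx mul1r.
by rewrite big1 ?addr0// => i _; rewrite mul0r.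
Qed.

(** A single Gaussian is a sum of the preceding kind with one nonzero coefficient, at index 0, and
    with zero phase. The class is closed under derivatives and under multiplication by monomials,
    and its sums are bounded, which are exactly the Schwartz estimates. *)
Lemma gaussian_schwartz : schwartz (fun x : 'rV[R]_n => (gaussian x)%:C).
Proof.
have lam1 (i : nat) : 1 <= one i by [].
have delta0 i : 0 <= delta i by [].
have ds k : cvgn (series (fun i => delta i * one i ^+ k)).
  apply/cvg_ex; exists 1; rewrite -(cvg_shiftn 1%N).
  rewrite (_ : (fun _ => _) = cst 1); first exact: cvg_cst.
  apply/funext => j; rewrite /series /= addn1 big_nat_recl//= ?eqxx mul1r expr1n.
  by rewrite big1 ?addr0// => i _; rewrite mul0r.
have gr : growth one rho by exact: growth_cst.
have td k : exists2 D, pclass rho one theta D & pderiv theta D k.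
  exists theta; first exact: (pclass_cst _ _ (growth_cst _ 0)).
  by move=> i x; exact: is_derive_cst.
have tc (i : nat) : continuous (fun _ : 'rV[R]_n => 0 : R).
  exact: cst_continuous.
pose F (i : nat) (x : 'rV[R]_n) := 1 * gfactor rho i x.
pose Z (i : nat) (x : 'rV[R]_n) := 0 * gfactor rho i x.
have FF : gclass rho one theta F.
  by exists (fun _ _ => 1) => //; exact: (pclass_cst _ _ (growth_cst _ 1)).
have ZZ : gclass rho one theta Z.
  by exists (fun _ _ => 0) => //; exact: (pclass_cst _ _ (growth_cst _ 0)).
have fE : (fun x : 'rV[R]_n => (gaussian x)%:C) =
    (fun x => gsum delta F x +i* gsum delta Z x).
  apply/funext => x; rewrite /gsum !delta_sum /F /Z mul1r mul0r -gaussianE.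
  by [].
rewrite fE; split; first exact: (gsum_csmooth lam1 delta0 ds gr td tc).
move=> a s.
have [F' FF' FE'] := gsum_rpartials lam1 delta0 ds gr td s FF.
have [Z' ZZ' ZE'] := gsum_rpartials lam1 delta0 ds gr td s ZZ.
have mono : pclass rho one theta
    (fun (_ : nat) (x : 'rV[R]_n) => \prod_(l < n) x ord0 l ^+ a l).
  (* Coordinates belong to the class only after rescaling by [r], hence the compensating factor
     [r^-1]. *)
  have -> : (fun (_ : nat) (x : 'rV[R]_n) => \prod_(l < n) x ord0 l ^+ a l) =
      (fun (_ : nat) x => \prod_(l < n) (r^-1 * (r * x ord0 l)) ^+ a l).
    apply/funext => i; apply/funext => x; apply: eq_bigr => l _.
    by rewrite mulrA mulVf ?gt_eqF// mul1r.
  apply: (pclass_prod (P := fun l i x => r^-1 * (r * x ord0 l))) => l.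
  apply: pclass_mul; first exact: (pclass_cst _ _ (growth_cst _ _)).
  exact: (pclass_coord rho one theta l).
have [A FA] := gsum_bounded lam1 delta0 ds (gclass_mul mono FF').
have [B ZB] := gsum_bounded lam1 delta0 ds (gclass_mul mono ZZ').
exists (A + B) => x; rewrite cpartialsE FE' ZE'.
rewrite (le_trans (normc_le_ReIm _))// cReM cImM /= !mul0r subr0 addr0.
have := FA x; have := ZB x; rewrite /gsum !delta_sum => h1 h2.
by rewrite lerD.
Qed.

End gaussian_schwartz.

(** * The multiplier *)

Section gauss_rV.
Context {R : realType}.
Local Notation mu n := (lebesgue_rV R n).

Lemma gauss_rV n (r : R) : 0 < r ->
  (mu n).-integrable setT
    (EFin \o (fun x => \prod_(l < n) expR (- (pi * (r * x ord0 l) ^+ 2)))) /\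
  \int[mu n]_x (\prod_(l < n) expR (- (pi * (r * x ord0 l) ^+ 2))) = r^-1 ^+ n.
Proof.
move=> r0; have c0 : 0 < pi * r ^+ 2 by rewrite mulr_gt0 ?pi_gt0 ?exprn_gt0.
pose h (_ : 'I_n) (y : R) : R[i] := (expR (- (pi * r ^+ 2) * y ^+ 2))%:C.
have hi l : cintegrable (@lebesgue_measure R) (h l).
  split; first exact: integrable_gauss.
  rewrite (_ : _ \o _ = cst 0%E); last by apply/funext.
  exact: integrable0.
have [[i1 _] e] := tensor_rV hi.
have hE (x : 'rV[R]_n) : \prod_(l < n) h l (x ord0 l) =
    (\prod_(l < n) expR (- (pi * (r * x ord0 l) ^+ 2)))%:C.
  rewrite rmorph_prod; apply: eq_bigr => l _; congr (expR _)%:C.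
  by rewrite exprMn; ring.
split.
  apply: eq_integrable i1 => // x _ /=.
  by rewrite hE.
transitivity (Re (cintegral (mu n) (fun v => \prod_(i < n) h i (v ord0 i)))).
  by apply: eq_Rintegral => x _; rewrite hE.
rewrite e.
have -> : \prod_(l < n) cintegral (@lebesgue_measure R) (h l) = (r^-1 ^+ n)%:C.
  rewrite rmorphXn -[in RHS](card_ord n) -prodr_const; apply: eq_bigr => l _.
  apply: complex_ext; rewrite /= ?Rintegral_gauss//; last first.
    by rewrite /Rintegral integral0.
  rewrite invfM mulrA mulfV ?gt_eqF ?pi_gt0// mul1r -exprVn sqrtr_sqr.
  by rewrite gtr0_norm ?invr_gt0.
by [].
Qed.

End gauss_rV.

Section multiplier.
Context {R : realType} (n : nat).

(* In the notation of the header, [lambda_i = chirp i], [R_i = root_width i ^ 2],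
   [1 / R_i = inv_width i], [tau_i = chirp i * inv_width i] and
   [delta_i = weight i]; the square roots of [lambda_i] and [R_i] are named
   because [R_i] enters [delta_i] with the exponent [- n / 2]. *)
Definition freq (i : nat) : R := 4 ^+ i.
Definition chirp (i : nat) : R := freq i ^+ 2.
Definition root_width (i : nat) : R := 2 ^+ (4 ^ (i + 2))%N.
Definition inv_width (i : nat) : R := (root_width i ^+ 2)^-1.
Definition weight (i : nat) : R := 2^-1 ^+ i.+1 * (root_width i)^-1 ^+ n.
Definition phi (i : nat) (x : 'rV[R]_(n + n)) : R :=
  pi * (chirp i * inv_width i) *
  \sum_(a < n) (x ord0 (lshift n a) + x ord0 (rshift n a)) ^+ 2.
Definition cosine (i : nat) (x : 'rV[R]_(n + n)) : R :=
  cos (phi i x) * gfactor inv_width i x.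
Definition sine (i : nat) (x : 'rV[R]_(n + n)) : R :=
  sin (phi i x) * gfactor inv_width i x.
Definition multiplier (x : 'rV[R]_(n + n)) : R[i] :=
  gsum weight cosine x +i* gsum weight sine x.

Lemma root_width_ge1 i : 1 <= root_width i.
Proof. by rewrite exprn_ege1// ler1n. Qed.

Lemma root_width_gt0 i : 0 < root_width i.
Proof. exact: lt_le_trans (root_width_ge1 i). Qed.

Lemma inv_width_gt0 i : 0 < inv_width i.
Proof. by rewrite invr_gt0 exprn_gt0// root_width_gt0. Qed.

Lemma chirp_ge1 i : 1 <= chirp i.
Proof. by rewrite exprn_ege1// exprn_ege1// ler1n. Qed.

Lemma weight_ge0 i : 0 <= weight i.
Proof.
by rewrite mulr_ge0// exprn_ge0// ?invr_ge0// ltW// root_width_gt0.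
Qed.

Lemma half_summable : cvgn (series (fun i => 2^-1 ^+ i.+1 : R)) /\
  sumR (fun i => 2^-1 ^+ i.+1 : R) = 1.
Proof.
have h : (fun i => 2^-1 ^+ i.+1 : R) = geometric 2^-1 2^-1.
  by apply/funext => i; rewrite /geometric /= exprS.
have l : `|2^-1 : R| < 1 by rewrite ger0_norm// invf_lt1// ltr1n.
have c := @cvg_geometric_series _ (2^-1 : R) _ l.
rewrite -h (_ : 2^-1 / (1 - 2^-1) = 1) in c; last by field.
split; first by apply/cvg_ex; exists 1.
exact: (cvg_lim (@Rhausdorff R)).
Qed.

Hypothesis n0 : (0 < n)%N.

(** In powers of 2, [chirp i ^+ k] has exponent 4 i k <= i^2 + 4 k^2 <= 4^(i + 2) + 4 k^2, so a
    single factor [root_width i] absorbs it up to the constant 2^(4 k^2). Positivity of [n] provides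
    that factor in [weight n i]. *)
Lemma weight_summable k : cvgn (series (fun i => weight i * chirp i ^+ k)).
Proof.
have [cs _] := half_summable.
apply: (@summable_dominated _ _ (fun i => 2 ^+ (4 * k ^ 2) * 2^-1 ^+ i.+1)).
  move=> i; rewrite ger0_norm; last first.
    by rewrite mulr_ge0 ?weight_ge0// exprn_ge0// (le_trans ler01)// chirp_ge1.
  rewrite /weight -mulrA [leRHS]mulrC ler_wpM2l ?exprn_ge0//.
  rewrite exprVn ler_pdivrMl ?exprn_gt0 ?root_width_gt0//.
  apply: (@le_trans _ _ (root_width i * 2 ^+ (4 * k ^ 2))).
    rewrite /chirp /freq /root_width -!exprM -exprD.
    have -> : (4 : R) = 2 ^+ 2 by rewrite expr2 -natrM.
    rewrite -exprM ler_eXn2l ?ltr1n//.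
    have : (i ^ 2 <= 4 ^ (i + 2))%N.
      elim: i => // i; rewrite addSn [(4 ^ (i + 2).+1)%N]expnS; nia.
    move: (4 ^ (i + 2))%N => X; have := (nat_AGM2 i (2 * k)).1; rewrite -!mulnn.
    nia.
  rewrite ler_wpM2r ?exprn_ge0// -[leLHS]expr1.
  by rewrite ler_weXn2l ?root_width_ge1.
exact: summableZ.
Qed.

Lemma inv_width_growth : growth chirp inv_width.
Proof.
exists 1, 0%N => i; rewrite mulr1 ger0_norm; last exact/ltW/inv_width_gt0.
by rewrite invf_le1 ?exprn_gt0 ?root_width_gt0// exprn_ege1// root_width_ge1.
Qed.

Lemma chirp_growth c : growth chirp (fun i => c * chirp i).
Proof.
exists `|c|, 1%N => i; rewrite expr1 normrM [`|chirp i|]ger0_norm//.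
by rewrite (le_trans ler01)// chirp_ge1.
Qed.

(** The phase is quadratic with coefficient [chirp i * inv_width i]. After one derivative a linear
    form remains, with which [inv_width i] combines into rescaled coordinates, and only [chirp i] is
    left over. *)
Lemma phi_deriv k : exists2 D, pclass inv_width chirp phi D &
  pderiv phi D k.
Proof.
pose z (x : 'rV[R]_(n + n)) (a : 'I_n) := x ord0 (lshift n a) + x ord0 (rshift n a).
pose d (a : 'I_n) : R := (k == lshift n a)%:R + (k == rshift n a)%:R.
exists (fun i x => 2 * pi * chirp i * \sum_(a < n) d a *
    (inv_width i * x ord0 (lshift n a) + inv_width i * x ord0 (rshift n a))).
  apply: pclass_mul; first exact: (pclass_cst _ _ (chirp_growth _)).
  elim: (index_enum _) => [|a s IH].
    have -> : (fun (i : nat) (x : 'rV[R]_(n + n)) => \sum_(a <- [::]) d a *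
      (inv_width i * x ord0 (lshift n a) + inv_width i * x ord0 (rshift n a))) =
      (fun _ _ => 0).
      by apply/funext => i; apply/funext => x; rewrite big_nil.
    exact: (pclass_cst _ _ (growth_cst _ 0)).
  have -> : (fun (i : nat) (x : 'rV[R]_(n + n)) => \sum_(b <- a :: s) d b *
      (inv_width i * x ord0 (lshift n b) + inv_width i * x ord0 (rshift n b))) =
      (fun i x => d a *
      (inv_width i * x ord0 (lshift n a) + inv_width i * x ord0 (rshift n a)) +
      \sum_(b <- s) d b *
      (inv_width i * x ord0 (lshift n b) + inv_width i * x ord0 (rshift n b))).
    by apply/funext => i; apply/funext => x; rewrite big_cons.
  apply: pclass_add => //; apply: pclass_mul.
    exact: (pclass_cst _ _ (growth_cst _ _)).
  by apply: pclass_add; exact: pclass_coord.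
move=> i x.
have dz a : is_derive x (delta_mx ord0 k) (fun y => z y a ^+ 2) (2 * d a * z x a).
  have h : is_derive x (delta_mx ord0 k) (fun y => z y a) (d a).
    exact: (is_deriveD (is_derive_coord x k _) (is_derive_coord x k _)).
  by apply: (is_derive_eq (is_deriveM_rV h h)); ring.
have h : is_derive x (delta_mx ord0 k) (\sum_(a < n) (fun y => z y a ^+ 2))
    (\sum_(a < n) (2 * d a * z x a)) by exact: is_derive_sum.
have -> : phi i = (pi * (chirp i * inv_width i)) *: (\sum_(a < n) (fun y => z y a ^+ 2)).
  by apply/funext => y; rewrite /phi fctE fct_sumE.
apply: (is_derive_eq (is_deriveZ _ h)).
rewrite /GRing.scale /= !mulr_sumr; apply: eq_bigr => a _.
by rewrite /z; ring.
Qed.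

Lemma phi_continuous i : continuous (phi i).
Proof.
move=> x; pose S (y : 'rV[R]_(n + n)) : R :=
  \sum_(a < n) (y ord0 (lshift n a) + y ord0 (rshift n a)) ^+ 2.
suff cS : {for x, continuous S}.
  have cc : {for x, continuous (cst (pi * (chirp i * inv_width i)) : 'rV[R]_(n + n) -> R)}.
    exact: cst_continuous.
  exact: (continuousM cc cS).
apply: continuous_sumR => a.
have h : {for x, continuous
    (fun y : 'rV[R]_(n + n) => y ord0 (lshift n a) + y ord0 (rshift n a))}.
  by apply: (@continuousD _ _ _ (fun y : 'rV[R]_(n + n) => y ord0 (lshift n a))
    (fun y => y ord0 (rshift n a))); exact: coord_continuous.
exact: (continuousM h h).
Qed.

Lemma phi_measurable i : measurable_fun setT (phi i).
Proof.
apply: measurable_funM; first exact: measurable_cst.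
apply: measurable_sum => a; apply: measurable_funX.
by apply: measurable_funD; exact: measurable_coord.
Qed.

Lemma cosine_gclass : gclass inv_width chirp phi cosine.
Proof. by exists (fun i x => cos (phi i x)) => //; exact: pclass_cos. Qed.

Lemma sine_gclass : gclass inv_width chirp phi sine.
Proof. by exists (fun i x => sin (phi i x)) => //; exact: pclass_sin. Qed.

Lemma multiplier_csmooth : csmooth multiplier.
Proof.
exact: (gsum_csmooth chirp_ge1 weight_ge0 weight_summable inv_width_growth
  phi_deriv phi_continuous cosine_gclass sine_gclass).
Qed.

Lemma multiplier_cpartials_bounded s : cbounded (cpartials s multiplier).
Proof.
exact: (gsum_cbounded chirp_ge1 weight_ge0 weight_summable inv_width_growth
  phi_deriv s cosine_gclass sine_gclass).
Qed.

Lemma multiplier_measurable :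
  measurable_fun setT (fun x => Re (multiplier x)) /\
  measurable_fun setT (fun x => Im (multiplier x)).
Proof.
split.
  exact: (gsum_measurable chirp_ge1 weight_ge0 weight_summable
    phi_measurable cosine_gclass).
exact: (gsum_measurable chirp_ge1 weight_ge0 weight_summable
  phi_measurable sine_gclass).
Qed.

End multiplier.

Section series_integral.
Context {R : realType}.
Implicit Types (a w u : R^nat).

Lemma eseries_sumR a : cvgn (series a) ->
  (\sum_(0 <= i <oo) (a i)%:E = (sumR a)%:E)%E.
Proof.
move=> ca; apply: (@cvg_lim _ (@ereal_hausdorff R)).
have -> : (fun k => \sum_(0 <= i < k) (a i)%:E)%E = EFin \o series a.
  by apply/funext => k; rewrite /= sumEFin.
by apply: cvg_EFin; [exact: nearW|exact: ca].
Qed.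

(* [0 <= sum w (u - S)^2] with [S = sum w u]. *)
Lemma sqr_sumR_le w u : (forall i, 0 <= w i) -> cvgn (series w) ->
  sumR w = 1 -> (forall i, 0 <= u i <= 1) ->
  sumR (fun i => w i * u i) ^+ 2 <= sumR (fun i => w i * u i ^+ 2).
Proof.
move=> w0 cw w1 u01.
have c1 : cvgn (series (fun i => w i * u i)).
  apply: (@summable_dominated _ _ w) => // i; have /andP[u0 u1] := u01 i.
  by rewrite ger0_norm ?mulr_ge0// ler_piMr.
have c2 : cvgn (series (fun i => w i * u i ^+ 2)).
  apply: (@summable_dominated _ _ w) => // i; have /andP[u0 u1] := u01 i.
  by rewrite ger0_norm ?mulr_ge0 ?exprn_ge0// ler_piMr// exprn_ile1.
set S := sumR (fun i => w i * u i).
have c3 := @summableZ _ (- 2 * S) _ c1.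
have c4 := @summableZ _ (S ^+ 2) _ cw.
have c34 : cvgn (series (fun i => - 2 * S * (w i * u i) + S ^+ 2 * w i)).
  exact: (is_cvg_seriesD c3 c4).
have e : (fun i => w i * (u i - S) ^+ 2) = (fun i => w i * u i ^+ 2 +
    (- 2 * S * (w i * u i) + S ^+ 2 * w i)).
  by apply/funext => i; ring.
have : 0 <= sumR (fun i => w i * (u i - S) ^+ 2).
  apply: sumR_ge0 => [i|]; first by rewrite mulr_ge0// sqr_ge0.
  by rewrite e; exact: (is_cvg_seriesD c2 c34).
rewrite e sumRD// sumRD// !sumRZ// w1 -/S; nra.
Qed.

Lemma normc_sumR_le (u v b : R^nat) : (forall i, `|u i| <= b i) ->
  (forall i, `|v i| <= b i) -> cvgn (series b) ->
  normc (sumR u +i* sumR v) <= 2 * sumR b.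
Proof.
move=> ub vb cb; apply: (le_trans (normc_le_ReIm _)) => /=.
by rewrite mulr2n mulrDl mul1r lerD// norm_sumR.
Qed.

End series_integral.

(** * The multiplier belongs to L^4 *)

Section multiplier_L4.
Context {R : realType} (n : nat).
Hypothesis n0 : (0 < n)%N.
Local Notation mu := (lebesgue_rV R (n + n)).
Local Notation env i x := (gfactor (@inv_width R) i x).

Lemma gfactorE N (rho : nat -> R) i (x : 'rV[R]_N) :
  gfactor rho i x = \prod_(l < N) expR (- (pi * (rho i * x ord0 l) ^+ 2)).
Proof. by rewrite /gfactor /sqnorm mulr_sumr -sumrN expR_sum. Qed.

Lemma gfactor_ge0 N (rho : nat -> R) i (x : 'rV[R]_N) : 0 <= gfactor rho i x.
Proof. exact: expR_ge0. Qed.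

Lemma gfactor_le1 N (rho : nat -> R) i (x : 'rV[R]_N) : gfactor rho i x <= 1.
Proof.
by rewrite -expR0 ler_expR oppr_le0 mulr_ge0 ?pi_ge0// sqnorm_ge0.
Qed.

Lemma cosine_le i (x : 'rV[R]_(n + n)) : `|cosine i x| <= env i x.
Proof.
rewrite normrM (ger0_norm (gfactor_ge0 _ _ _)) ler_piMl ?gfactor_ge0//.
by rewrite ler_norml cos_geN1 cos_le1.
Qed.

Lemma sine_le i (x : 'rV[R]_(n + n)) : `|sine i x| <= env i x.
Proof.
rewrite normrM (ger0_norm (gfactor_ge0 _ _ _)) ler_piMl ?gfactor_ge0//.
by rewrite ler_norml sin_geN1 sin_le1.
Qed.

Lemma weight_env_summable (x : 'rV[R]_(n + n)) :
  cvgn (series (fun i => weight n i * env i x)).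
Proof.
apply: (@summable_dominated _ _ (fun i => weight n i * chirp i ^+ 0)).
  move=> i; rewrite ger0_norm ?(mulr_ge0 (weight_ge0 _ _) (gfactor_ge0 _ _ _))//.
  by rewrite ler_wpM2l ?weight_ge0// gfactor_le1.
exact: (@weight_summable R n n0 0).
Qed.

Lemma normc_multiplier_le (x : 'rV[R]_(n + n)) :
  normc (multiplier x) <= 2 * sumR (fun i => weight n i * env i x).
Proof.
apply: (normc_sumR_le _ _ (@weight_env_summable x)) => i; rewrite normrM ger0_norm ?weight_ge0//
  ler_wpM2l ?weight_ge0//; [exact: cosine_le|exact: sine_le].
Qed.

(** The envelope of the [i]-th block without its factor 2^-(i + 1). These factors sum to 1 and act
    as probability weights, so the series of envelopes is an average of numbers in [0, 1]. *)
Let u (i : nat) (x : 'rV[R]_(n + n)) := (root_width i : R)^-1 ^+ n * env i x.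

Let u01 i x : 0 <= u i x <= 1.
Proof.
have Q1 : 0 <= (root_width i : R)^-1 <= 1.
  by rewrite invr_ge0 invf_le1 ?root_width_gt0// root_width_ge1 ltW// root_width_gt0.
have /andP[Q0 Q2] := Q1.
rewrite mulr_ge0 ?exprn_ge0 ?gfactor_ge0//= mulr_ile1 ?exprn_ge0 ?gfactor_ge0//.
  by rewrite exprn_ile1.
exact: gfactor_le1.
Qed.

Let u4 i x : u i x ^+ 4 = (root_width i : R)^-1 ^+ (4 * n) *
  \prod_(l < n + n) expR (- (pi * (2 * inv_width i * x ord0 l) ^+ 2)).
Proof.
rewrite exprMn -exprM mulnC; congr (_ * _).
rewrite gfactorE -prodrXl; apply: eq_bigr => l _.
by rewrite -expRM_natl; congr expR; ring.
Qed.

(** Convexity replaces Minkowski's inequality in L^4: the square of an average is at most the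
    average of the squares, used twice, after which the fourth powers can be integrated term by
    term. The constant 16 is 2^4, from bounding the modulus by the sum of the absolute real and
    imaginary parts. *)
Lemma normc_multiplier4_le (x : 'rV[R]_(n + n)) :
  normc (multiplier x) ^+ 4 <= 16 * sumR (fun i => 2^-1 ^+ i.+1 * u i x ^+ 4).
Proof.
have [cw w1] := @half_summable R.
have w0 i : 0 <= (2^-1 ^+ i.+1 : R) by rewrite exprn_ge0.
have S0 (v : R^nat) : (forall i, 0 <= v i <= 1) ->
    0 <= sumR (fun i => 2^-1 ^+ i.+1 * v i).
  move=> v01; apply: sumR_ge0 => [i|].
    by rewrite mulr_ge0//; have /andP[] := v01 i.
  apply: (@summable_dominated _ _ (fun i => 2^-1 ^+ i.+1)) => // i.
  have /andP[v0 v1] := v01 i.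
  by rewrite ger0_norm ?mulr_ge0// ler_piMr.
have u2 i : 0 <= u i x ^+ 2 <= 1.
  have /andP[a0 a1] := u01 i x.
  by rewrite exprn_ge0//= exprn_ile1.
have j1 := sqr_sumR_le w0 cw w1 (u01^~ x).
have j2 := sqr_sumR_le w0 cw w1 u2.
have h : normc (multiplier x) <= 2 * sumR (fun i => 2^-1 ^+ i.+1 * u i x).
  apply: (le_trans (normc_multiplier_le x)); rewrite le_eqVlt; apply/orP; left.
  by apply/eqP; congr (_ * sumR _); apply/funext => i; rewrite /weight mulrA.
have -> : (fun i => 2^-1 ^+ i.+1 * u i x ^+ 4) =
    (fun i => 2^-1 ^+ i.+1 * (u i x ^+ 2) ^+ 2).
  by apply/funext => i; rewrite -exprM.
have S1 := S0 _ (u01^~ x); have S2 := S0 _ u2.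
apply: (@le_trans _ _ ((2 * sumR (fun i => 2^-1 ^+ i.+1 * u i x)) ^+ 4)).
  by rewrite lerXn2r ?nnegrE ?normc_ge0 ?mulr_ge0.
rewrite exprMn (_ : 2 ^+ 4 = 16 :> R); last by rewrite -natrX.
rewrite ler_wpM2l// (exprM _ 2 2) (le_trans _ j2)//.
by rewrite lerXn2r ?nnegrE ?sqr_ge0.
Qed.

Lemma multiplier_L4 : in_cLp mu 4 (@multiplier R n).
Proof.
have [mR mI] := @multiplier_measurable R n n0; split=> //.
rewrite /cLnorm unlock; apply: poweR_lty.
have [cw w1] := @half_summable R.
have mu4 i : measurable_fun setT (fun x => 2^-1 ^+ i.+1 * u i x ^+ 4).
  apply: measurable_funM; first exact: measurable_cst.
  apply: measurable_funX; apply: measurable_funM; first exact: measurable_cst.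
  exact: gfactor_measurable.
have g0 i (x : 'rV[R]_(n + n)) : 0 <= 2^-1 ^+ i.+1 * u i x ^+ 4.
  by rewrite mulr_ge0 ?exprn_ge0//; have /andP[] := u01 i x.
have cu x : cvgn (series (fun i => 2^-1 ^+ i.+1 * u i x ^+ 4)).
  apply: (@summable_dominated _ _ (fun i => 2^-1 ^+ i.+1)) => // i.
  have /andP[a0 a1] := u01 i x.
  by rewrite ger0_norm// ler_piMr ?exprn_ge0// exprn_ile1.
(* As a polynomial in the real and imaginary parts the fourth power is visibly measurable. *)
rewrite (eq_integral (fun x => ((Re (multiplier x) ^+ 2 + Im (multiplier x) ^+ 2) ^+ 2)%:E));
  last first.
  move=> x _.
  rewrite /= ger0_norm ?normc_ge0// powR_mulrn ?normc_ge0//.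
  by rewrite (exprM _ 2 2) sqr_sqrtr// addr_ge0 ?sqr_ge0.
have ms : measurable_fun setT (fun x : 'rV[R]_(n + n) =>
    (\sum_(0 <= i <oo) (2^-1 ^+ i.+1 * u i x ^+ 4)%:E)%E).
  apply: ge0_emeasurable_sum => [i x _ _|i _]; first by rewrite lee_fin.
  exact/measurable_EFinP.
apply: (@le_lt_trans _ _ (\int[mu]_x
    (16%:E * \sum_(0 <= i <oo) (2^-1 ^+ i.+1 * u i x ^+ 4)%:E))%E).
  apply: ge0_le_integral => //.
  - by move=> x _; rewrite lee_fin sqr_ge0.
  - apply/measurable_EFinP; apply: measurable_funX.
    by apply: measurable_funD; exact: measurable_funX.
  - by apply: emeasurable_funM => //; exact: measurable_cst.
  - move=> x _; rewrite eseries_sumR// -EFinM lee_fin.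
    by have := normc_multiplier4_le x; rewrite (exprM _ 2 2) normc_sqr.
rewrite ge0_integralZl//; last first.
  by move=> x _; apply: nneseries_ge0 => i _ _; rewrite lee_fin.
rewrite lte_mul_pinfty// ?lee_fin//.
rewrite integral_nneseries//; last 2 first.
- by move=> i; apply/measurable_EFinP.
- by move=> i x _; rewrite lee_fin.
apply: (@le_lt_trans _ _ (\sum_(0 <= i <oo) (2^-1 ^+ i.+1 : R)%:E)%E); last first.
  by rewrite eseries_sumR// ltry.
apply: lee_nneseries => [i *|i *]; first by apply: integral_ge0 => x _; rewrite lee_fin.
have w0 : 0 < 2 * inv_width i :> R by rewrite mulr_gt0 ?inv_width_gt0.
have [gi gE] := gauss_rV (n + n) w0.
under eq_integral => x _ do rewrite u4 mulrA EFinM.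
rewrite integralZl//.
rewrite -[X in (_ * X)%E]fineK; last exact: integrable_fin_num.
rewrite [fine _]gE -EFinM lee_fin -[leRHS]mulr1 -mulrA ler_wpM2l ?exprn_ge0//.
(* The fourth power of the envelope is a Gaussian of half the width, whose integral over R^(2n)
   cancels the prefactor [(root_width i)^-1 ^+ (4 * n)] up to 2^-(2n). *)
rewrite /inv_width invfM invrK exprMn exprVn mulrC -exprM.
rewrite (_ : (2 * (n + n) = 4 * n)%N); last by lia.
rewrite mulfK ?gt_eqF ?exprn_gt0 ?root_width_gt0//.
by rewrite exprn_ile1// invf_le1// ler1n.
Qed.

End multiplier_L4.

(** * The bilinear operator on Gaussians *)

Section iterated_integral_bound.
Context d1 d2 (T1 : measurableType d1) (T2 : measurableType d2) (R : realType).
Variable m1 : {sigma_finite_measure set T1 -> \bar R}.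
Variable m2 : {sigma_finite_measure set T2 -> \bar R}.
Variables (a b : T1 -> R) (a' b' : T2 -> R).
Hypothesis ai : m1.-integrable setT (EFin \o a).
Hypothesis bi : m1.-integrable setT (EFin \o b).
Hypothesis ai' : m2.-integrable setT (EFin \o a').
Hypothesis bi' : m2.-integrable setT (EFin \o b').

(** The majorant has two tensor terms because the remainder of the multiplier does: one for the
    blocks below the chosen scale, one for those above. Integrability on the product space supplies
    the measurability of the inner integral. *)
Lemma real_iterated_bound (f : T1 * T2 -> R) : measurable_fun setT f ->
  (forall x y, `|f (x, y)| <= a x * a' y + b x * b' y) ->
  [/\ forall y, m1.-integrable setT (EFin \o (fun x => f (x, y))),
      m2.-integrable setT (EFin \o (fun y => \int[m1]_x f (x, y))) &
      `|\int[m2]_y \int[m1]_x f (x, y)| <=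
        \int[m1]_x a x * \int[m2]_y a' y + \int[m1]_x b x * \int[m2]_y b' y].
Proof.
move=> mf fab.
have abi y : m1.-integrable setT (EFin \o (fun x => a x * a' y + b x * b' y)).
  apply: integrable_EFinD.
    by under eq_fun do rewrite mulrC; exact: integrable_EFinZ.
  by under eq_fun do rewrite mulrC; exact: integrable_EFinZ.
have fi y : m1.-integrable setT (EFin \o (fun x => f (x, y))).
  apply: le_integrable (abi y) => //.
    by apply/measurable_EFinP; exact: (measurableT_comp mf).
  by move=> x _ /=; rewrite lee_fin (le_trans (fab x y))// ler_norm.
have fi2 : (m1 \x m2)%E.-integrable setT (EFin \o f).
  have : (m1 \x m2)%E.-integrable setT
      (EFin \o (fun z => a z.1 * a' z.2 + b z.1 * b' z.2)).
    by apply: integrable_EFinD; exact: tensor2_integrable.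
  apply: le_integrable => //; first exact/measurable_EFinP.
  by move=> [x y] _ /=; rewrite lee_fin (le_trans (fab x y))// ler_norm.
have hE : EFin \o (fun y => \int[m1]_x f (x, y)) = fubini_G m1 (EFin \o f).
  apply/funext => y; rewrite /fubini_G /= /Rintegral fineK//.
  exact: (integrable_fin_num _ (fi y)).
have hb y : `|\int[m1]_x f (x, y)| <= \int[m1]_x a x * a' y + \int[m1]_x b x * b' y.
  rewrite (le_trans (le_normr_Rintegral _ (fi y)))//.
  have aE : \int[m1]_x (a x * a' y + b x * b' y) =
      \int[m1]_x a x * a' y + \int[m1]_x b x * b' y.
    rewrite RintegralD// ?RintegralZr//.
      by under eq_fun do rewrite mulrC; exact: integrable_EFinZ.
    by under eq_fun do rewrite mulrC; exact: integrable_EFinZ.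
  rewrite -aE le_Rintegral//.
  rewrite (_ : _ \o _ = abse \o (EFin \o (fun x => f (x, y))))//.
  exact: integrable_abse.
have hi : m2.-integrable setT (EFin \o (fun y => \int[m1]_x f (x, y))).
  have : m2.-integrable setT (EFin \o (fun y =>
      \int[m1]_x a x * a' y + \int[m1]_x b x * b' y)).
    by apply: integrable_EFinD; exact: integrable_EFinZ.
  apply: le_integrable => //; first by rewrite hE; exact: (measurable_fubini_G fi2).
  by move=> y _ /=; rewrite lee_fin (le_trans (hb y))// ler_norm.
split=> //; rewrite (le_trans (le_normr_Rintegral _ hi))//.
rewrite -!RintegralZl// -RintegralD//; [|exact: integrable_EFinZ..].
rewrite le_Rintegral//.
  rewrite (_ : _ \o _ = abse \o (EFin \o (fun y => \int[m1]_x f (x, y))))//.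
  exact: integrable_abse.
by apply: integrable_EFinD; exact: integrable_EFinZ.
Qed.

Lemma complex_iterated_bound (f : T1 * T2 -> R[i]) :
  measurable_fun setT (fun z => Re (f z)) ->
  measurable_fun setT (fun z => Im (f z)) ->
  (forall x y, normc (f (x, y)) <= a x * a' y + b x * b' y) ->
  [/\ forall y, cintegrable m1 (fun x => f (x, y)),
      cintegrable m2 (fun y => cintegral m1 (fun x => f (x, y))) &
      normc (cintegral m2 (fun y => cintegral m1 (fun x => f (x, y)))) <=
      2 * (\int[m1]_x a x * \int[m2]_y a' y + \int[m1]_x b x * \int[m2]_y b' y)].
Proof.
move=> mR mI fab.
have [i1 h1 b1] := real_iterated_bound mR
  (fun x y => le_trans (Re_le_normc _) (fab x y)).
have [i2 h2 b2] := real_iterated_bound mI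
  (fun x y => le_trans (Im_le_normc _) (fab x y)).
split=> [y||]; [by split|by split|].
apply: (le_trans (normc_le_ReIm _)).
by rewrite mulr2n mulrDl mul1r lerD.
Qed.

End iterated_integral_bound.

Section complex_measurable.
Context d (T : measurableType d) (R : realType).
Implicit Types f g : T -> R[i].

Definition cmeasurable f := measurable_fun setT (fun x => Re (f x)) /\
  measurable_fun setT (fun x => Im (f x)).

Lemma cmeasurableM f g : cmeasurable f -> cmeasurable g ->
  cmeasurable (fun x => f x * g x).
Proof.
move=> [f1 f2] [g1 g2]; split.
  under eq_fun do rewrite cReM.
  by apply: measurable_funB; exact: measurable_funM.
under eq_fun do rewrite cImM.
by apply: measurable_funD; exact: measurable_funM.
Qed.

Lemma cmeasurableB f g : cmeasurable f -> cmeasurable g ->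
  cmeasurable (fun x => f x - g x).
Proof.
move=> [f1 f2] [g1 g2]; split.
  by under eq_fun do rewrite cReB; exact: measurable_funB.
by under eq_fun do rewrite cImB; exact: measurable_funB.
Qed.

Lemma cmeasurable_real (f : T -> R) : measurable_fun setT f ->
  cmeasurable (fun x => (f x)%:C).
Proof. by move=> mf; split => //; exact: measurable_cst. Qed.

Lemma cmeasurable_cis (f : T -> R) : measurable_fun setT f ->
  cmeasurable (fun x => cis (f x)).
Proof.
move=> mf; split => /=.
  apply: (@measurableT_comp _ _ _ _ _ _ (@cos R)) => //.
  by apply: continuous_measurable_fun; exact: continuous_cos.
apply: (@measurableT_comp _ _ _ _ _ _ (@sin R)) => //.
by apply: continuous_measurable_fun; exact: continuous_sin.
Qed.

End complex_measurable.

Section gaussian_bilinear.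
Context {R : realType} (n : nat).
Local Notation mu := (lebesgue_rV R n).

Lemma cis_sum (I : Type) (s : seq I) (F : I -> R) :
  cis (\sum_(i <- s) F i) = \prod_(i <- s) cis (F i).
Proof.
apply: (big_morph (@cis R)) => [x y|]; last by rewrite /cis cos0 sin0.
by rewrite !cis_cexp -cexpD; congr cexp; apply: complex_ext; rewrite !ReImE /= ?addr0.
Qed.

Lemma fourier_gaussian (r : R) (xi : 'rV[R]_n) : 0 < r ->
  fourier (fun x : 'rV[R]_n => (gaussian r x)%:C) xi =
  (r^-1 ^+ n * \prod_(l < n) expR (- (pi * (r^-1 * xi ord0 l) ^+ 2)))%:C.
Proof.
move=> r0; have hi l := fourier_gauss_1d_integrable (xi ord0 l) r0.
have [_ e] := tensor_rV hi.
rewrite /fourier; transitivity (\prod_(l < n) cintegral (@lebesgue_measure R)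
  (fun y : R => (expR (- (pi * r ^+ 2 * y ^+ 2)))%:C *
    cis (- (2 * pi * (y * xi ord0 l))))).
  rewrite -e; apply: eq_cintegral => x.
  rewrite big_split /= -cis_sum; congr (_ * cis _).
    by rewrite /gaussian rmorph_prod.
  by rewrite /dotrV mulr_sumr sumrN.
under eq_bigr do rewrite fourier_gauss_1d//.
rewrite -rmorph_prod big_split /= prodr_const card_ord.
congr (_ * _)%:C; apply: eq_bigr => l _; congr (expR (- _)).
by rewrite exprMn exprVn; ring.
Qed.

(** The integrand is a product over coordinates, and by the one-dimensional computation so is the
    inner integral as a function of [eta]; both integrations therefore reduce to dimension one. *)
Lemma chirp_bilinear (a t : R) (x : 'rV[R]_n) : 0 < a ->
  let f (xi eta : 'rV[R]_n) :=
    \prod_(l < n) cexp (phase a t (x ord0 l) (xi ord0 l) (eta ord0 l)) in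
  [/\ forall eta, cintegrable mu (fun xi => f xi eta),
      cintegrable mu (fun eta => cintegral mu (fun xi => f xi eta)) &
      normc (cintegral mu (fun eta => cintegral mu (fun xi => f xi eta))) ^+ 2 =
      \prod_(l < n) (expR (- (4 * pi * x ord0 l ^+ 2 * a / (a ^+ 2 + 4 * t ^+ 2))) /
        (a * normc (a +i* (- (2 * t)))))].
Proof.
move=> a0 f.
have /choice[K /choice[p /choice[q Kpq]]] : forall l, exists K p q : R[i],
  [/\ Re p < 0,
      forall eta : R, cintegral (@lebesgue_measure R)
          (fun xi : R => cexp (phase a t (x ord0 l) xi eta)) =
        K * cexp (p * eta%:C ^+ 2 + q * eta%:C) &
      normc (K * cgauss p q) ^+ 2 =
        expR (- (4 * pi * x ord0 l ^+ 2 * a / (a ^+ 2 + 4 * t ^+ 2))) /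
        (a * normc (a +i* (- (2 * t))))].
  by move=> l; exact: phase_inner.
have inner (eta : 'rV[R]_n) := tensor_rV
  (fun l => phase_inner_integrable t (x ord0 l) (eta ord0 l) a0).
have outer_i l : cintegrable (@lebesgue_measure R)
    (fun eta : R => K l * cexp (p l * eta%:C ^+ 2 + q l * eta%:C)).
  by apply: cintegrableZ; apply: cgauss_integrable; case: (Kpq l).
have [oi oE] := tensor_rV outer_i.
have innerE : (fun eta => cintegral mu (fun xi => f xi eta)) =
  (fun eta => \prod_(l < n)
    (K l * cexp (p l * (eta ord0 l)%:C ^+ 2 + q l * (eta ord0 l)%:C))).
  apply/funext => eta; rewrite (inner eta).2; apply: eq_bigr => l _.
  by case: (Kpq l).
split=> [eta||]; first exact: (inner eta).1.
  by rewrite innerE.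
rewrite innerE oE normc_prod -prodrXl; apply: eq_bigr => l _.
have [p0 _ <-] := Kpq l; rewrite cintegralZ//; exact: cgauss_integrable.
Qed.

End gaussian_bilinear.

(** * Comparison of constants at one scale *)

Section one_scale.
Context {R : realType} (n : nat).
Hypothesis n0 : (0 < n)%N.
Variable j : nat.
Local Notation J := (j.+1).
Local Notation mu := (lebesgue_rV R n).
Local Notation Q i := (root_width i : R).
Local Notation rho := (inv_width J : R).
Local Notation chi := (chirp J : R).

(** The scale is [J = j.+1], so that a preceding scale [j] always exists; its envelope dominates
    those of all lower blocks. *)
Definition test_function (x : 'rV[R]_n) : R[i] := (gaussian (Q J ^+ 2) x)%:C.

Definition fourier_test (xi : 'rV[R]_n) : R :=
  rho ^+ n * \prod_(l < n) expR (- (pi * (rho * xi ord0 l) ^+ 2)).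

(* A lower bound, on a box of side [chirp J / 2], for the contribution of the [J]-th
   block to the operator applied to the test functions. *)
Definition level : R := 2^-1 ^+ J.+1 * (Q J ^+ 2)^-1 ^+ n * (4 * freq J)^-1 ^+ n.

Lemma fourier_testE xi : fourier test_function xi = (fourier_test xi)%:C.
Proof.
by rewrite fourier_gaussian// exprn_gt0// root_width_gt0.
Qed.

Lemma freq_gt0 i : 0 < freq i :> R. Proof. by rewrite exprn_gt0. Qed.

Lemma level_gt0 : 0 < level.
Proof.
have f0 : 0 < 4 * freq J :> R by rewrite mulr_gt0// freq_gt0.
apply: mulr_gt0; last by rewrite exprn_gt0// invr_gt0.
apply: mulr_gt0; rewrite exprn_gt0// invr_gt0//.
by rewrite exprn_gt0// root_width_gt0.
Qed.

(** In powers of 2 the inequalities read 3 J + 7 + 4 y <= 8 y with y = 4^(j + 2), and 3 J + 7 + 2 y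
    <= 4 y with y = 4^(J + 2). The first controls the lower blocks and the second the higher ones;
    the shift by 2 in [root_width] leaves room for the additive constants. *)
Lemma root_width_gap : 2 ^+ (J + 5) * (4 * freq J) * Q j ^+ 4 <= Q J ^+ 2 /\
  2 ^+ (J + 5) * (4 * freq J) * Q J ^+ 2 <= Q J.+1.
Proof.
have f4 : 4 * freq J = 2 ^+ (2 * J.+1) :> R.
  rewrite /freq -exprS (_ : 4 = 2 ^+ 2); first by rewrite -exprM.
  by rewrite expr2 -natrM.
have p (i : nat) : (i < 4 ^ i)%N by exact: ltn_expl.
rewrite f4 /root_width -!exprM -!exprD !ler_eXn2l ?ltr1n//.
have := p j; rewrite !addSn ![(4 ^ _.+1)%N]expnS !addn2 ![(4 ^ _.+1)%N]expnS.
by move: (4 ^ j)%N => y; lia.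
Qed.

(** Passes from one dimension to [k]: of the factor [X ^+ k] produced by taking powers only one [X]
    is kept, which [1 <= X] and [0 < k] allow. *)
Lemma pow_gap (X Y U V : R) k : 1 <= X -> 0 <= Y -> 0 <= U -> (0 < k)%N ->
  X * Y * U <= V -> X * Y ^+ k * U ^+ k <= V ^+ k.
Proof.
move=> X1 Y0 U0 k0 XYU; have X0 : 0 <= X by rewrite (le_trans ler01).
apply: (@le_trans _ _ ((X * Y * U) ^+ k)).
  rewrite !exprMn; apply: ler_wpM2r; first exact: exprn_ge0.
  apply: ler_wpM2r; first exact: exprn_ge0.
  by case: k k0 => // k _; rewrite exprS ler_peMr// exprn_ege1.
by rewrite lerXn2r ?nnegrE ?mulr_ge0// (le_trans _ XYU)// !mulr_ge0.
Qed.

Lemma half_pow_shift k (b c : R) : b != 0 -> c != 0 ->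
  2^-1 ^+ k.+1 * b^-1 * c^-1 = 16 * (2 ^+ (k + 5) * c * b)^-1.
Proof.
move=> b0 c0; have a0 : 2 ^+ k.+1 != 0 :> R by rewrite expf_neq0.
rewrite exprVn (_ : (k + 5 = 4 + k.+1)%N) ?exprD; last by lia.
move: (2 ^+ k.+1) a0 => a a0.
by field; rewrite a0 b0 c0.
Qed.

(** Let Y be the inverse of [2 ^+ (J + 5) * (4 * freq J) ^+ n * (Q J ^+ 2) ^+ n]. Both error terms
    are at most Y by the gaps, while [level] = 16 Y; the 5 in the exponent is chosen so that 4 (Y +
    Y) = 8 Y is exactly half of it. *)
Lemma error_le_level :
  4 * ((rho ^+ n * ((inv_width j : R)^-1) ^+ n) ^+ 2 + (Q J.+1)^-1 ^+ n) <= level / 2.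
Proof.
have [g1 g2] := root_width_gap.
have QJ := @root_width_gt0 R J; have Qj := @root_width_gt0 R j.
have QS := @root_width_gt0 R J.+1; have fJ := freq_gt0 J.
have X1 : 1 <= 2 ^+ (J + 5) :> R by rewrite exprn_ege1// ler1n.
have X0 : 0 < 2 ^+ (J + 5) :> R by rewrite exprn_gt0.
have Y0 : 0 < 4 * freq J :> R by rewrite mulr_gt0.
have h1 := pow_gap X1 (ltW Y0) (ltW (exprn_gt0 4 Qj)) n0 g1.
have h2 := pow_gap X1 (ltW Y0) (ltW (exprn_gt0 2 QJ)) n0 g2.
have b0 : (Q J ^+ 2) ^+ n != 0 by apply: expf_neq0; apply: expf_neq0; rewrite gt_eqF.
have c0 : (4 * freq J) ^+ n != 0 :> R by apply: expf_neq0; rewrite gt_eqF.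
have levelE : level = 16 * (2 ^+ (J + 5) * (4 * freq J) ^+ n * (Q J ^+ 2) ^+ n)^-1.
  rewrite /level (exprVn (Q J ^+ 2) n) (exprVn (4 * freq J) n).
  exact: half_pow_shift.
have e1 : (rho ^+ n * ((inv_width j : R)^-1) ^+ n) ^+ 2 =
    (Q j ^+ 4) ^+ n * ((Q J ^+ 2) ^+ n * (Q J ^+ 2) ^+ n)^-1.
  have -> : (Q j ^+ 4) ^+ n = ((Q j ^+ 2) ^+ n) ^+ 2.
    by rewrite [RHS]exprAC -[in RHS](exprM (Q j) 2 2).
  rewrite /inv_width invrK (exprVn (Q J ^+ 2)).
  move: ((Q J ^+ 2) ^+ n) ((Q j ^+ 2) ^+ n) b0 => b c b0.
  by field.
set A := (4 * freq J) ^+ n in h1 h2 levelE.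
set V := (Q J ^+ 2) ^+ n in h1 h2 levelE e1.
set U := (Q j ^+ 4) ^+ n in h1 e1.
have A0 : 0 < A by rewrite exprn_gt0.
have V0 : 0 < V by rewrite exprn_gt0// exprn_gt0.
set X := 2 ^+ (J + 5) in X0 X1 h1 h2 levelE.
have nzA := lt0r_neq0 A0; have nzV := lt0r_neq0 V0; have nzX := lt0r_neq0 X0.
have k1 : U * (V * V)^-1 <= (X * A * V)^-1.
  rewrite -[leRHS]mul1r ler_pdivlMr ?mulr_gt0//.
  rewrite (_ : U / (V * V) * (X * A * V) = X * A * U / V); last by field.
  by rewrite ler_pdivrMr// mul1r.
have k2 : (Q J.+1)^-1 ^+ n <= (X * A * V)^-1.
  rewrite exprVn lef_pV2 ?posrE ?mulr_gt0// exprn_gt0//.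
have := lerD k1 k2; rewrite e1 levelE; lra.
Qed.

Lemma cRe_sum (I : Type) (s : seq I) (F : I -> R[i]) :
  Re (\sum_(i <- s) F i) = \sum_(i <- s) Re (F i).
Proof. by apply: (big_morph (@complex.Re R)) => // a b; exact: cReD. Qed.

Lemma cIm_sum (I : Type) (s : seq I) (F : I -> R[i]) :
  Im (\sum_(i <- s) F i) = \sum_(i <- s) Im (F i).
Proof. by apply: (big_morph (@complex.Im R)) => // a b; exact: cImD. Qed.

Lemma gfactor_row_mx i (xi eta : 'rV[R]_n) :
  gfactor (@inv_width R) i (row_mx xi eta) =
  gfactor (@inv_width R) i xi * gfactor (@inv_width R) i eta.
Proof.
rewrite !gfactorE big_split_ord /=; congr (_ * _); apply: eq_bigr => l _.
  by rewrite row_mxEl.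
by rewrite row_mxEr.
Qed.

(** The envelope of the [J]-th block and the Fourier transforms of the test functions have the same
    width, so their product has decay rate [2 * rho ^+ 2]; the chirp rate is [chi * rho]. *)
Lemma main_term (x xi eta : 'rV[R]_n) :
  (cosine J (row_mx xi eta) +i* sine J (row_mx xi eta)) *
    (fourier_test xi)%:C * (fourier_test eta)%:C *
    cis (2 * pi * dotrV x (xi + eta)) =
  ((rho ^+ n) ^+ 2)%:C * \prod_(l < n)
    cexp (phase (2 * rho ^+ 2) (chi * rho) (x ord0 l) (xi ord0 l) (eta ord0 l)).
Proof.
have fE (v : 'rV[R]_n) : fourier_test v = rho ^+ n * gfactor (fun=> rho) 0 v.
  by rewrite /fourier_test gfactorE.
have csE z : cosine J z +i* sine J z =
    (gfactor (@inv_width R) J z)%:C * cis (phi J z) :> R[i].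
  by apply: complex_ext; rewrite !ReImE /= /cosine /sine; ring.
rewrite csE -cexp_sum !fE gfactor_row_mx.
set s := \sum_(l < n) _.
have sRe : Re s = - (pi * sqnorm (@inv_width R) J xi) - pi * sqnorm (@inv_width R) J eta
    - pi * sqnorm (@inv_width R) J xi - pi * sqnorm (@inv_width R) J eta.
  rewrite /s cRe_sum /sqnorm.
  rewrite !mulr_sumr -!sumrN -!big_split /=; apply: eq_bigr => l _; ring.
have sIm : Im s = phi J (row_mx xi eta) + 2 * pi * dotrV x (xi + eta).
  rewrite /s cIm_sum /phi /dotrV.
  rewrite !mulr_sumr -big_split /=; apply: eq_bigr => l _.
  by rewrite row_mxEl row_mxEr !mxE; ring.
rewrite /cexp sRe sIm !expRD /gfactor.
have cD (y z : R) : cis (y + z) = cis y * cis z :> R[i].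
  by rewrite !cis_cexp -cexpD; congr cexp; apply: complex_ext; rewrite !ReImE /= ?addr0.
rewrite cD !rmorphM /=.
by ring.
Qed.

End one_scale.

(** * The contribution of the other blocks *)

Section unboundedness.
Context {R : realType} (n : nat).
Hypothesis n0 : (0 < n)%N.
Variable j : nat.
Local Notation J := (j.+1).
Local Notation mu := (lebesgue_rV R n).
Local Notation Q i := (root_width i : R).
Local Notation rho := (inv_width J : R).
Local Notation chi := (chirp J : R).
Local Notation E v := (gfactor (@inv_width R) j v).
Local Notation W := ((Q J.+1)^-1 ^+ n).
Local Notation fb := (@fourier_test R n j).

Definition remainder (z : 'rV[R]_(n + n)) : R[i] :=
  multiplier z - (weight n J)%:C * (cosine J z +i* sine J z).

Lemma root_width_le i k : (i <= k)%N -> Q i <= Q k.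
Proof.
by move=> ik; rewrite ler_eXn2l ?ltr1n// leq_exp2l// leq_add2r.
Qed.

Lemma inv_width_le i k : (i <= k)%N -> inv_width k <= inv_width i :> R.
Proof.
move=> ik; rewrite lef_pV2 ?posrE ?exprn_gt0 ?root_width_gt0//.
by rewrite lerXn2r ?nnegrE ?(ltW (root_width_gt0 _))// root_width_le.
Qed.

Lemma gfactor_le N i k (x : 'rV[R]_N) : (i <= k)%N ->
  gfactor (@inv_width R) i x <= gfactor (@inv_width R) k x.
Proof.
move=> ik; rewrite ler_expR lerN2 ler_wpM2l ?pi_ge0// ler_sum// => l _.
rewrite !exprMn ler_wpM2r ?sqr_ge0// lerXn2r ?nnegrE ?(ltW (inv_width_gt0 _))//.
exact: inv_width_le.
Qed.

(** Below [J] the envelope is at most that of block [j] and the weight contributes at most 2^-(i +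
    1). Above [J] the envelope is at most 1, and the weight has the small factor [W]. *)
Lemma weight_env_le i (x : 'rV[R]_(n + n)) : i != J ->
  weight n i * gfactor (@inv_width R) i x <= 2^-1 ^+ i.+1 * (E x + W).
Proof.
move=> iJ; rewrite /weight -mulrA; apply: ler_wpM2l; first exact: exprn_ge0.
have Q1 k : 0 <= (Q k)^-1 <= 1.
  by rewrite invr_ge0 invf_le1 ?root_width_gt0// root_width_ge1 ltW// root_width_gt0.
have Qn k : 0 <= (Q k)^-1 ^+ n <= 1.
  by have /andP[a b] := Q1 k; rewrite exprn_ge0//= exprn_ile1.
have /andP[a b] := Qn i; have /andP[c _] := Qn J.+1.
have [ij|ij] := leqP i j.
  apply: (@le_trans _ _ (E x)); last by rewrite lerDl.
  by apply: le_trans (gfactor_le x ij); rewrite ler_piMl// gfactor_ge0.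
have Ji : (J < i)%N by rewrite ltn_neqAle eq_sym iJ.
apply: (@le_trans _ _ W); last by rewrite lerDr gfactor_ge0.
apply: (@le_trans _ _ ((Q i)^-1 ^+ n)); first by rewrite ler_piMr// gfactor_le1.
rewrite lerXn2r ?nnegrE ?invr_ge0 ?(ltW (root_width_gt0 _))//.
by rewrite lef_pV2 ?posrE ?root_width_gt0// root_width_le.
Qed.

Lemma gsum_D1 (F : nat -> 'rV[R]_(n + n) -> R) (x : 'rV[R]_(n + n)) :
  (forall i, `|F i x| <= gfactor (@inv_width R) i x) ->
  gsum (weight n) F x - weight n J * F J x =
  sumR (fun i => if i == J then 0 else weight n i * F i x).
Proof.
move=> Fb; have c : cvgn (series (fun i => weight n i * F i x)).
  apply: (summable_dominated _ (@weight_env_summable R n n0 x)) => i.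
  by rewrite normrM ger0_norm ?weight_ge0// ler_wpM2l ?weight_ge0.
rewrite /gsum (sumR_D1 J c).
by move: (sumR _) (weight n J * F J x) => S a; ring.
Qed.

Lemma remainder_le (x : 'rV[R]_(n + n)) : normc (remainder x) <= 2 * (E x + W).
Proof.
have [cw w1] := @half_summable R.
have -> : remainder x =
    sumR (fun i => if i == J then 0 else weight n i * cosine i x) +i*
    sumR (fun i => if i == J then 0 else weight n i * sine i x).
  rewrite -!gsum_D1; [|by move=> i; exact: sine_le|by move=> i; exact: cosine_le].
  by apply: complex_ext; rewrite !ReImE /=; ring.
have EW0 : 0 <= E x + W.
  rewrite addr_ge0 ?gfactor_ge0// exprn_ge0// invr_ge0.
  exact/ltW/root_width_gt0.
have cb : cvgn (series (fun i => (E x + W) * 2^-1 ^+ i.+1)) by exact: summableZ.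
have h (F : nat -> 'rV[R]_(n + n) -> R) i :
    (forall i, `|F i x| <= gfactor (@inv_width R) i x) ->
    `|if i == J then 0 else weight n i * F i x| <= (E x + W) * 2^-1 ^+ i.+1.
  move=> Fb; case: eqP => [_|/eqP iJ].
    by rewrite normr0 mulr_ge0// exprn_ge0.
  rewrite [leRHS]mulrC; apply: le_trans (weight_env_le x iJ).
  by rewrite normrM ger0_norm ?weight_ge0// ler_wpM2l ?weight_ge0.
have := normc_sumR_le (fun i => h _ i (fun k => cosine_le k x))
  (fun i => h _ i (fun k => sine_le k x)) cb.
by rewrite sumRZ// w1 mulr1.
Qed.

Lemma measurable_row_mx : measurable_fun setT
  (fun z : 'rV[R]_n * 'rV[R]_n => row_mx z.1 z.2).
Proof.
apply: measurable_fun_rV => k; case: (split_ordP k) => l ->.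
  under eq_fun do rewrite row_mxEl.
  exact: (measurableT_comp (measurable_coord l) measurable_fst).
under eq_fun do rewrite row_mxEr.
exact: (measurableT_comp (measurable_coord l) measurable_snd).
Qed.

Lemma fourier_test_measurable : measurable_fun setT fb.
Proof.
apply: measurable_funM; first exact: measurable_cst.
have [+ _] := gauss_rV n (@inv_width_gt0 R J).
exact: integrable_measurable.
Qed.

Lemma fourier_test_integral : mu.-integrable setT (EFin \o fb) /\
  \int[mu]_x fb x = 1.
Proof.
have [i e] := gauss_rV n (@inv_width_gt0 R J).
split; first exact: integrable_EFinZ.
rewrite /fourier_test RintegralZl// e -exprMn mulfV ?expr1n//.
by rewrite gt_eqF ?inv_width_gt0.
Qed.

Lemma fourier_test_ge0 v : 0 <= fb v.
Proof.
rewrite mulr_ge0 ?exprn_ge0 ?(ltW (inv_width_gt0 _))//.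
by rewrite prodr_ge0// => l _; exact: expR_ge0.
Qed.

Lemma fourier_test_le v : fb v <= rho ^+ n.
Proof.
rewrite ler_piMr ?exprn_ge0 ?(ltW (inv_width_gt0 _))//.
by have := gfactor_le1 (fun=> rho) 0 v; rewrite gfactorE.
Qed.

Definition error (x : 'rV[R]_n) (z : 'rV[R]_n * 'rV[R]_n) : R[i] :=
  remainder (row_mx z.1 z.2) * (fb z.1)%:C * (fb z.2)%:C *
  cis (2 * pi * dotrV x (z.1 + z.2)).

Lemma error_measurable x : cmeasurable (error x).
Proof.
have mc : cmeasurable (fun z : 'rV[R]_n * 'rV[R]_n => remainder (row_mx z.1 z.2)).
  have [mR mI] := @multiplier_measurable R n n0.
  apply: cmeasurableB.
    split; first exact: (measurableT_comp mR measurable_row_mx).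
    exact: (measurableT_comp mI measurable_row_mx).
  apply: cmeasurableM; first exact/cmeasurable_real/measurable_cst.
  split.
    apply: (@measurableT_comp _ _ _ _ _ _ (@cosine R n J)); last exact: measurable_row_mx.
    exact: (gclass_measurable (@phi_measurable R n) J (@cosine_gclass R n)).
  apply: (@measurableT_comp _ _ _ _ _ _ (@sine R n J)); last exact: measurable_row_mx.
  exact: (gclass_measurable (@phi_measurable R n) J (@sine_gclass R n)).
apply: cmeasurableM.
  apply: cmeasurableM.
    apply: cmeasurableM => //; apply: cmeasurable_real.
    exact: (measurableT_comp fourier_test_measurable measurable_fst).
  apply: cmeasurable_real.
  exact: (measurableT_comp fourier_test_measurable measurable_snd).
apply: cmeasurable_cis; apply: measurable_funM; first exact: measurable_cst.
apply: measurable_sum => l; apply: measurable_funM; first exact: measurable_cst.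
under eq_fun do rewrite mxE.
apply: measurable_funD.
  exact: (measurableT_comp (measurable_coord l) measurable_fst).
exact: (measurableT_comp (measurable_coord l) measurable_snd).
Qed.

(** The bound is uniform in [x], as the oscillating factor has modulus 1. For the lower blocks the
    Fourier transforms are bounded by [rho ^+ n] and the envelope is integrated; for the higher ones
    the Fourier transforms integrate to 1 and [W] remains. Two factors 2, from the remainder and
    from the integral, each for real and imaginary parts, make up the 4 in [error_le_level]. *)
Lemma error_bound x :
  [/\ forall eta, cintegrable mu (fun xi => error x (xi, eta)),
      cintegrable mu (fun eta => cintegral mu (fun xi => error x (xi, eta))) &
      normc (cintegral mu (fun eta => cintegral mu (fun xi => error x (xi, eta))))
      <= level n j / 2].
Proof.
have [mR mI] := error_measurable x.
have [gi g1] := fourier_test_integral.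
have [Ei E1] := gauss_rV n (@inv_width_gt0 R j).
pose e (v : 'rV[R]_n) := rho ^+ n * E v.
have ei : mu.-integrable setT (EFin \o e).
  apply: integrable_EFinZ.
  by apply: eq_integrable Ei => // v _; rewrite /= gfactorE.
have e1 : \int[mu]_v e v = rho ^+ n * (inv_width j)^-1 ^+ n.
  rewrite -E1 -RintegralZl//; apply: eq_Rintegral => v _.
  by rewrite /e gfactorE.
have W0 : 0 <= W by rewrite exprn_ge0// invr_ge0 ltW ?root_width_gt0.
have dom (xi eta : 'rV[R]_n) :
    normc (error x (xi, eta)) <= 2 * e xi * e eta + 2 * W * fb xi * fb eta.
  have g0 := fourier_test_ge0.
  have -> : normc (error x (xi, eta)) =
      normc (remainder (row_mx xi eta)) * (fb xi * fb eta).
    rewrite /error 3!normcM !normc_real !ger0_norm//.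
    by rewrite [normc (cis _)](_ : _ = 1) ?mulr1 ?mulrA// cis_cexp normc_cexp expR0.
  apply: (@le_trans _ _ (2 * (E xi * E eta + W) * (fb xi * fb eta))).
    apply: ler_wpM2r; first exact: mulr_ge0.
    by rewrite -gfactor_row_mx; exact: remainder_le.
  have h : E xi * E eta * (fb xi * fb eta) <= e xi * e eta.
    have k v : 0 <= E v * fb v <= e v.
      rewrite mulr_ge0 ?gfactor_ge0//= mulrC ler_wpM2r ?gfactor_ge0//.
      exact: fourier_test_le.
    have /andP[a1 a2] := k xi; have /andP[b1 b2] := k eta.
    by rewrite [leLHS]mulrACA; exact: ler_pM.
  rewrite (_ : _ * _ = 2 * (E xi * E eta * (fb xi * fb eta)) +
    2 * W * fb xi * fb eta); last by ring.
  by rewrite lerD2r -[leRHS]mulrA ler_wpM2l.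
have [h1 h2 h3] := @complex_iterated_bound _ _ _ _ R mu mu
  (fun v => 2 * e v) (fun v => 2 * W * fb v) e fb
  (integrable_EFinZ _ ei) (integrable_EFinZ _ gi) ei gi _ mR mI dom.
split=> //; apply: le_trans (error_le_level n0 j).
apply: (le_trans h3).
have -> : \int[mu]_v (2 * e v) = 2 * \int[mu]_v e v by exact: RintegralZl.
have -> : \int[mu]_v (2 * W * fb v) = 2 * W * \int[mu]_v fb v.
  exact: RintegralZl.
rewrite e1 g1 !mulr1.
by move: (rho ^+ n) ((inv_width j)^-1 ^+ n) (W) => p q w; lra.
Qed.

End unboundedness.

(** * Pointwise lower bound on a box *)

Section lower_bound.
Context {R : realType}.

(* No measurability is needed: the integral of a nonnegative function is the
   supremum of the integrals of the simple functions below it. *)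
Lemma ge0_le_integralT d (T : measurableType d) (mu : {measure set T -> \bar R})
    (f g : T -> \bar R) : (forall x, 0 <= f x)%E -> (forall x, f x <= g x)%E ->
  (\int[mu]_x f x <= \int[mu]_x g x)%E.
Proof.
move=> f0 fg; rewrite !ge0_integralTE//; last first.
  by move=> x; exact: le_trans (fg x).
apply: le_ereal_sup => _ /= [h hf <-]; exists h => // x.
exact: le_trans (fg x).
Qed.

Lemma markov_lower d (T : measurableType d) (mu : {measure set T -> \bar R})
    (g : T -> \bar R) (A : set T) (k : R) : measurable A -> 0 <= k ->
  (forall x, 0 <= g x)%E -> (forall x, A x -> k%:E <= g x)%E ->
  (k%:E * mu A <= \int[mu]_x g x)%E.
Proof.
move=> mA k0 g0 kg.
have -> : (k%:E * mu A = \int[mu]_x (k%:E * (\1_A x)%:E))%E.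
  rewrite ge0_integralZl//.
  - by rewrite integral_indic// setIT.
  - by apply/measurable_EFinP; exact: measurable_indic.
apply: ge0_le_integralT => x.
  by rewrite mule_ge0// lee_fin.
rewrite indicE; have [xA|xA] := boolP (x \in A); last by rewrite mule0.
by rewrite mule1 kg//; rewrite inE in xA.
Qed.

(** The modulus in the denominator is at most 2 rho^2 + 2 chi rho <= 4 chi rho. The exponent is at
    most 2 pi y^2 / chi^2 <= pi / 8 <= 1/2 in absolute value on [|y| <= chi / 4], so the exponential
    is at least 1/2 by exp (-w) >= 1 - w. Together they give 1 / (16 chi rho^3). *)
Lemma chirp_factor_ge (rho chi y : R) : 0 < rho -> rho <= 1 -> 1 <= chi ->
  `|y| <= chi / 4 ->
  (16 * chi * rho ^+ 3)^-1 <=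
  expR (- (4 * pi * y ^+ 2 * (2 * rho ^+ 2) /
    ((2 * rho ^+ 2) ^+ 2 + 4 * (chi * rho) ^+ 2))) /
  (2 * rho ^+ 2 * normc (2 * rho ^+ 2 +i* (- (2 * (chi * rho))))).
Proof.
move=> r0 r1 c1 yc; have c0 : 0 < chi by exact: lt_le_trans c1.
have r2 : 0 < rho ^+ 2 by rewrite exprn_gt0.
have r3 : 0 < rho ^+ 3 by rewrite exprn_gt0.
have cr : 0 < chi * rho by rewrite mulr_gt0.
set v := normc _.
have v0 : 0 < v.
  rewrite /v lt_neqAle normc_ge0 andbT eq_sym; apply/eqP.
  move=> /ComplexField.Normc.eq0_normc /(congr1 (@complex.Re R)) /= /eqP.
  by rewrite gt_eqF// mulr_gt0.
have v1 : v <= 4 * chi * rho.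
  apply: (le_trans (normc_le_ReIm _)) => /=.
  rewrite normrN (ger0_norm (ltW (mulr_gt0 _ r2)))// (ger0_norm (ltW (mulr_gt0 _ cr)))//.
  have : rho ^+ 2 <= chi * rho.
    rewrite expr2 ler_wpM2r ?(ltW r0)//; exact: le_trans c1.
  lra.
have e0 : 1 / 2 <= expR (- (4 * pi * y ^+ 2 * (2 * rho ^+ 2) /
    ((2 * rho ^+ 2) ^+ 2 + 4 * (chi * rho) ^+ 2))).
  apply: le_trans (expR_ge1Dx _).
  set w := (4 * pi * _ * _) / _; suff : w <= 1 / 2 by lra.
  rewrite /w ler_pdivrMr; last first.
    by rewrite addr_gt0// ?mulr_gt0// exprn_gt0// mulr_gt0.
  have y2 : y ^+ 2 <= (chi / 4) ^+ 2.
    by rewrite -(real_normK (num_real y)) lerXn2r ?nnegrE// divr_ge0// ltW.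
  have p4 : pi <= 4 :> R by have := pihalf_lt2 R; lra.
  have p0 : 0 <= pi :> R by exact: pi_ge0.
  have h1 : pi * y ^+ 2 <= 4 * (chi / 4) ^+ 2 by rewrite ler_pM// sqr_ge0.
  have h2 : pi * y ^+ 2 * rho ^+ 2 <= 4 * (chi / 4) ^+ 2 * rho ^+ 2.
    by rewrite ler_wpM2r// ltW.
  have h3 : 0 <= (2 * rho ^+ 2) ^+ 2 by rewrite sqr_ge0.
  have e4 : 4 * (chi / 4) ^+ 2 * rho ^+ 2 = (chi * rho) ^+ 2 / 4 by field.
  move: h2 h3; rewrite e4; move: ((2 * rho ^+ 2) ^+ 2) ((chi * rho) ^+ 2) => s t.
  have -> : 4 * pi * y ^+ 2 * (2 * rho ^+ 2) = 8 * (pi * y ^+ 2 * rho ^+ 2) by ring.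
  lra.
rewrite ler_pdivlMr ?mulr_gt0//.
apply: le_trans e0.
rewrite ler_pdivrMl; last by rewrite !mulr_gt0.
have -> : 16 * chi * rho ^+ 3 * (1 / 2) = 2 * rho ^+ 2 * (4 * chi * rho) by field.
by rewrite ler_wpM2l// mulr_ge0// ltW.
Qed.

Lemma normc_opp (z : R[i]) : normc (- z) = normc z.
Proof. by rewrite !normc_sqrtE cReN cImN !sqrrN. Qed.

Variables (n : nat) (j : nat).
Hypothesis n0 : (0 < n)%N.
Local Notation J := (j.+1).
Local Notation mu := (lebesgue_rV R n).
Local Notation Q := (root_width J : R).
Local Notation rho := (inv_width J : R).
Local Notation chi := (chirp J : R).
Local Notation test_function := (@test_function R n j).

(** The operator splits as [c] times the explicit iterated integral [T1] plus the error [T2]. Since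
    [c * normc T1] is at least [level] and [normc T2] at most half of it, the reverse triangle
    inequality leaves the other half. *)
Lemma bilinear_test_ge (x : 'rV[R]_n) : (forall l, `|x ord0 l| <= chi / 4) ->
  level n j / 2 <= normc (bilinear_multiplier (@multiplier R n) test_function test_function x).
Proof.
move=> xc; have r0 := @inv_width_gt0 R J; have Q0 := @root_width_gt0 R J.
have r1 : rho <= 1.
  by rewrite invf_le1 ?exprn_gt0// exprn_ege1// root_width_ge1.
pose a := 2 * rho ^+ 2; pose t := chi * rho.
have a0 : 0 < a by rewrite mulr_gt0// exprn_gt0.
have [I1 I2 I3] := chirp_bilinear t x a0.
have [E1 E2 E3] := error_bound n0 j x.
pose f (xi eta : 'rV[R]_n) :=
  \prod_(l < n) cexp (phase a t (x ord0 l) (xi ord0 l) (eta ord0 l)).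
pose c := weight n J * (rho ^+ n) ^+ 2.
have c0 : 0 <= c by rewrite mulr_ge0 ?weight_ge0 ?sqr_ge0.
have TE : bilinear_multiplier (@multiplier R n) test_function test_function x =
    c%:C * cintegral mu (fun eta => cintegral mu (fun xi => f xi eta)) +
    cintegral mu (fun eta => cintegral mu (fun xi => error j x (xi, eta))).
  rewrite -cintegralZ// -cintegralD//; last exact: cintegrableZ.
  apply: eq_cintegral => eta.
  have ci := I1 eta; have ei := E1 eta.
  transitivity (c%:C * cintegral mu (fun xi => f xi eta) +
    cintegral mu (fun xi => error j x (xi, eta))) => //.
  rewrite -(cintegralZ c%:C ci) -(cintegralD (cintegrableZ c%:C ci) ei).
  apply: eq_cintegral => xi; rewrite !fourier_testE.
  have cE : c%:C = (weight n J)%:C * ((rho ^+ n) ^+ 2)%:C by rewrite -rmorphM.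
  rewrite /error /remainder cE -[_ * f xi eta]mulrA.
  rewrite -(@main_term R n j x xi eta) [(xi, eta).1]/= [(xi, eta).2]/=.
  by ring.
set T1 := cintegral mu (fun eta => cintegral mu (fun xi => f xi eta)) in TE I3.
set T2 := cintegral mu (fun eta => cintegral mu (fun xi => error j x (xi, eta))) in TE E3.
have T1ge : (Q ^+ 3 / (4 * freq J)) ^+ n <= normc T1.
  have f0 : 0 < freq J :> R by exact: freq_gt0.
  (* Only the squared modulus is explicit. Per coordinate its lower bound is 1 / (16 chi rho^3), the
     exact square of [Q ^+ 3 / (4 * freq J)]. *)
  rewrite -(@ler_pXn2r _ 2)// ?nnegrE ?normc_ge0 ?exprn_ge0 ?divr_ge0 ?exprn_ge0//;
    rewrite ?mulr_ge0 ?(ltW f0) ?(ltW Q0)//.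
  rewrite I3 exprAC -[in leLHS](card_ord n) -prodr_const.
  apply: ler_prod => l _; rewrite sqr_ge0 /=.
  apply: le_trans (chirp_factor_ge r0 r1 (@chirp_ge1 R J) (xc l)).
  rewrite le_eqVlt; apply/orP; left; apply/eqP.
  rewrite /inv_width /chirp; field.
  by rewrite !gt_eqF.
have levelE : level n j = c * (Q ^+ 3 / (4 * freq J)) ^+ n.
  have b0 : Q ^+ n != 0 by rewrite expf_neq0// gt_eqF.
  have d0 : (4 * freq J) ^+ n != 0 :> R.
    by rewrite expf_neq0// gt_eqF// mulr_gt0// freq_gt0.
  have e3 : (Q ^+ 3 / (4 * freq J)) ^+ n = (Q ^+ n) ^+ 3 / (4 * freq J) ^+ n.
    by rewrite expr_div_n exprAC.
  have e2 : (Q ^+ 2)^-1 ^+ n = ((Q ^+ n) ^+ 2)^-1 by rewrite exprVn exprAC.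
  rewrite e3 /level /c /weight -/Q /inv_width e2.
  rewrite (exprVn (4 * freq J) n) (exprVn Q n).
  move: (2^-1 ^+ J.+1) (Q ^+ n) ((4 * freq J) ^+ n) b0 d0 => q b d b0 d0.
  by field; rewrite b0 d0.
have key : normc (c%:C * T1) <=
    normc (bilinear_multiplier (@multiplier R n) test_function test_function x) + normc T2.
  have -> : c%:C * T1 = bilinear_multiplier (@multiplier R n) test_function test_function x + - T2.
    by rewrite TE addrK.
  by apply: (le_trans (normcD _ _)); rewrite normc_opp.
have := ler_wpM2l c0 T1ge; rewrite -levelE.
rewrite (normcM c%:C T1) normc_real (ger0_norm c0) in key.
move=> low; rewrite -(lerD2r (level n j / 2)) -splitr.
by apply: (le_trans low); apply: (le_trans key); rewrite lerD2l.
Qed.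

End lower_bound.

(** * Unboundedness *)

Section contradiction.
Context {R : realType} (n j : nat).
Hypothesis n0 : (0 < n)%N.
Local Notation J := (j.+1).
Local Notation mu := (lebesgue_rV R n).
Local Notation Q := (root_width J : R).
Local Notation chi := (chirp J : R).
Local Notation tf := (@test_function R n j).

(** The product of the two norms is the integral of the squared Gaussian, and [0 <= tf <= 1] bounds
    it by the integral of the Gaussian itself; the lost constant depends on [n] alone and is
    harmless. *)
Lemma test_function_L2 :
  (cLnorm mu 2 tf * cLnorm mu 2 tf <= ((Q ^+ 2)^-1 ^+ n)%:E)%E.
Proof.
have Q0 : 0 < Q ^+ 2 by rewrite exprn_gt0// root_width_gt0.
have [gi gE] := gauss_rV n Q0.
have half1 : 2^-1 + 2^-1 = 1 :> R by field.
rewrite /cLnorm unlock -poweRD; last first.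
  by apply: add_neq0_poweRD_def; rewrite half1 oner_neq0.
rewrite half1.
rewrite poweRe1; last by apply: integral_ge0 => x _; exact: poweR_ge0.
rewrite -gE /Rintegral fineK; last exact: integrable_fin_num.
apply: ge0_le_integralT => x; first exact: poweR_ge0.
have gE' : normc (tf x) = \prod_(l < n) expR (- (pi * (Q ^+ 2 * x ord0 l) ^+ 2)).
  rewrite /test_function normc_real gaussianE gfactorE ger0_norm//.
  by rewrite prodr_ge0// => l _; exact: expR_ge0.
rewrite abse_EFin poweR_EFin ger0_norm ?normc_ge0// powR_mulrn ?normc_ge0//.
rewrite lee_fin -gE'.
rewrite expr2 ler_piMr ?normc_ge0// gE'.
by have := gfactor_le1 (fun=> Q ^+ 2) 0 x; rewrite gfactorE.
Qed.

Definition box : set 'rV[R]_n :=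
  [set v | forall l, (`[- (chi / 4), chi / 4]%classic : set R) (v ord0 l)].

Lemma chirp_gt0 : 0 < chi. Proof. exact: lt_le_trans (chirp_ge1 _). Qed.

Lemma box_measurable : measurable box.
Proof.
rewrite (_ : box = \bigcap_(i in [set: 'I_n])
    [set v | (`[- (chi / 4), chi / 4]%classic : set R) (v ord0 i)]).
  apply: fin_bigcap_measurable; first exact: finite_finset.
  move=> i _; apply: (measurable_preimageT (measurable_coord i)).
  exact: measurable_itv.
by apply/seteqP; split => [v Av i _|v Av i]; exact: Av.
Qed.

Lemma box_measure : mu box = ((chi / 2) ^+ n)%:E.
Proof.
have c0 := chirp_gt0.
rewrite (lebesgue_rV_box (A := fun _ => `[- (chi / 4), chi / 4]%classic)).
  transitivity (\prod_(i < n) (chi / 2)%:E)%E.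
    apply: eq_bigr => l _; rewrite lebesgue_measure_itv /= lte_fin.
    rewrite ifT; last by rewrite -subr_gt0 opprK addr_gt0// divr_gt0.
    by rewrite -EFinD; congr EFin; field.
  by rewrite prodEFin prodr_const card_ord.
by move=> i; exact: measurable_itv.
Qed.

Lemma bilinear_test_L1 : (((level n j / 2) * (chi / 2) ^+ n)%:E <=
  cLnorm mu 1 (bilinear_multiplier (@multiplier R n) tf tf))%E.
Proof.
rewrite /cLnorm Lnorm1 EFinM -box_measure.
apply: markov_lower.
- exact: box_measurable.
- by rewrite divr_ge0// ltW// level_gt0.
- by move=> x; exact: abse_ge0.
- move=> x bx; rewrite abse_EFin lee_fin ger0_norm ?normc_ge0//.
  apply: bilinear_test_ge => // l.
  by have := bx l; rewrite /= in_itv/= -ler_norml.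
Qed.

(** The factor [(Q ^+ 2)^-1 ^+ n] occurs on both sides and cancels. The volume of the box turns
    [(4 * freq J)^-1 ^+ n] into [(freq J / 8) ^+ n]; this base is at least 1 once J >= 2, so one
    factor may replace the power, and 2^-(J + 2) 4^J / 8 = 2^J / 32 is left. *)
Lemma growth_of_ratio (C : R) : (1 < J)%N ->
  (forall f g : 'rV[R]_n -> R[i], schwartz f -> schwartz g ->
    (cLnorm mu 1 (bilinear_multiplier (@multiplier R n) f g) <=
     C%:E * cLnorm mu 2 f * cLnorm mu 2 g)%E) ->
  2 ^+ J <= 32 * `|C|.
Proof.
move=> J2 bC; have Q0 : 0 < Q ^+ 2 by rewrite exprn_gt0// root_width_gt0.
have stf : schwartz tf by exact: gaussian_schwartz.
have := le_trans bilinear_test_L1 (bC _ _ stf stf).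
rewrite -muleA => h.
have N0 : (0 <= cLnorm mu 2 tf)%E by exact: Lnorm_ge0.
have NN0 : (0 <= cLnorm mu 2 tf * cLnorm mu 2 tf)%E by exact: mule_ge0.
have {}h : (((level n j / 2) * (chi / 2) ^+ n)%:E <=
    `|C|%:E * ((Q ^+ 2)^-1 ^+ n)%:E)%E.
  apply: (le_trans h); apply: (@le_trans _ _ (`|C|%:E * (cLnorm mu 2 tf * cLnorm mu 2 tf))%E).
    by apply: lee_wpmul2r => //; rewrite lee_fin ler_norm.
  by apply: lee_wpmul2l; [rewrite lee_fin|exact: test_function_L2].
rewrite -EFinM lee_fin in h.
have B0 : 0 < (Q ^+ 2)^-1 ^+ n by rewrite exprn_gt0// invr_gt0.
have f0 : 0 < freq J :> R by exact: freq_gt0.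
have e : level n j / 2 * (chi / 2) ^+ n =
    (2^-1 ^+ J.+1 / 2 * (freq J / 8) ^+ n) * (Q ^+ 2)^-1 ^+ n.
  have -> : (chi / 2) ^+ n = (4 * freq J) ^+ n * (freq J / 8) ^+ n.
    by rewrite -exprMn; congr (_ ^+ n); rewrite /chirp; field.
  have d0 : (4 * freq J) ^+ n != 0 :> R.
    by rewrite expf_neq0// gt_eqF// mulr_gt0.
  rewrite /level (exprVn (4 * freq J) n).
  move: (2^-1 ^+ J.+1) ((Q ^+ 2)^-1 ^+ n) ((4 * freq J) ^+ n) ((freq J / 8) ^+ n) d0
    => p q r s r0.
  by field.
rewrite e ler_pM2r// in h.
have f8 : 1 <= freq J / 8 :> R.
  rewrite ler_pdivlMr// mul1r /freq (@le_trans _ _ (4 ^+ 2))//.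
    by rewrite -natrX ler_nat.
  by rewrite ler_eXn2l// ltr1n.
have h2 : 2^-1 ^+ J.+1 / 2 * (freq J / 8) <= `|C|.
  apply: le_trans h; rewrite ler_wpM2l// ?divr_ge0 ?exprn_ge0//.
  by case: n n0 => // k _; rewrite exprS ler_peMr ?exprn_ege1// (le_trans ler01).
have -> : 2 ^+ J = 32 * (2^-1 ^+ J.+1 / 2 * (freq J / 8)) :> R.
  have -> : freq J = 2 ^+ J * 2 ^+ J :> R by rewrite -exprMn -natrM.
  rewrite [2^-1 ^+ J.+1]exprS exprVn.
  have : 2 ^+ J != 0 :> R by rewrite expf_neq0.
  by move: (2 ^+ J) => p p0; field.
by rewrite ler_wpM2l.
Qed.

End contradiction.

Theorem theorem1p3 (R : realType) (n : nat) (hn : (0 < n)%N) :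
  exists m : 'rV[R]_(n + n) -> R[i],
    [/\ csmooth m,
        cbounded m,
        in_cLp (lebesgue_rV R (n + n)) 4 m,
        (forall s : seq 'I_(n + n), cbounded (cpartials s m)) &
        ~ bounded_L2xL2_L1 (bilinear_multiplier m)].
Proof.
exists (@multiplier R n); split.
- exact: multiplier_csmooth.
- exact: (@multiplier_cpartials_bounded R n hn [::]).
- exact: multiplier_L4.
- exact: multiplier_cpartials_bounded.
move=> [C bC].
(* The successor makes [j] exceed [32 * |C|] and also ensures [1 < j.+1]; then 2^(j + 1) > j + 1 > j
   contradicts the growth bound. *)
pose j := (Num.trunc (32 * `|C|)).+1.
have := @growth_of_ratio R n j hn C isT bC; apply/negP; rewrite -ltNge.
apply: (lt_trans (truncnS_gt _)); rewrite -/j -natrX ltr_nat.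
exact: ltn_trans (ltnSn j) (ltn_expl _ _).
Qed.
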